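(* If $M,N$ are objects of $\mathcal I_{\mathrm{bdd}}$ which admit a filtration by global Weyl modules, then $M\otimes N$ also admits a filtration by global Weyl modules.
   Context: All vector spaces and tensor products are over $\mathbb C$; $\mathbb Z_+$ is the set of non-negative integers. $\mathfrak{sl}_2$ has standard basis $x,y,h$ with $[h,x]=2x$, $[h,y]=-2y$, $[x,y]=h$. $\mathfrak{sl}_2[t]=\mathfrak{sl}_2\otimes\mathbb C[t]$ with bracket $[a\otimes t^r,b\otimes t^s]=[a,b]\otimes t^{r+s}$. A graded representation is a $\mathbb Z$-graded space $V=\bigoplus_rV[r]$ with $(a\otimes t^r)V[s]\subset V[r+s]$; $V_\mu=\{v\in V:(h\otimes1)v=\mu v\}$. Tensor products of graded representations are graded by total degree. $\mathcal I_{\mathrm{bdd}}$ is the category of graded representations $V$ of $\mathfrak{sl}_2[t]$ with $V[p]=0$ for $p\ll0$, $\dim V[p]<\infty$ for all $p$, and $V_\mu=0$ for all but finitely many $\mu\in\mathbb Z$; morphisms are degree-zero $\mathfrak{sl}_2[t]$-maps. Grade shift: $(\tau_s^*V)[r]=V[r-s]$. For $\lambda\in\mathbb Z_+$, the global Weyl module $W(\lambda)$ is generated by $w_\lambda$ (grade $0$) with relations $(x\otimes\mathbb C[t])w_\lambda=0$, $(h\otimes1)w_\lambda=\lambda w_\lambda$, $(y\otimes1)^{\lambda+1}w_\lambda=0$; $W(\lambda,r)=\tau_r^*W(\lambda)$. A filtration by global Weyl modules on $M\in\mathcal I_{\mathrm{bdd}}$ is a finite decreasing chain of submodules $M=M^0\supset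 M^1\supset\cdots\supset M^k\supset M^{k+1}=0$ such that each $M^s/M^{s+1}\cong\bigoplus_{p\in\mathbb Z}W(\lambda_s,p)^{\oplus m_{s,p}}$ for some $\lambda_s\in\mathbb Z_+$ and $m_{s,p}\in\mathbb Z_+$ (infinitely many $m_{s,p}$ may be non-zero). *)

(* Defs.v *)
From HB Require Import structures.
From mathcomp Require Import all_boot all_order all_algebra.
From mathcomp Require Import finmap.
From mathcomp Require Import boolp classical_sets functions cardinality fsbigop.
From mathcomp Require Import reals complex.

Set Implicit Arguments.
Unset Strict Implicit.
Unset Printing Implicit Defensive.

Import Order.TTheory GRing.Theory Num.Theory.

Local Open Scope classical_set_scope.
Local Open Scope ring_scope.

Section Subspaces.
Variables (K : fieldType) (V : lmodType K).

Record subspace := Subspace {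
  subspace_set :> V -> Prop;
  subspace0 : subspace_set 0;
  subspaceP : forall c u v,
    subspace_set u -> subspace_set v -> subspace_set (c *: u + v) }.

Variable S : subspace.

Lemma subspaceZ c u : S u -> S (c *: u).
Proof. by move=> Su; rewrite -[_ *: _]addr0; apply: subspaceP => //; apply: subspace0. Qed.

Lemma subspaceD u v : S u -> S v -> S (u + v).
Proof. by move=> Su Sv; rewrite -[u]scale1r; apply: subspaceP. Qed.

Lemma subspace_sum (I : Type) (s : seq I) (F : I -> V) :
  (forall i, S (F i)) -> S (\sum_(i <- s) F i).
Proof. by move=> SF; elim/big_ind: _ => //; [apply: subspace0|apply: subspaceD]. Qed.

Definition subspace_pred : {pred V} := fun v => `[< S v >].

Lemma subspace_predE v : (v \in subspace_pred) = `[< S v >].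
Proof. by []. Qed.

Fact subspace_pred_closed : submod_closed subspace_pred.
Proof.
split=> [|c u v]; rewrite !subspace_predE.
  by apply/asboolP/subspace0.
by move=> /asboolP Su /asboolP Sv; apply/asboolP/subspaceP.
Qed.

HB.instance Definition _ :=
  GRing.isSubmodClosed.Build K V subspace_pred subspace_pred_closed.

Record vsub := VSub { vsub_val : V; vsub_valP : vsub_val \in subspace_pred }.
HB.instance Definition _ := [isSub for vsub_val].
HB.instance Definition _ := [Choice of vsub by <:].
HB.instance Definition _ := [SubChoice_isSubLmodule of vsub by <:].

Lemma vsubP (u : vsub) : S (val u).
Proof. by have /asboolP := vsub_valP u. Qed.

Definition mkvsub v (Sv : S v) : vsub := VSub (asboolT Sv : v \in subspace_pred).

Definition vquot := Quotient.quot subspace_pred.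
HB.instance Definition _ := GRing.Zmodule.on vquot.
HB.instance Definition _ := EqQuotient.on vquot.

Definition vpi (v : V) : vquot := (\pi_vquot v)%qT.

Lemma vpi_eq u v : vpi u = vpi v <-> S (u - v).
Proof.
rewrite /vpi; split=> [/eqP|Suv].
  by rewrite -Quotient.idealrBE => /asboolP.
by apply/eqP; rewrite -Quotient.idealrBE; apply/asboolP.
Qed.

Lemma vpi_repr (q : vquot) : vpi (repr q) = q.
Proof. exact: reprK. Qed.

Lemma vpiD u v : vpi (u + v) = vpi u + vpi v.
Proof. by rewrite /vpi !piE. Qed.

Definition vquot_scale (c : K) (q : vquot) : vquot := vpi (c *: repr q).

Lemma vpiZ c v : vpi (c *: v) = vquot_scale c (vpi v).
Proof.
apply/vpi_eq; rewrite -scalerBr; apply: subspaceZ.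
by apply/vpi_eq; rewrite vpi_repr.
Qed.

Fact vquot_scaleA a b v : vquot_scale a (vquot_scale b v) = vquot_scale (a * b) v.
Proof. by rewrite -[v]vpi_repr -!vpiZ scalerA. Qed.
Fact vquot_scale1 : left_id 1 vquot_scale.
Proof. by move=> v; rewrite -[v]vpi_repr -!vpiZ scale1r. Qed.
Fact vquot_scaleDr : right_distributive vquot_scale +%R.
Proof. by move=> a u v; rewrite -[u]vpi_repr -[v]vpi_repr -vpiD -!vpiZ -vpiD scalerDr. Qed.
Fact vquot_scaleDl v : {morph vquot_scale^~ v : a b / a + b}.
Proof. by move=> a b; rewrite -[v]vpi_repr -!vpiZ -vpiD scalerDl. Qed.

HB.instance Definition _ := GRing.Zmodule_isLmodule.Build K vquot
  vquot_scaleA vquot_scale1 vquot_scaleDr vquot_scaleDl.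

Fact vpi_linear : linear vpi.
Proof. by move=> c u v; rewrite vpiD vpiZ. Qed.
HB.instance Definition _ := GRing.isLinear.Build K V vquot *:%R vpi vpi_linear.

End Subspaces.

Arguments vpi {K V S} v.
Arguments mkvsub {K V S v} Sv.

Section Linear.
Variable K : fieldType.
Implicit Types U V W : lmodType K.

Definition mklin V W (f : V -> W) (lf : linear f) : {linear V -> W} :=
  HB.pack f (GRing.isLinear.Build K V W *:%R f lf).

Lemma lin0 V W (f : V -> W) : linear f -> f 0 = 0.
Proof. by move=> lf; exact: (linear0 (mklin lf)). Qed.
Lemma linD V W (f : V -> W) : linear f -> {morph f : u v / u + v}.
Proof. by move=> lf; exact: (linearD (mklin lf)). Qed.
Lemma linZ V W (f : V -> W) : linear f -> forall c, {morph f : u / c *: u}.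
Proof. by move=> lf c u; exact: (linearZ_LR (mklin lf)). Qed.
Lemma linB V W (f : V -> W) : linear f -> {morph f : u v / u - v}.
Proof. by move=> lf; exact: (linearB (mklin lf)). Qed.
Lemma lin_sum V W (f : V -> W) I (s : seq I) (F : I -> V) :
  linear f -> f (\sum_(i <- s) F i) = \sum_(i <- s) f (F i).
Proof. by move=> lf; exact: (linear_sum (mklin lf)). Qed.

Lemma lin_comp U V W (f : V -> W) (g : U -> V) :
  linear f -> linear g -> linear (f \o g).
Proof. by move=> lf lg c u v /=; rewrite lg lf. Qed.
Lemma lin_id V : linear (@id V). Proof. by []. Qed.
Lemma lin_cst0 V W : linear (fun _ : V => 0 : W).
Proof. by move=> c u v; rewrite scaler0 addr0. Qed.
Lemma lin_add V W (f g : V -> W) : linear f -> linear g -> linear (f \+ g).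
Proof. by move=> lf lg c u v /=; rewrite lf lg scalerDr addrACA. Qed.
Lemma lin_sub V W (f g : V -> W) : linear f -> linear g -> linear (f \- g).
Proof. by move=> lf lg c u v /=; rewrite lf lg scalerBr opprD addrACA. Qed.
Lemma lin_scale V W b (f : V -> W) : linear f -> linear (fun v => b *: f v).
Proof. by move=> lf c u v /=; rewrite lf scalerDr !scalerA mulrC. Qed.

Lemma fsumE V (I : choiceType) (s : seq I) (F : I -> V) : uniq s ->
  (forall i, i \notin s -> F i = 0) ->
  \sum_(i \in [set: I]) F i = \sum_(i <- s) F i.
Proof.
move=> us F0; rewrite (fsbigTE (seq_fset tt s)); last first.
  by move=> i; rewrite seq_fsetE; exact: F0.
by apply: perm_big; rewrite (perm_trans (seq_fset_perm tt s)) // undup_id.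
Qed.

Lemma fsum1 V (I : choiceType) (F : I -> V) i0 :
  (forall i, i != i0 -> F i = 0) -> \sum_(i \in [set: I]) F i = F i0.
Proof. by move=> F0; rewrite (fsumE (s := [:: i0])) ?big_seq1 // => i; rewrite inE; exact: F0. Qed.

Lemma finsupp_seq (I : choiceType) (A : set I) : finite_set A ->
  exists2 s : seq I, uniq s & forall i, i \notin s -> ~ A i.
Proof.
move=> fA; exists (fset_set A); first exact: fset_uniq.
by move=> i + Ai; rewrite in_fset_set // => /negP; apply; rewrite inE.
Qed.

Lemma finsupp_of_seq V (I : choiceType) (s : seq I) (F : I -> V) :
  (forall i, i \notin s -> F i = 0) -> finite_set [set i | F i != 0].
Proof.
by move=> F0; apply: sub_finite_set (finite_seq s) => i /=; apply: contra_neqT => /F0.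
Qed.

Lemma finsupp2 V W (I : choiceType) (F : I -> V) (G : I -> W) :
  finite_set [set i | F i != 0] -> finite_set [set i | G i != 0] ->
  exists s : seq I, [/\ uniq s, forall i, i \notin s -> F i = 0
    & forall i, i \notin s -> G i = 0].
Proof.
move=> fF fG; have [|s us sP] := @finsupp_seq I ([set i | F i != 0] `|` [set i | G i != 0]).
  by rewrite finite_setU.
by exists s; split=> // i /sP /=; apply: contra_notP => /eqP ?; [left|right].
Qed.

Lemma lin_fsum V W (I : choiceType) (f : V -> W) (F : I -> V) :
  linear f -> finite_set [set i | F i != 0] ->
  f (\sum_(i \in [set: I]) F i) = \sum_(i \in [set: I]) f (F i).
Proof.
move=> lf fF; have [s [us F0 _]] := finsupp2 fF fF.
rewrite !(fsumE us) ?lin_sum // => i /F0 ->; exact: lin0.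
Qed.

Lemma fsum_linear V W (I : choiceType) (g : I -> V -> W) :
  (forall i, linear (g i)) -> (forall v, finite_set [set i | g i v != 0]) ->
  linear (fun v => \sum_(i \in [set: I]) g i v).
Proof.
move=> lg fg c u v; have [s [us u0 v0]] := finsupp2 (fg u) (fg v).
rewrite !(fsumE us) // => [|i si]; last by rewrite lg u0 // v0 // scaler0 addr0.
by rewrite scaler_sumr -big_split; apply: eq_bigr => i _; rewrite lg.
Qed.

Definition subspace_ker V W (f : V -> W) (lf : linear f) : subspace V.
Proof.
exists (fun v => f v = 0); first exact: lin0.
by move=> c u v fu fv; rewrite lf fu fv scaler0 addr0.
Defined.

Definition preim_subspace V W (f : V -> W) (lf : linear f) (S : subspace W) : subspace V.
Proof.
exists (fun v => S (f v)); first by rewrite lin0 //; exact: subspace0.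
by move=> c u v Su Sv; rewrite lf; exact: subspaceP.
Defined.

Definition im_subspace V W (f : V -> W) (lf : linear f) (S : subspace V) : subspace W.
Proof.
exists (fun w => exists2 v, S v & w = f v).
  by exists 0; [exact: subspace0|rewrite lin0].
by move=> c _ _ [u Su ->] [v Sv ->]; exists (c *: u + v); [exact: subspaceP|rewrite lf].
Defined.

Definition span V (A : set V) : subspace V.
Proof.
exists (fun v => forall S : subspace V, (forall a, A a -> S a) -> S v).
  by move=> S _; exact: subspace0.
by move=> c u v Su Sv S AS; apply: subspaceP; [exact: Su|exact: Sv].
Defined.

Lemma span_gen V (A : set V) a : A a -> span A a.
Proof. by move=> Aa S; apply. Qed.

Lemma span_eq_lin V W (A : set V) (f g : V -> W) : linear f -> linear g ->
  (forall a, A a -> f a = g a) -> forall v, span A v -> f v = g v.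
Proof.
move=> lf lg fg v /(_ (subspace_ker (lin_sub lf lg))) /= fgv.
by apply: subr0_eq; apply: fgv => a /fg ->; rewrite subrr.
Qed.

Definition vlift V W (S : subspace V) (f : V -> W) (q : vquot S) : W := f (repr q).

Lemma vlift_pi V W (S : subspace V) (f : V -> W) : linear f ->
  (forall v, S v -> f v = 0) -> forall v, vlift f (vpi v : vquot S) = f v.
Proof.
move=> lf f0 v; rewrite /vlift; apply: subr0_eq; rewrite -(linB lf); apply: f0.
by apply/vpi_eq; rewrite vpi_repr.
Qed.

Lemma vlift_linear V W (S : subspace V) (f : V -> W) : linear f ->
  (forall v, S v -> f v = 0) -> linear (vlift f : vquot S -> W).
Proof.
move=> lf f0 c p q; rewrite -[p]vpi_repr -[q]vpi_repr -linearP.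
by rewrite !vlift_pi // lf.
Qed.

End Linear.

Section DirectSum.
Variables (K : fieldType) (I : choiceType) (V : I -> lmodType K).

Record dsum := DSum {
  dsum_fun :> forall i, V i;
  dsum_fin : finite_set [set i | dsum_fun i != 0] }.

Lemma dsumP (f g : dsum) : (forall i, f i = g i) -> f = g.
Proof.
case: f g => f ff [g fg] /= fg_eq.
have E : f = g by apply: functional_extensionality_dep.
by case: g / E fg {fg_eq} => fg; rewrite (Prop_irrelevance ff fg).
Qed.

HB.instance Definition _ := gen_eqMixin dsum.
HB.instance Definition _ := gen_choiceMixin dsum.

Fact dsum0_fin : finite_set [set i | (fun i => 0 : V i) i != 0].
Proof. by rewrite (_ : mkset _ = set0) //; apply/seteqP; split=> i //=; rewrite eqxx. Qed.
Fact dsumN_fin (f : dsum) : finite_set [set i | - f i != 0].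
Proof. by apply: sub_finite_set (dsum_fin f) => i /=; rewrite oppr_eq0. Qed.
Fact dsumD_fin (f g : dsum) : finite_set [set i | f i + g i != 0].
Proof.
apply: (@sub_finite_set _ _ ([set i | f i != 0] `|` [set i | g i != 0])).
  move=> i /=; have [->|] := eqVneq (f i) 0; last by left.
  by rewrite add0r; right.
by rewrite finite_setU; split; exact: dsum_fin.
Qed.
Fact dsumZ_fin c (f : dsum) : finite_set [set i | c *: f i != 0].
Proof.
by apply: sub_finite_set (dsum_fin f) => i /=; apply: contra_neq => ->; rewrite scaler0.
Qed.

Fact dsum_addA : associative (fun f g => DSum (dsumD_fin f g)).
Proof. by move=> f g h; apply: dsumP => i /=; rewrite addrA. Qed.
Fact dsum_addC : commutative (fun f g => DSum (dsumD_fin f g)).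
Proof. by move=> f g; apply: dsumP => i /=; rewrite addrC. Qed.
Fact dsum_add0 : left_id (DSum dsum0_fin) (fun f g => DSum (dsumD_fin f g)).
Proof. by move=> f; apply: dsumP => i /=; rewrite add0r. Qed.
Fact dsum_addN : left_inverse (DSum dsum0_fin) (fun f => DSum (dsumN_fin f))
  (fun f g => DSum (dsumD_fin f g)).
Proof. by move=> f; apply: dsumP => i /=; rewrite addNr. Qed.

HB.instance Definition _ :=
  GRing.isZmodule.Build dsum dsum_addA dsum_addC dsum_add0 dsum_addN.

Fact dsum_scaleA a b (f : dsum) :
  DSum (dsumZ_fin a (DSum (dsumZ_fin b f))) = DSum (dsumZ_fin (a * b) f).
Proof. by apply: dsumP => i /=; rewrite scalerA. Qed.
Fact dsum_scale1 : left_id 1 (fun c f => DSum (dsumZ_fin c f)).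
Proof. by move=> f; apply: dsumP => i /=; rewrite scale1r. Qed.
Fact dsum_scaleDr : right_distributive (fun c f => DSum (dsumZ_fin c f)) +%R.
Proof. by move=> a f g; apply: dsumP => i /=; rewrite scalerDr. Qed.
Fact dsum_scaleDl f : {morph (fun c => DSum (dsumZ_fin c f)) : a b / a + b}.
Proof. by move=> a b; apply: dsumP => i /=; rewrite scalerDl. Qed.

HB.instance Definition _ := GRing.Zmodule_isLmodule.Build K dsum
  dsum_scaleA dsum_scale1 dsum_scaleDr dsum_scaleDl.

Lemma dsum_eval_linear i : linear (fun f : dsum => f i).
Proof. by []. Qed.

End DirectSum.

Section Presented.
Variables (K : fieldType) (T : choiceType).

Definition free := dsum (fun _ : T => K^o : lmodType K).
HB.instance Definition _ := GRing.Lmodule.on free.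

Fact free_gen_fin (t : T) : finite_set [set i | ((i == t)%:R : K^o) != 0].
Proof.
apply: sub_finite_set (finite_set1 t) => i /=.
by case: (eqVneq i t) => //= _; rewrite eqxx.
Qed.
Definition free_gen (t : T) : free := DSum (free_gen_fin t).

Definition free_lift (U : lmodType K) (f : T -> U) (F : free) : U :=
  \sum_(t \in [set: T]) (F t : K) *: f t.

Lemma free_lift_linear (U : lmodType K) (f : T -> U) : linear (free_lift f).
Proof.
apply: fsum_linear => [t c F G|F]; first by rewrite scalerDl scalerA.
by apply: sub_finite_set (dsum_fin F) => t /=; apply: contra_neq => ->; rewrite scale0r.
Qed.

Lemma free_lift_gen (U : lmodType K) (f : T -> U) t : free_lift f (free_gen t) = f t.
Proof.
rewrite /free_lift (fsum1 (i0 := t)) /= => [|i /negPf ->]; last by rewrite scale0r.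
by rewrite eqxx scale1r.
Qed.

Lemma free_sum (F : free) : F = free_lift free_gen F.
Proof.
apply: dsumP => i; rewrite /free_lift.
rewrite (lin_fsum (dsum_eval_linear (V := fun _ => K^o) i)); last first.
  by apply: sub_finite_set (dsum_fin F) => t /=; apply: contra_neq => ->; rewrite scale0r.
rewrite (fsum1 (i0 := i)) /= => [|j nj]; first by rewrite eqxx; exact/esym/mulr1.
by rewrite eq_sym (negPf nj); exact: mulr0.
Qed.

Lemma free_ind (S : subspace free) : (forall t, S (free_gen t)) -> forall F, S F.
Proof.
move=> Sg F; rewrite [F]free_sum /free_lift.
have [s us F0] := finsupp_seq (dsum_fin F).
rewrite (fsumE us) => [|t /F0 /negP]; last by rewrite negbK => /eqP ->; rewrite scale0r.
by apply: subspace_sum => t; exact/subspaceZ.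
Qed.

Variable R : set free.

Definition presented := vquot (span R).
HB.instance Definition _ := GRing.Lmodule.on presented.

Definition pgen (t : T) : presented := vpi (free_gen t).

Definition plift (U : lmodType K) (f : T -> U) : presented -> U := vlift (free_lift f).

Section Lift.
Variables (U : lmodType K) (f : T -> U).
Hypothesis fR : forall F, R F -> free_lift f F = 0.

Fact span_rel0 F : span R F -> free_lift f F = 0.
Proof. by move/(_ (subspace_ker (free_lift_linear f))); apply. Qed.

Lemma plift_linear : linear (plift f).
Proof. exact: vlift_linear (free_lift_linear f) span_rel0. Qed.

Lemma plift_gen t : plift f (pgen t) = f t.
Proof. by rewrite /plift vlift_pi ?free_lift_gen //; [exact: free_lift_linear|exact: span_rel0]. Qed.
End Lift.

Lemma pi_rel0 F : R F -> vpi F = 0 :> presented.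
Proof.
by move=> RF; rewrite -[RHS](linear0 (@vpi K _ _)); apply/vpi_eq; rewrite subr0; exact: span_gen.
Qed.

Lemma presented_ind (S : subspace presented) : (forall t, S (pgen t)) -> forall q, S q.
Proof.
move=> Sg q; rewrite -[q]vpi_repr.
exact: (free_ind (S := preim_subspace (vpi_linear (span R)) S)).
Qed.

Lemma presented_ext (U : lmodType K) (f g : presented -> U) : linear f -> linear g ->
  (forall t, f (pgen t) = g (pgen t)) -> f =1 g.
Proof.
move=> lf lg fg q; apply: subr0_eq.
by apply: (presented_ind (S := subspace_ker (lin_sub lf lg))) => t /=; rewrite fg subrr.
Qed.

End Presented.

Arguments pgen {K T R} t.

Section Grading.
Variables (K : fieldType) (V : lmodType K).
Implicit Type A : int -> subspace V.

Definition homog_decomp A (v : V) (c : int -> V) : Prop :=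
  [/\ forall r, A r (c r), finite_set [set r | c r != 0]
    & v = \sum_(r \in [set: int]) c r].

Definition is_grading A : Prop := forall v, exists! c, homog_decomp A v c.

Section FromProj.
Variables (A : int -> subspace V) (p : int -> V -> V).
Hypothesis p_lin : forall r, linear (p r).
Hypothesis pE : forall r s v, A s v -> p r v = if r == s then v else 0.

Lemma grading_of_proj : (forall v, homog_decomp A v (p^~ v)) -> is_grading A.
Proof.
move=> pv v; exists (p^~ v); split=> // c [Ac fc ->]; apply: functional_extensionality_dep => r.
rewrite lin_fsum // (fsum1 (i0 := r)) ?(pE _ (Ac _)) ?eqxx // => s /negPf sr.
by rewrite (pE _ (Ac _)) eq_sym sr.
Qed.

Lemma homog_decomp_proj v : span [set u | exists r, A r u] v -> homog_decomp A v (p^~ v).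
Proof.
have [S SE] : exists S : subspace V, forall v, S v <-> homog_decomp A v (p^~ v).
  suff [h0 hP] : homog_decomp A 0 (p^~ 0) /\ forall c u v, homog_decomp A u (p^~ u) ->
      homog_decomp A v (p^~ v) -> homog_decomp A (c *: u + v) (p^~ (c *: u + v)).
    by exists (Subspace h0 hP).
  split=> [|c u w [Au fu eu] [Aw fw ew]].
    split=> [r||]; first by rewrite lin0 //; exact: subspace0.
      by rewrite (_ : mkset _ = set0) //; apply/seteqP; split=> r //=; rewrite lin0 // eqxx.
    by rewrite (fsumE (s := [::])) ?big_nil // => r _; rewrite lin0.
  have [s [us u0 w0]] := finsupp2 fu fw.
  have cuw0 i : i \notin s -> p i (c *: u + w) = 0.
    by move=> si; rewrite p_lin u0 // w0 // scaler0 addr0.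
  split=> [r||]; first by rewrite p_lin; exact: subspaceP.
    exact: finsupp_of_seq cuw0.
  rewrite (fsumE us) // [in LHS]eu [in LHS]ew !(fsumE us) // scaler_sumr -big_split.
  by apply: eq_bigr => r _; rewrite p_lin.
move=> /(_ S) Sv; apply/SE/Sv => u [r Au]; apply/SE.
have p0 s : s != r -> p s u = 0 by move=> /negPf sr; rewrite (pE _ Au) sr.
split=> [s||].
- by rewrite (pE _ Au); case: eqVneq => [->|_] //; exact: subspace0.
- by apply: (finsupp_of_seq (s := [:: r])) => s; rewrite inE; exact: p0.
- by rewrite (fsum1 p0) (pE _ Au) eqxx.
Qed.

Lemma grading_of_span :
  (forall v, span [set u | exists r, A r u] v) -> is_grading A.
Proof. by move=> sp; apply: grading_of_proj => v; exact/homog_decomp_proj. Qed.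
End FromProj.

Section Components.
Variables (A : int -> subspace V) (gA : is_grading A).

Definition homog_part (r : int) (v : V) : V := projT1 (cid (gA v)) r.

Lemma homog_partP v : homog_decomp A v (homog_part^~ v).
Proof. by rewrite /homog_part; case: cid => c /= []. Qed.

Lemma homog_part_uniq v c : homog_decomp A v c -> forall r, homog_part r v = c r.
Proof.
by rewrite /homog_part; case: cid => d /= [_ du] /du ->.
Qed.

Lemma homog_part_grade r v : A r (homog_part r v).
Proof. by have [] := homog_partP v. Qed.
Lemma homog_part_fin v : finite_set [set r | homog_part r v != 0].
Proof. by have [] := homog_partP v. Qed.
Lemma homog_part_sum v : v = \sum_(r \in [set: int]) homog_part r v.
Proof. by have [] := homog_partP v. Qed.

Lemma homog_part_id r s v : A s v -> homog_part r v = if r == s then v else 0.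
Proof.
move=> Av; apply: (homog_part_uniq (c := fun r => if r == s then v else 0)); split.
- by move=> q; case: eqVneq => [->|_] //; exact: subspace0.
- apply: sub_finite_set (finite_set1 s) => q /=.
  by case: (eqVneq q s) => //= _; rewrite eqxx.
- by rewrite (fsum1 (i0 := s)) ?eqxx // => q /negPf ->.
Qed.

Lemma homog_part_linear r : linear (homog_part r).
Proof.
move=> c u v; apply: (homog_part_uniq (c := fun r => c *: homog_part r u + homog_part r v)).
have [s [us u0 v0]] := finsupp2 (homog_part_fin u) (homog_part_fin v).
have uv0 i : i \notin s -> c *: homog_part i u + homog_part i v = 0.
  by move=> si; rewrite u0 // v0 // scaler0 addr0.
split=> [q||]; first by apply: subspaceP; exact: homog_part_grade.
  exact: finsupp_of_seq uv0.
rewrite [in LHS](homog_part_sum u) [in LHS](homog_part_sum v) !(fsumE us) //.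
by rewrite scaler_sumr -big_split.
Qed.

Lemma grading_ind (S : subspace V) : (forall r v, A r v -> S v) -> forall v, S v.
Proof.
move=> AS v; rewrite (homog_part_sum v).
have [s us sP] := finsupp_seq (homog_part_fin v).
rewrite (fsumE us) => [|r /sP /negP]; last by rewrite negbK => /eqP.
by apply: subspace_sum => r; apply: AS; exact: homog_part_grade.
Qed.

End Components.
End Grading.

Section Sl2.
Variable K : fieldType.

Definition traceless : {pred 'M[K]_2} := fun a => \tr a == 0.

Fact traceless_closed : submod_closed traceless.
Proof.
split=> [|c a b]; rewrite !unfold_in; first by rewrite mxtrace0.
by move=> /eqP ta /eqP tb; rewrite mxtraceD mxtraceZ ta tb mulr0 addr0.
Qed.
HB.instance Definition _ := GRing.isSubmodClosed.Build K 'M[K]_2 traceless traceless_closed.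

Record sl2 := Sl2 { sl2_mx :> 'M[K]_2; sl2_tr : sl2_mx \in traceless }.
HB.instance Definition _ := [isSub for sl2_mx].
HB.instance Definition _ := [Choice of sl2 by <:].
HB.instance Definition _ := [SubChoice_isSubLmodule of sl2 by <:].

Fact sl2_bracket_tr (a b : sl2) : (a *m b - b *m a : 'M[K]_2) \in traceless.
Proof. by rewrite unfold_in raddfB /= mxtrace_mulC subrr. Qed.
Definition sl2_bracket (a b : sl2) : sl2 := Sl2 (sl2_bracket_tr a b).

Fact sl2_x_tr : (delta_mx 0 1 : 'M[K]_2) \in traceless.
Proof. by rewrite unfold_in /mxtrace big_ord_recl big_ord1 !mxE addr0. Qed.
Fact sl2_y_tr : (delta_mx 1 0 : 'M[K]_2) \in traceless.
Proof. by rewrite unfold_in /mxtrace big_ord_recl big_ord1 !mxE addr0. Qed.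
Fact sl2_h_tr : (delta_mx 0 0 - delta_mx 1 1 : 'M[K]_2) \in traceless.
Proof. by rewrite unfold_in /mxtrace big_ord_recl big_ord1 !mxE /= subr0 sub0r subrr. Qed.

Definition sl2_x : sl2 := Sl2 sl2_x_tr.
Definition sl2_y : sl2 := Sl2 sl2_y_tr.
Definition sl2_h : sl2 := Sl2 sl2_h_tr.

Lemma sl2_hx : sl2_bracket sl2_h sl2_x = 2%:R *: sl2_x.
Proof. apply: val_inj => /=; rewrite mulmxBl mulmxBr !mul_delta_mx_cond /= !subr0 sub0r opprK scaler_nat. by []. Qed.
Lemma sl2_hy : sl2_bracket sl2_h sl2_y = - 2%:R *: sl2_y.
Proof. apply: val_inj => /=; rewrite mulmxBl mulmxBr !mul_delta_mx_cond /= !subr0 sub0r scaleNr scaler_nat opprD. by []. Qed.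
Lemma sl2_xy : sl2_bracket sl2_x sl2_y = sl2_h.
Proof. by apply: val_inj; rewrite /= !mul_delta_mx. Qed.

End Sl2.

Arguments sl2_x {K}.
Arguments sl2_y {K}.
Arguments sl2_h {K}.

Section GradedRep.
Variable K : fieldType.

(* A linear action of sl_2[t] = \bigoplus_r sl_2 \otimes t^r is a family of
   actions of the summands: [act a r] is the action of a \otimes t^r. *)
Record gradedRep := GradedRep {
  rep_space :> lmodType K;
  act : sl2 K -> nat -> rep_space -> rep_space;
  grade : int -> subspace rep_space;
  act_linearl : forall r v, linear (fun a => act a r v);
  act_linear : forall a r, linear (act a r);
  act_bracket : forall a b r s v,
    act (sl2_bracket a b) (r + s)%N v = act a r (act b s v) - act b s (act a r v);
  grade_direct : is_grading grade;
  act_grade : forall a r s v, grade s v -> grade (r%:Z + s) (act a r v) }.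

HB.instance Definition _ (M : gradedRep) a r :=
  GRing.isLinear.Build K M M *:%R (@act M a r) (@act_linear M a r).

Definition component (M : gradedRep) (r : int) (v : M) : M :=
  homog_part (@grade_direct M) r v.

Lemma component_linear M r : linear (@component M r).
Proof. exact: homog_part_linear. Qed.
HB.instance Definition _ (M : gradedRep) (r : int) :=
  GRing.isLinear.Build K M M *:%R (@component M r) (@component_linear M r).

Lemma component_id M r s v : grade M s v -> component r v = if r == s then v else 0.
Proof. exact: homog_part_id. Qed.

Definition rep_hom (M N : gradedRep) (f : M -> N) : Prop :=
  [/\ linear f, forall a r v, f (act a r v) = act a r (f v)
    & forall r v, grade M r v -> grade N r (f v)].

Definition rep_iso (M N : gradedRep) : Prop :=
  exists2 f : M -> N, rep_hom f & bijective f.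

Definition weight_space (M : gradedRep) (mu : int) : set M :=
  [set v | act sl2_h 0 v = mu%:~R *: v].

Arguments weight_space : clear implicits.

Definition fin_dim (V : lmodType K) (S : subspace V) : Prop :=
  exists n (b : 'I_n -> V), (forall i, S (b i)) /\
    forall v, S v -> exists c : 'I_n -> K, v = \sum_i c i *: b i.

Definition I_bdd (M : gradedRep) : Prop :=
  [/\ exists p0 : int, forall p, p < p0 -> forall v, grade M p v -> v = 0,
      forall p, fin_dim (grade M p)
    & finite_set [set mu : int | exists2 v, weight_space M mu v & v != 0]].

Section Shift.
Variables (s : int) (M : gradedRep).

Fact shift_direct : is_grading (fun r => grade M (r - s)).
Proof.
apply: (grading_of_span (p := fun r => @component M (r - s))).
- by move=> r; exact: component_linear.
- by move=> r q v /component_id ->; rewrite (inj_eq (addIr _)).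
- move=> v; apply: (grading_ind (@grade_direct M)) => r u Mu.
  by apply: span_gen; exists (r + s); rewrite addrK.
Qed.

Fact shift_act_grade a r q v :
  grade M (q - s) v -> grade M (r%:Z + q - s) (act a r v).
Proof. by move=> Mv; rewrite -addrA; exact: act_grade. Qed.

Definition shift : gradedRep :=
  GradedRep (@act_linearl M) (@act_linear M) (@act_bracket M)
    shift_direct shift_act_grade.
End Shift.

(* Submodules in the graded category are the homogeneous ones. *)
Record gradedSub (M : gradedRep) := GradedSub {
  gsub_space :> subspace M;
  gsub_act : forall a r v, gsub_space v -> gsub_space (act a r v);
  gsub_component : forall r v, gsub_space v -> gsub_space (component r v) }.

Section SubRep.
Variables (M : gradedRep) (S : gradedSub M).
Notation T := (vsub S).

Definition sub_act a r (u : T) : T := mkvsub (gsub_act a r (vsubP u)).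

Fact sub_act_linearl r v : linear (fun a => sub_act a r v).
Proof. by move=> c a b; apply: val_inj; rewrite linearP /= act_linearl. Qed.
Fact sub_act_linear a r : linear (sub_act a r).
Proof. by move=> c u v; apply: val_inj; rewrite linearP /= !linearP. Qed.
Fact sub_act_bracket a b r s v :
  sub_act (sl2_bracket a b) (r + s) v =
  sub_act a r (sub_act b s v) - sub_act b s (sub_act a r v).
Proof. by apply: val_inj; rewrite linearB /= act_bracket. Qed.

Lemma val_vsub_linear : linear (val : T -> M).
Proof. exact: linearP. Qed.

Definition sub_grade r : subspace T := preim_subspace val_vsub_linear (grade M r).

Definition sub_component r (u : T) : T := mkvsub (gsub_component r (vsubP u)).

Fact sub_direct : is_grading sub_grade.
Proof.
have clin r : linear (sub_component r).
  by move=> c u v; apply: val_inj; rewrite linearP /= !linearP.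
have cfin u : finite_set [set r | sub_component r u != 0].
  apply: sub_finite_set (homog_part_fin (@grade_direct M) (val u)) => r /=.
  by apply: contra_neq => cu; apply: val_inj.
apply: (grading_of_proj (p := sub_component)) => //.
  move=> r s v Sv; apply: val_inj; rewrite /= (component_id r Sv).
  by case: eqP.
move=> v; split=> // [r|]; first exact: homog_part_grade.
apply: val_inj; rewrite (lin_fsum val_vsub_linear) //.
exact: homog_part_sum.
Qed.

Fact sub_act_grade a r s v : sub_grade s v -> sub_grade (r%:Z + s) (sub_act a r v).
Proof. exact: act_grade. Qed.

Definition subRep : gradedRep :=
  GradedRep sub_act_linearl sub_act_linear sub_act_bracket sub_direct sub_act_grade.
End SubRep.

Section QuotRep.
Variables (M : gradedRep) (S : gradedSub M).
Notation Q := (vquot S).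

Definition quot_act a r : Q -> Q := vlift (fun v => vpi (act a r v)).

Fact quot_lin (f : M -> M) : linear f -> linear (fun v => vpi (f v) : Q).
Proof. by move=> lf; exact: lin_comp (@vpi_linear _ _ _) lf. Qed.

Lemma vpi0 v : S v -> vpi v = 0 :> Q.
Proof. by move=> Sv; rewrite -[RHS](linear0 (@vpi K _ _)); apply/vpi_eq; rewrite subr0. Qed.

Lemma quot_act_pi a r v : quot_act a r (vpi v) = vpi (act a r v).
Proof.
rewrite /quot_act vlift_pi //; first exact: quot_lin (@act_linear M a r).
by move=> u Su; exact/vpi0/gsub_act.
Qed.

Fact quot_act_linearl r v : linear (fun a => quot_act a r v).
Proof. by move=> c a b; rewrite -[v]vpi_repr !quot_act_pi act_linearl linearP. Qed.
Fact quot_act_linear a r : linear (quot_act a r).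
Proof.
by move=> c u v; rewrite -[u]vpi_repr -[v]vpi_repr -linearP !quot_act_pi !linearP.
Qed.
Fact quot_act_bracket a b r s v :
  quot_act (sl2_bracket a b) (r + s) v =
  quot_act a r (quot_act b s v) - quot_act b s (quot_act a r v).
Proof. by rewrite -[v]vpi_repr !quot_act_pi act_bracket linearB. Qed.

Definition quot_grade r : subspace Q := im_subspace (@vpi_linear _ _ S) (grade M r).

Definition quot_component r : Q -> Q := vlift (fun v => vpi (component r v)).

Lemma quot_component_pi r v : quot_component r (vpi v) = vpi (component r v).
Proof.
rewrite /quot_component vlift_pi //; first exact: quot_lin (@component_linear M r).
by move=> u Su; exact/vpi0/gsub_component.
Qed.

Fact quot_direct : is_grading quot_grade.
Proof.
apply: (grading_of_span (p := quot_component)).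
- move=> r c u v; rewrite -[u]vpi_repr -[v]vpi_repr -linearP.
  by rewrite !quot_component_pi !linearP.
- move=> r s _ [v Sv ->]; rewrite quot_component_pi (component_id r Sv).
  by case: eqP; rewrite ?linear0.
- move=> q; rewrite -[q]vpi_repr.
  pose T : subspace M := preim_subspace (@vpi_linear _ _ S)
    (span [set u | exists r, quot_grade r u]).
  apply: (grading_ind (@grade_direct M) (S := T)) => r v Mv.
  by apply: span_gen; exists r; exists v.
Qed.

Fact quot_act_grade a r s v : quot_grade s v -> quot_grade (r%:Z + s) (quot_act a r v).
Proof.
case=> u Mu ->; exists (act a r u); first exact: act_grade.
by rewrite quot_act_pi.
Qed.

Definition quotRep : gradedRep :=
  GradedRep quot_act_linearl quot_act_linear quot_act_bracket quot_direct quot_act_grade.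
End QuotRep.

Section Restrict.
Variables (M : gradedRep) (S S' : gradedSub M).

Fact restrict_act a r (v : subRep S) :
  preim_subspace (@val_vsub_linear M S) S' v ->
  preim_subspace (@val_vsub_linear M S) S' (act a r v).
Proof. exact: gsub_act. Qed.

Lemma val_component r (v : subRep S) : val (component r v) = component r (val v).
Proof.
rewrite /component.
rewrite (homog_part_uniq (@sub_direct M S) (c := @sub_component M S ^~ v)) //.
split=> [q||]; first exact: homog_part_grade.
  apply: sub_finite_set (homog_part_fin (@grade_direct M) (val v)) => q /=.
  by apply: contra_neq => cu; apply: val_inj.
apply: val_inj; rewrite (lin_fsum (@val_vsub_linear M S)) //; first exact: homog_part_sum.
apply: sub_finite_set (homog_part_fin (@grade_direct M) (val v)) => q /=.
by apply: contra_neq => cu; apply: val_inj.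
Qed.

Fact restrict_component r (v : subRep S) :
  preim_subspace (@val_vsub_linear M S) S' v ->
  preim_subspace (@val_vsub_linear M S) S' (component r v).
Proof. by rewrite /= val_component; exact: gsub_component. Qed.

(* S' \cap S as a submodule of S *)
Definition restrict : gradedSub (subRep S) := GradedSub restrict_act restrict_component.

Definition subquot : gradedRep := quotRep restrict.
End Restrict.

Section DirectSumRep.
Variables (I : choiceType) (M : I -> gradedRep).
Notation D := (dsum (fun i => M i : lmodType K)).

Lemma dmap_fin (f : forall i, M i -> M i) (u : D) : (forall i, linear (f i)) ->
  finite_set [set i | f i (u i) != 0].
Proof.
move=> lf; apply: sub_finite_set (dsum_fin u) => i /=.
by apply: contra_neq => ->; rewrite lin0.
Qed.

Definition dsum_act (a : sl2 K) (r : nat) (u : D) : D :=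
  DSum (dmap_fin u (fun i => @act_linear (M i) a r)).

Fact dsum_act_linearl r (v : D) : linear (fun a => dsum_act a r v).
Proof. by move=> c a b; apply: dsumP => i /=; rewrite act_linearl. Qed.
Fact dsum_act_linear (a : sl2 K) (r : nat) : linear (dsum_act a r).
Proof. by move=> c u v; apply: dsumP => i /=; rewrite linearP. Qed.
Fact dsum_act_bracket a b r s (v : D) :
  dsum_act (sl2_bracket a b) (r + s) v =
  dsum_act a r (dsum_act b s v) - dsum_act b s (dsum_act a r v).
Proof. by apply: dsumP => i /=; rewrite act_bracket. Qed.

Definition dsum_grade (r : int) : subspace D.
Proof.
apply: (@Subspace K D (fun u => forall i, grade (M i) r (u i))).
  by move=> i; exact: subspace0.
by move=> c u v ur vr i; exact: subspaceP.
Defined.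

Definition dsum_component (r : int) (u : D) : D :=
  DSum (dmap_fin u (fun i => @component_linear (M i) r)).

Fact dsum_direct : is_grading dsum_grade.
Proof.
apply: (grading_of_proj (p := dsum_component)).
- by move=> r c u v; apply: dsumP => i /=; rewrite linearP.
- move=> r s v gv; apply: dsumP => i /=; rewrite (component_id r (gv i)).
  by case: eqP.
move=> v.
have fv : finite_set [set r | dsum_component r v != 0].
  apply: (@sub_finite_set _ _ (\bigcup_(i in [set i | v i != 0])
      [set r | component r (v i) != 0])).
    move=> r /= cv; apply: contrapT => nv; move/eqP: cv; apply.
    apply: dsumP => i /=; apply: contrapT => /eqP ci; apply: nv; exists i => //=.
    by apply: contra_neq ci => ->; rewrite linear0.
  by apply: bigcup_finite (dsum_fin v) _ => i _; exact: homog_part_fin.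
split=> // [r i|]; first exact: homog_part_grade.
apply: dsumP => i; rewrite (lin_fsum (dsum_eval_linear (V := fun i => M i : lmodType K) i)) //.
exact: homog_part_sum.
Qed.

Fact dsum_act_grade a r s v : dsum_grade s v -> dsum_grade (r%:Z + s) (dsum_act a r v).
Proof. by move=> gv i; exact: act_grade. Qed.

Definition dsumRep : gradedRep :=
  GradedRep dsum_act_linearl dsum_act_linear dsum_act_bracket dsum_direct dsum_act_grade.
End DirectSumRep.

Lemma cross_cancel (V : zmodType) (a1 a2 b1 b2 c d : V) :
  a1 - a2 + (b1 - b2) = a1 + c + (d + b1) - (a2 + d + (c + b2)).
Proof.
rewrite !opprD !addrA [RHS](ACl (1*5*4*8*2*7*3*6))%AC /=.
by rewrite addrK addrK.
Qed.

Section Tensor.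
Variables M N : gradedRep.

Inductive tensor_rel : set (free K (M * N)%type) :=
| tensor_rel_l c (v v' : M) (w : N) : tensor_rel
    (free_gen K (c *: v + v', w) - c *: free_gen K (v, w) - free_gen K (v', w))
| tensor_rel_r c (v : M) (w w' : N) : tensor_rel
    (free_gen K (v, c *: w + w') - c *: free_gen K (v, w) - free_gen K (v, w')).

Definition tensor_space := presented tensor_rel.
HB.instance Definition _ := GRing.Lmodule.on tensor_space.

Definition tens (v : M) (w : N) : tensor_space := pgen (v, w).

Lemma tens_linearl w : linear (tens^~ w).
Proof.
move=> c v v'; apply: subr0_eq; rewrite opprD addrA /tens /pgen -linearZ -!linearB.
by apply: pi_rel0; exact: tensor_rel_l.
Qed.
Lemma tens_linear v : linear (tens v).
Proof.
move=> c w w'; apply: subr0_eq; rewrite opprD addrA /tens /pgen -linearZ -!linearB.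
by apply: pi_rel0; exact: tensor_rel_r.
Qed.

Section TensorLift.
Variables (U : lmodType K) (f : M -> N -> U).
Hypotheses (fl : forall w, linear (f^~ w)) (fr : forall v, linear (f v)).

Definition tensor_lift : tensor_space -> U := plift (fun vw => f vw.1 vw.2).

Fact tensor_lift_rel F : tensor_rel F -> free_lift (fun vw => f vw.1 vw.2) F = 0.
Proof.
have ll := free_lift_linear (fun vw : M * N => f vw.1 vw.2).
by case=> [c v v' w|c v w w']; rewrite !(linB ll) (linZ ll) !free_lift_gen /=
  ?(fl w c v v') ?(fr v c w w') addrAC addrK subrr.
Qed.

Lemma tensor_lift_linear : linear tensor_lift.
Proof. exact: plift_linear tensor_lift_rel. Qed.
Lemma tensor_liftE v w : tensor_lift (tens v w) = f v w.
Proof. exact: plift_gen tensor_lift_rel (v, w). Qed.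
End TensorLift.

Lemma tensor_ext (U : lmodType K) (f g : tensor_space -> U) : linear f -> linear g ->
  (forall v w, f (tens v w) = g (tens v w)) -> f =1 g.
Proof. by move=> lf lg fg; apply: presented_ext => // -[v w]; exact: fg. Qed.

Lemma tensor_ind (S : subspace tensor_space) : (forall v w, S (tens v w)) -> forall q, S q.
Proof. by move=> Sg; apply: presented_ind => -[v w]; exact: Sg. Qed.

Definition tensor_act a r : tensor_space -> tensor_space :=
  tensor_lift (fun v w => tens (act a r v) w + tens v (act a r w)).

Fact tensor_act_l a r w : linear (fun v => tens (act a r v) w + tens v (act a r w)).
Proof.
apply: lin_add; last exact: tens_linearl.
exact: lin_comp (tens_linearl w) (@act_linear M a r).
Qed.
Fact tensor_act_r a r v : linear (fun w => tens (act a r v) w + tens v (act a r w)).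
Proof.
apply: lin_add; first exact: tens_linear.
exact: lin_comp (tens_linear v) (@act_linear N a r).
Qed.

Lemma tensor_actE a r v w :
  tensor_act a r (tens v w) = tens (act a r v) w + tens v (act a r w).
Proof. exact: tensor_liftE (tensor_act_l a r) (tensor_act_r a r) v w. Qed.

Fact tensor_act_linear a r : linear (tensor_act a r).
Proof. exact: tensor_lift_linear (tensor_act_l a r) (tensor_act_r a r). Qed.

Fact tensor_act_linearl r v : linear (fun a => tensor_act a r v).
Proof.
move=> c a b; apply: (tensor_ext (tensor_act_linear _ _)
  (lin_add (lin_scale c (tensor_act_linear a r)) (tensor_act_linear b r))) => u w /=.
rewrite !tensor_actE !act_linearl tens_linearl tens_linear scalerDr.
by rewrite addrACA.
Qed.

Fact tensor_act_bracket a b r s v :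
  tensor_act (sl2_bracket a b) (r + s) v =
  tensor_act a r (tensor_act b s v) - tensor_act b s (tensor_act a r v).
Proof.
have l2 a' r' b' s' := lin_comp (tensor_act_linear a' r') (tensor_act_linear b' s').
apply: (tensor_ext (tensor_act_linear _ _) (lin_sub (l2 a r b s) (l2 b s a r))) => u w /=.
rewrite !tensor_actE !(linD (tensor_act_linear _ _)) !tensor_actE !act_bracket.
by rewrite (linB (tens_linearl _)) (linB (tens_linear _)); exact: cross_cancel.
Qed.

(* total degree *)
Definition tensor_grade n : subspace tensor_space :=
  span [set t | exists i j v w,
    [/\ grade M i v, grade N j w, i + j = n & t = tens v w]].

Definition tensor_component n : tensor_space -> tensor_space :=
  tensor_lift (fun v w =>
    \sum_(i \in [set: int]) tens (component i v) (component (n - i) w)).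

Fact tensor_component_fin n v w :
  finite_set [set i | tens (component i v) (component (n - i) w) != 0].
Proof.
apply: sub_finite_set (homog_part_fin (@grade_direct M) v) => i /=.
by apply: contra_neq; rewrite -/(component i v) => ->; rewrite (lin0 (tens_linearl _)).
Qed.

Fact tensor_component_l n w :
  linear (fun v => \sum_(i \in [set: int]) tens (component i v) (component (n - i) w)).
Proof.
apply: fsum_linear => [i|v]; last exact: tensor_component_fin.
exact: lin_comp (tens_linearl _) (@component_linear M i).
Qed.
Fact tensor_component_r n v :
  linear (fun w => \sum_(i \in [set: int]) tens (component i v) (component (n - i) w)).
Proof.
apply: fsum_linear => [i|w]; last exact: tensor_component_fin.
exact: lin_comp (tens_linear _) (@component_linear N (n - i)).
Qed.

Fact tensor_component_linear n : linear (tensor_component n).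
Proof. exact: tensor_lift_linear (tensor_component_l n) (tensor_component_r n). Qed.
Fact tensor_componentE n v w : tensor_component n (tens v w) =
  \sum_(i \in [set: int]) tens (component i v) (component (n - i) w).
Proof. exact: tensor_liftE (tensor_component_l n) (tensor_component_r n) v w. Qed.

Fact tensor_direct : is_grading tensor_grade.
Proof.
apply: (grading_of_span (p := tensor_component) tensor_component_linear).
- move=> n m v mv.
  have lc : linear (fun v : tensor_space => if n == m then v else 0).
    by case: eqP => _; [exact: lin_id|exact: lin_cst0].
  apply: (span_eq_lin (tensor_component_linear n) lc _ mv) => _ [i [j [u [w [Mu Nw <- ->]]]]].
  rewrite tensor_componentE (fsum1 (i0 := i)) => [|k ki]; last first.
    by rewrite (component_id k Mu) (negPf ki) (lin0 (tens_linearl _)).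
  rewrite (component_id i Mu) eqxx (component_id _ Nw) subr_eq [j + i]addrC.
  by case: eqP => // _; rewrite (lin0 (tens_linear _)).
- set A := span _; apply: tensor_ind => v w.
  apply: (grading_ind (@grade_direct M) (S := preim_subspace (tens_linearl w) A)) => i {}v Mv.
  apply: (grading_ind (@grade_direct N) (S := preim_subspace (tens_linear v) A)) => j {}w Nw.
  by apply: span_gen; exists (i + j); apply: span_gen; exists i, j, v, w.
Qed.

Fact tensor_act_grade a r s v :
  tensor_grade s v -> tensor_grade (r%:Z + s) (tensor_act a r v).
Proof.
move/(_ (preim_subspace (tensor_act_linear a r) (tensor_grade (r%:Z + s)))); apply.
move=> _ [i [j [u [w [Mu Nw <- ->]]]]].
suff : tensor_grade (r%:Z + (i + j)) (tensor_act a r (tens u w)) by [].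
rewrite tensor_actE; apply: subspaceD; apply: span_gen.
  exists (r%:Z + i), j, (act a r u), w; split=> //; last by rewrite addrA.
  exact: act_grade.
exists i, (r%:Z + j), u, (act a r w); split=> //; last by rewrite addrCA.
exact: act_grade.
Qed.

Definition tensorRep : gradedRep :=
  GradedRep tensor_act_linearl tensor_act_linear tensor_act_bracket
    tensor_direct tensor_act_grade.
End Tensor.

Section Weyl.
Variable lambda : nat.

Notation letter := (sl2 K * nat)%type.
Notation word := (seq letter).

(* The word (a_1, r_1) ... (a_n, r_n) stands for the vector
   (a_1 \otimes t^r_1) ... (a_n \otimes t^r_n) w_lambda.  The first two
   families of relations are those of the enveloping algebra of sl_2[t]. *)
Inductive weyl_rel : set (free K word) :=
| weyl_rel_lin (u v : word) c a b r : weyl_rel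
    (free_gen K (u ++ (c *: a + b, r) :: v)
     - c *: free_gen K (u ++ (a, r) :: v) - free_gen K (u ++ (b, r) :: v))
| weyl_rel_bracket (u v : word) a b r s : weyl_rel
    (free_gen K (u ++ (a, r) :: (b, s) :: v)
     - free_gen K (u ++ (b, s) :: (a, r) :: v)
     - free_gen K (u ++ (sl2_bracket a b, (r + s)%N) :: v))
| weyl_rel_x (u : word) r : weyl_rel (free_gen K (rcons u (sl2_x, r)))
| weyl_rel_h (u : word) : weyl_rel
    (free_gen K (rcons u (sl2_h, 0)) - lambda%:R *: free_gen K u)
| weyl_rel_y (u : word) : weyl_rel
    (free_gen K (u ++ nseq lambda.+1 (sl2_y, 0))).

Definition weyl_space := presented weyl_rel.
HB.instance Definition _ := GRing.Lmodule.on weyl_space.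

Definition weyl_word (u : word) : weyl_space := pgen u.

Definition word_degree (u : word) : nat := \sum_(l <- u) l.2.

Lemma word_degree_cat u v : word_degree (u ++ v) = (word_degree u + word_degree v)%N.
Proof. exact: big_cat. Qed.
Lemma word_degree_cons l u : word_degree (l :: u) = (l.2 + word_degree u)%N.
Proof. exact: big_cons. Qed.

Definition weyl_act a r : weyl_space -> weyl_space :=
  plift (fun u => weyl_word ((a, r) :: u)).

Fact weyl_act_rel a r F : weyl_rel F -> free_lift (fun u => weyl_word ((a, r) :: u)) F = 0.
Proof.
have ll := free_lift_linear (fun u => weyl_word ((a, r) :: u)).
case=> [u v c b d s|u v b d s q|u s|u|u];
  rewrite ?(linB ll) ?(linZ ll) !free_lift_gen /weyl_word /pgen -?linearZ -?linearB;
  apply: pi_rel0.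
- exact: (weyl_rel_lin ((a, r) :: u)).
- exact: (weyl_rel_bracket ((a, r) :: u)).
- exact: (weyl_rel_x ((a, r) :: u)).
- exact: (weyl_rel_h ((a, r) :: u)).
- exact: (weyl_rel_y ((a, r) :: u)).
Qed.

Fact weyl_act_linear a r : linear (weyl_act a r).
Proof. exact: plift_linear (@weyl_act_rel a r). Qed.
Lemma weyl_act_word a r u : weyl_act a r (weyl_word u) = weyl_word ((a, r) :: u).
Proof. exact: plift_gen (@weyl_act_rel a r) u. Qed.

Fact weyl_act_linearl r v : linear (fun a => weyl_act a r v).
Proof.
move=> c a b; apply: (presented_ext (weyl_act_linear _ _)
  (lin_add (lin_scale c (weyl_act_linear a r)) (weyl_act_linear b r))) => u.
rewrite /= !weyl_act_word; apply: subr0_eq; rewrite opprD addrA.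
rewrite /weyl_word /pgen -linearZ -!linearB; apply: pi_rel0.
exact: (weyl_rel_lin [::]).
Qed.

Fact weyl_act_bracket a b r s v :
  weyl_act (sl2_bracket a b) (r + s) v =
  weyl_act a r (weyl_act b s v) - weyl_act b s (weyl_act a r v).
Proof.
have l2 a' r' b' s' := lin_comp (weyl_act_linear a' r') (weyl_act_linear b' s').
apply: (presented_ext (weyl_act_linear _ _) (lin_sub (l2 a r b s) (l2 b s a r))) => u.
rewrite /= !weyl_act_word; apply/esym/subr0_eq.
rewrite /weyl_word /pgen -!linearB; apply: pi_rel0.
exact: (weyl_rel_bracket [::]).
Qed.

Definition weyl_grade (n : int) : subspace weyl_space :=
  span [set q | exists2 u, (word_degree u)%:Z = n & q = weyl_word u].

Definition weyl_component (n : int) : weyl_space -> weyl_space :=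
  plift (fun u => if n == word_degree u then weyl_word u else 0).

Fact weyl_component_rel (n : int) F : weyl_rel F ->
  free_lift (fun u => if n == word_degree u then weyl_word u else 0) F = 0.
Proof.
set f := fun u => _; move=> RF; have ll := free_lift_linear f.
have wR := pi_rel0 RF; case: RF wR => [u v c b d s|u v b d s q|u s|u|u];
  rewrite ?(linB ll) ?(linZ ll) !free_lift_gen ?linearB ?linearZ /= /f
    ?word_degree_cat ?word_degree_cons -?cats1 ?word_degree_cat ?word_degree_cons
    /= ?(addnCA q) ?addnA => wR.
- by case: eqP => // _; rewrite ?(oppr0, scaler0, addr0, subr0).
- by case: eqP => // _; rewrite ?(oppr0, scaler0, addr0, subr0).
- by case: eqP.
- rewrite [word_degree [::]]big_nil !addn0.
  by case: eqP => // _; rewrite oppr0 scaler0 addr0.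
- by case: eqP.
Qed.

Fact weyl_component_linear (n : int) : linear (weyl_component n).
Proof. exact: plift_linear (@weyl_component_rel n). Qed.
Fact weyl_component_word (n : int) u :
  weyl_component n (weyl_word u) = if n == word_degree u then weyl_word u else 0.
Proof. exact: plift_gen (@weyl_component_rel n) u. Qed.

Fact weyl_direct : is_grading weyl_grade.
Proof.
apply: (grading_of_span (p := weyl_component) weyl_component_linear).
- move=> n m v mv.
  have lc : linear (fun v : weyl_space => if n == m then v else 0).
    by case: eqP => _; [exact: lin_id|exact: lin_cst0].
  apply: (span_eq_lin (weyl_component_linear n) lc _ mv) => _ [u <- ->].
  exact: weyl_component_word.
- apply: presented_ind => u; apply: span_gen; exists (word_degree u).
  by apply: span_gen; exists u.
Qed.

Fact weyl_act_grade a r s v : weyl_grade s v -> weyl_grade (r%:Z + s) (weyl_act a r v).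
Proof.
move/(_ (preim_subspace (weyl_act_linear a r) (weyl_grade (r%:Z + s)))); apply.
move=> _ [u <- ->].
suff : weyl_grade (r%:Z + (word_degree u)%:Z) (weyl_act a r (weyl_word u)) by [].
rewrite weyl_act_word; apply: span_gen.
by exists ((a, r) :: u) => //; rewrite word_degree_cons.
Qed.

Definition weyl : gradedRep :=
  GradedRep weyl_act_linearl weyl_act_linear weyl_act_bracket
    weyl_direct weyl_act_grade.

Definition weyl_gen : weyl := weyl_word [::].

Lemma weyl_gen_rel :
  [/\ forall r, act sl2_x r weyl_gen = 0,
      act sl2_h 0 weyl_gen = lambda%:R *: weyl_gen
    & iter lambda.+1 (act sl2_y 0) weyl_gen = 0].
Proof.
have wE a r u : act a r (weyl_word u : weyl) = weyl_word ((a, r) :: u).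
  exact: weyl_act_word.
split=> [r||]; first by rewrite wE; apply: pi_rel0; exact: (weyl_rel_x [::]).
  rewrite wE; apply: subr0_eq; rewrite /weyl_gen /weyl_word /pgen -linearZ -linearB.
  by apply: pi_rel0; exact: (weyl_rel_h [::]).
rewrite (_ : iter _ _ _ = weyl_word (nseq lambda.+1 (sl2_y, 0))).
  by apply: pi_rel0; exact: (weyl_rel_y [::]).
by elim: lambda.+1 => // k IH; rewrite iterS IH wE.
Qed.

Lemma weyl_generated (S : subspace weyl) : S weyl_gen ->
  (forall a r v, S v -> S (act a r v)) -> forall v, S v.
Proof.
move=> S0 SA; apply: presented_ind; elim=> [|[a r] u IH] //.
by have := SA a r _ IH; rewrite /act /= weyl_act_word.
Qed.

Lemma weyl_universal (M : gradedRep) (w : M) :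
  (forall r, act sl2_x r w = 0) -> act sl2_h 0 w = lambda%:R *: w ->
  iter lambda.+1 (act sl2_y 0) w = 0 ->
  exists f : weyl -> M, [/\ linear f, f weyl_gen = w
    & forall a r v, f (act a r v) = act a r (f v)].
Proof.
move=> wx wh wy; pose e (u : word) := foldr (fun l v => act l.1 l.2 v) w u.
have eR F : weyl_rel F -> free_lift e F = 0.
  have ll := free_lift_linear e.
  have z u : foldr (fun (l : letter) (v : M) => act l.1 l.2 v) 0 u = 0.
    by elim: u => //= l u ->; exact: linear0.
  case=> [u v c a b r|u v a b r s|u r|u|u];
    rewrite ?(linB ll) ?(linZ ll) !free_lift_gen /e -?cats1 !foldr_cat /=.
  - elim: u => [|l u IH] /=; first by rewrite act_linearl addrAC addrK subrr.
    by rewrite -linearZ -!linearB IH linear0.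
  - elim: u => [|l u IH] /=; first by rewrite act_bracket subrr.
    by rewrite -!linearB IH linear0.
  - by rewrite wx z.
  - rewrite wh; elim: u => [|l u IH] /=; first by rewrite subrr.
    by rewrite -linearZ -linearB IH linear0.
  - rewrite (_ : act _ _ _ = 0) ?z // -[RHS]wy /=; congr act.
    by elim: lambda => //= k ->.
exists (plift e); split.
- exact: plift_linear eR.
- exact: plift_gen eR [::].
- move=> a r v; have le := plift_linear eR.
  apply: (presented_ext (lin_comp le (weyl_act_linear a r))
    (lin_comp (@act_linear M a r) le)) => u /=.
  rewrite -/(weyl_word u) weyl_act_word /weyl_word.
  by rewrite (plift_gen eR (_ :: u)) (plift_gen eR u).
Qed.

End Weyl.

Definition weyl_sum (lambda : nat) (m : int -> nat) : gradedRep :=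
  dsumRep (fun i : {p : int & 'I_(m p)} => shift (tag i) (weyl lambda)).

Definition weyl_filtered (M : gradedRep) : Prop :=
  exists (k : nat) (F : nat -> gradedSub M),
    [/\ forall v, F 0 v,
        forall v, F k.+1 v -> v = 0
      & forall s, (s <= k)%N ->
          (forall v, F s.+1 v -> F s v) /\
          exists (lambda : nat) (m : int -> nat),
            rep_iso (subquot (F s) (F s.+1)) (weyl_sum lambda m)].

End GradedRep.

(* Main.v *)
(* A filtration whose layers are sums of shifts of single global Weyl modules passes to tensor
   products as soon as every W(lambda) (x) W(mu) has one: tensoring the filtration of M with N
   reduces to W(lambda) (x) N, and the same step on the other side to W(lambda) (x) W(mu).

   Write V = C^2[t].  Applying x (x) t^r and h (x) t^r to (y (x) 1)^(n+1) w_n = 0 yields straightening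
   relations by which W(n) is spanned by no more vectors than there are monomials in the symmetric
   power S^n(V), and these are independent there: W(n) = S^n(V).  In W(n) (x) V the vectors
   w_n (x) e_0 t^i are highest weight vectors of weight n + 1.  Those with i <= n generate
   a direct sum of n + 1 shifts of W(n+1) (a Vandermonde argument) and by Cayley-Hamilton also
   the others; modulo them W(n) (x) V is the sum of the shifts of W(n-1) by all p >= 0, as the
   contraction W(n) (x) V -> W(n-1)[t] by the symplectic form of C^2 shows.

   Since S^(m+1)(V) is a direct summand of S^m(V) (x) V, an induction on mu exhibits
   W(lambda) (x) W(mu+1) as a retract of W(lambda) (x) W(mu) (x) V, so it remains to see that
   filtrations pass to retracts.  If X is filtered, the submodules X_nu generated by the weight
   vectors of weight at least nu in absolute value have layers X_nu / X_(nu+1) that are sums of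
   shifts of W(nu), whatever the given filtration was.  This filtration is functorial, so an
   idempotent of X acts on each layer, and there its image is again a sum of shifts of W(nu),
   because W(nu) has scalar endomorphisms in degree 0 and the shifts are bounded below. *)

From HB Require Import structures.
From mathcomp Require Import all_boot all_order all_algebra.
From mathcomp Require Import finmap.
From mathcomp Require Import boolp classical_sets functions cardinality fsbigop.
From mathcomp Require Import reals complex.
From mathcomp Require Import zify.
Require Import Defs.

Set Implicit Arguments.
Unset Strict Implicit.
Unset Printing Implicit Defensive.

Import Order.TTheory GRing.Theory Num.Theory.

Local Open Scope classical_set_scope.
Local Open Scope ring_scope.

(** * Subspaces *)

(** A direct summand need not inherit a given filtration, because the idempotent may fail to
    preserve it; this forces a filtration intrinsic to the module. It uses absolute values of
    weights for the following reason: if g has weight lambda and lifts a generator of a layer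
    W(lambda), the defects x t^r g and y^(lambda+1) g have weights lambda + 2 and -lambda - 2, so g
    becomes a highest weight vector modulo the part of larger absolute weight.

    The number n + 1 of shifts of W(n+1) in W(n) (x) V has this origin: the vectors of weight n + 1
    form C[t_1, ..., t_n]^(S_n) (x) C[z], which is free over C[t_1, ..., t_n, z]^(S_(n+1)) with
    basis 1, z, ..., z^n.

    An endomorphism of a possibly infinite sum of shifts of W(nu) is a matrix that never raises the
    shift and is scalar between equal shifts. Its image is therefore found by induction from the
    largest shift that occurs in a vector; the lower bound on shifts ends the induction. *)

Section LinearAlgebra.
Variables (K : fieldType) (V : lmodType K).

Lemma spanS (A B : set V) v : A `<=` B -> span A v -> span B v.
Proof. by move=> AB Av S BS; apply: Av => a /AB; exact: BS. Qed.

Lemma subspace_of (P : V -> Prop) : P 0 -> (forall c u v, P u -> P v -> P (c *: u + v)) ->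
  exists S : subspace V, forall v, S v <-> P v.
Proof. by move=> P0 PP; exists (Subspace P0 PP). Qed.

Lemma span_min (A : set V) (S : subspace V) v :
  (forall a, A a -> S a) -> span A v -> S v.
Proof. by move=> AS; apply. Qed.

Lemma subspaceN (S : subspace V) v : S v -> S (- v).
Proof. by rewrite -scaleN1r; exact: subspaceZ. Qed.

Lemma subspaceB (S : subspace V) u v : S u -> S v -> S (u - v).
Proof. by move=> Su /subspaceN; exact: subspaceD. Qed.

Definition sum_subspace (S T : subspace V) : subspace V.
Proof.
exists (fun v => exists2 s, S s & T (v - s)).
  by exists 0; rewrite ?subr0; exact: subspace0.
move=> c u v [s Ss Ts] [s' Ss' Ts']; exists (c *: s + s'); first exact: subspaceP.
by rewrite opprD addrACA -scalerBr; exact: subspaceP.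
Defined.

(** Two vectors in spans of members of the chain lie in the span of the larger member; [v = 0]
    covers the empty chain. *)
Lemma span_bigcup (F : set (set V)) v : total_on F subset ->
  span (\bigcup_(X in F) X) v -> v = 0 \/ exists2 X, F X & span X v.
Proof.
move=> tF.
have [S SE] : exists S : subspace V, forall v, S v <-> (v = 0 \/ exists2 X, F X & span X v).
  apply: subspace_of => [|c u w]; first by left.
  case=> [->|[X FX Xu]]; first by rewrite scaler0 add0r.
  case=> [->|[Y FY Yw]]; right.
    by exists X => //; rewrite addr0; exact: subspaceZ.
  have [XY|YX] := tF _ _ FX FY.
    by exists Y => //; apply: subspaceP => //; exact: spanS Xu.
  by exists X => //; apply: subspaceP => //; exact: spanS Yw.
move=> /(_ S) Sv; apply/SE/Sv => a [X FX Xa]; apply/SE; right.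
by exists X => //; exact: span_gen.
Qed.

(** Zorn's lemma gives a maximal set [A] whose span meets [S] only in 0; this span is a complement
    of [S], and [p] projects along it. *)
Lemma subspace_retraction (S : subspace V) :
  exists p : V -> V, [/\ linear p, forall v, S (p v) & forall v, S v -> p v = v].
Proof.
pose P (A : set V) := forall v, span A v -> S v -> v = 0.
have [F FP tF|A [PA Amax]] := @Zorn_bigcup V P.
  move=> v /(span_bigcup tF)[//|[X FX Xv] Sv].
  exact: (FP X FX).
(* By maximality [S] and the span of [A] fill [V]: a vector outside their sum could be added to
   [A]. *)
have spl v : exists s, S s /\ span A (v - s).
  apply: contrapT => nv; have {}nv s : S s -> ~ span A (v - s).
    by move=> Ss As; apply: nv; exists s.
  have Bl : forall u, span (A `|` [set v]) u -> exists c, span A (u - c *: v).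
    have [T TE] : exists T : subspace V, forall u, T u <-> exists c, span A (u - c *: v).
      apply: subspace_of => [|c u w [d Ad] [d' Ad']].
        by exists 0; rewrite scale0r subr0; exact: subspace0.
      exists (c * d + d'); rewrite scalerDl opprD addrACA -scalerA -scalerBr.
      exact: subspaceP.
    move=> u /(_ T) Tu; apply/TE/Tu => a [Aa|->]; apply/TE.
      by exists 0; rewrite scale0r subr0; exact: span_gen.
    by exists 1; rewrite scale1r subrr; exact: subspace0.
  have /Amax : A `<` A `|` [set v].
    split; first by move=> a; left.
    move=> /(_ v (or_intror erefl)) Av; apply: (nv 0); first exact: subspace0.
    by rewrite subr0; exact: span_gen.
  apply=> u /Bl[c Auc] Su; have [c0|c0] := eqVneq c 0.
    by apply: PA => //; move: Auc; rewrite c0 scale0r subr0.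
  exfalso; apply: (nv (c^-1 *: u)); first exact: subspaceZ.
  have -> : v - c^-1 *: u = - c^-1 *: (u - c *: v).
    by rewrite scalerBr !scaleNr scalerA mulVf // scale1r opprK addrC.
  exact: subspaceZ.
pose p v := projT1 (cid (spl v)).
have Sp v : S (p v) by rewrite /p; case: cid => s [].
have Ap v : span A (v - p v) by rewrite /p; case: cid => s [].
have uq v s : S s -> span A (v - s) -> p v = s.
  move=> Ss As; apply/subr0_eq/PA; last exact: subspaceB.
  have -> : p v - s = (v - s) - (v - p v) by rewrite opprB [RHS]addrC addrA subrK.
  exact: subspaceB.
exists p; split=> // [c u v|v Sv].
  apply: uq; first exact: subspaceP.
  by rewrite opprD addrACA -scalerBr; exact: subspaceP.
by apply: uq => //; rewrite subrr; exact: subspace0.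
Qed.

Lemma line_subspace (w : V) : exists S : subspace V, forall v, S v <-> exists c, v = c *: w.
Proof.
apply: subspace_of => [|c _ _ [d ->] [e ->]]; first by exists 0; rewrite scale0r.
by exists (c * d + e); rewrite scalerDl scalerA.
Qed.

Lemma functional_sep (v : V) : v != 0 -> exists2 f : V -> K^o, linear f & f v != 0.
Proof.
move=> v0; have [S SE] := line_subspace v.
have [p [pl /(fun h u => (SE _).1 (h u)) pS pid]] := subspace_retraction S.
pose f u : K^o := projT1 (cid (pS u)).
have fE u : p u = f u *: v by rewrite /f; case: cid.
have inj (a b : K) : a *: v = b *: v -> a = b.
  move=> /eqP; rewrite -subr_eq0 -scalerBl scaler_eq0 (negPf v0) orbF subr_eq0.
  exact: eqP.
exists f => [c u w|].
  apply: inj; rewrite -fE pl !fE scalerDl; congr (_ + _).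
  by rewrite [LHS]scalerA.
apply/eqP => f0; move/negP: v0; apply; apply/eqP.
have <- : p v = v by apply/pid/SE; exists 1; rewrite scale1r.
by rewrite fE f0 scale0r.
Qed.

Section Independent.
Variables (J : choiceType) (v : J -> V).

Definition independent (A : set J) := forall (s : seq J) (c : J -> K), uniq s ->
  (forall j, j \in s -> A j) -> \sum_(j <- s) c j *: v j = 0 -> forall j, j \in s -> c j = 0.

(** Zorn's lemma on sets of indices, so equal vectors under two indices count as dependent. A
    relation involves finitely many indices, hence lives in one member of a chain. *)
Lemma maximal_independent : exists A : set J, independent A /\
  forall k, exists (s : seq J) (c : J -> K), [/\ uniq s, forall j, j \in s -> A j &
    v k = \sum_(j <- s) c j *: v j].
Proof.
have [F FP tF|A [PA Amax]] := @Zorn_bigcup J independent.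
  move=> s c us sF s0 j js.
  have [X FX sX] : exists2 X, F X & forall i, i \in s -> X i.
    elim: s sF j js {us s0} => // i s IH sF _ _.
    have [X FX Xi] : (\bigcup_(X in F) X) i by apply: sF; rewrite mem_head.
    case: s IH sF => [|k s] IH sF; first by exists X => // i'; rewrite inE => /eqP ->.
    have [|Y FY sY] := IH _ k (mem_head _ _).
      by move=> i' i's; apply: sF; rewrite inE i's orbT.
    have [XY|YX] := tF _ _ FX FY.
      by exists Y => // i'; rewrite inE => /orP[/eqP ->|/sY //]; exact: XY.
    by exists X => // i'; rewrite inE => /orP[/eqP -> //|/sY]; exact: YX.
  exact: (FP X FX s c).
exists A; split=> // k; have [Ak|nAk] := pselect (A k).
  exists [:: k], (fun=> 1); split=> // [j|]; first by rewrite inE => /eqP ->.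
  by rewrite big_seq1 scale1r.
have : ~ independent (A `|` [set k]).
  apply: Amax; split; first by move=> a; left.
  by move=> /(_ k (or_intror erefl)).
apply: contra_notP => nk s c us sA s0.
have [ks|nks] := boolP (k \in s); last first.
  apply: (PA s c) => // j js; have [//|/= jk] := sA _ js.
  by rewrite -jk js in nks.
have sA' j : j \in rem k s -> A j.
  move=> jr; have [//|/= jk] := sA _ (mem_rem jr).
  by move: jr; rewrite jk mem_rem_uniqF.
move: (s0); rewrite (big_rem k) //=.
have [ck|ck] := eqVneq (c k) 0.
  rewrite ck scale0r add0r => s0' j; have [->//|jk] := eqVneq j k => js.
  apply: (PA (rem k s) c) => //; first exact: rem_uniq.
  by rewrite mem_rem_uniq // inE jk.
move=> /eqP; rewrite addr_eq0 => /eqP E; exfalso; apply: nk.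
exists (rem k s), (fun j => - (c k)^-1 * c j); split=> //; first exact: rem_uniq.
rewrite -[LHS](scalerK ck) E scalerN -scaleNr scaler_sumr.
by apply: eq_bigr => j _; rewrite scalerA.
Qed.
End Independent.

End LinearAlgebra.

(** * Filtrations of graded representations *)

Section Homomorphisms.
Variable K : fieldType.
Implicit Types M N P Q X Y : gradedRep K.

Lemma homog_ext M (U : lmodType K) (f g : M -> U) : linear f -> linear g ->
  (forall r v, grade M r v -> f v = g v) -> f =1 g.
Proof.
move=> lf lg fg v; apply: subr0_eq.
by apply: (grading_ind (@grade_direct K M) (S := subspace_ker (lin_sub lf lg))) => r u /fg /= ->;
  rewrite subrr.
Qed.

Lemma hom_component M N (f : M -> N) : rep_hom f ->
  forall r v, f (component r v) = component r (f v).
Proof.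
case=> lf _ gf r; apply: homog_ext.
- exact: lin_comp lf (@component_linear K M r).
- exact: lin_comp (@component_linear K N r) lf.
move=> s v Mv; rewrite (component_id r Mv) (component_id r (gf _ _ Mv)).
by case: eqP => // _; exact: lin0.
Qed.

Lemma component_act M r a s (v : M) :
  component r (act a s v) = act a s (component (r - s%:Z) v).
Proof.
move: v; apply: homog_ext.
- exact: lin_comp (@component_linear K M r) (@act_linear K M a s).
- exact: lin_comp (@act_linear K M a s) (@component_linear K M (r - s%:Z)).
move=> t v Mv; rewrite (component_id _ Mv) (component_id r (act_grade a s Mv)).
by rewrite subr_eq addrC; case: eqP => // _; rewrite linear0.
Qed.

Lemma component_shift s M r (v : M) :
  component (r : int) (v : shift s M) = component (r - s) v.
Proof.
apply: (@homog_ext (shift s M) M _ _ (@component_linear K (shift s M) r)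
  (@component_linear K M (r - s))) => t u Mu.
rewrite (@component_id K (shift s M) r t u Mu) (component_id (r - s) (Mu : grade M (t - s) u)).
by rewrite (inj_eq (addIr _)).
Qed.

Lemma grade_component M r (v : M) : grade M r (component r v).
Proof. exact: homog_part_grade. Qed.

Lemma component_grade M r (v : M) : component r v = v -> grade M r v.
Proof. by move=> <-; exact: grade_component. Qed.

Lemma grade_component_id M r (v : M) : grade M r v -> component r v = v.
Proof. by move=> /component_id ->; rewrite eqxx. Qed.

Lemma rep_hom_id M : rep_hom (@id M).
Proof. by split. Qed.

Lemma rep_hom_comp X Y P (f : Y -> P) (g : X -> Y) : rep_hom f -> rep_hom g -> rep_hom (f \o g).
Proof.
case=> lf af gf [lg ag gg]; split=> [|a r v|r v Xv] /=.
- exact: lin_comp.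
- by rewrite ag af.
- exact/gf/gg.
Qed.

Definition full M : gradedSub M.
Proof.
pose S : subspace M := @Subspace _ _ (fun=> True) I (fun _ _ _ _ _ => I).
by exists S.
Defined.

Lemma zero_closed M c (u v : M) : u = 0 -> v = 0 -> c *: u + v = 0.
Proof. by move=> -> ->; rewrite scaler0 addr0. Qed.
Lemma zero_act M a r (v : M) : v = 0 -> act a r v = 0.
Proof. by move=> ->; exact: linear0. Qed.
Lemma zero_component M r (v : M) : v = 0 -> component r v = 0.
Proof. by move=> ->; exact: linear0. Qed.

Definition gsub0 M : gradedSub M :=
  @GradedSub K M (@Subspace K M (fun v => v = 0) erefl (@zero_closed M))
    (@zero_act M) (@zero_component M).

Section Generated.
Variables (M : gradedRep K) (A : set M).
Hypothesis A_component : forall r v, A v -> A (component r v).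

Definition act_stable (S : M -> Prop) := forall a r v, S v -> S (act a r v).

Definition generated_space : subspace M.
Proof.
exists (fun v => forall S : subspace M, (forall a, A a -> S a) -> act_stable S -> S v).
  by move=> S _ _; exact: subspace0.
by move=> c u v Su Sv S AS aS; apply: subspaceP; [exact: Su|exact: Sv].
Defined.

Lemma generated_act : act_stable generated_space.
Proof. by move=> a r v Av S AS aS; apply: (aS); exact: Av. Qed.

(** Homogeneity of the generating set passes to the submodule because components move past the
    action with a shift of degree. *)
Lemma generated_component r v : generated_space v -> generated_space (component r v).
Proof.
have [T TE] : exists T : subspace M, forall v, T v <-> forall r, generated_space (component r v).
  apply: subspace_of => [q|c u w Su Sw q]; first by rewrite linear0; exact: subspace0.
  by rewrite linearP; exact: (subspaceP c (Su q) (Sw q)).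
move=> /(_ T) gv; suff /TE : T v by [].
apply: gv => [a Aa|a q u /TE Tu]; apply/TE => s.
  by move=> S AS _; apply/AS/A_component.
by rewrite component_act; exact: generated_act.
Qed.

Definition generated : gradedSub M := GradedSub generated_act generated_component.

Lemma generated_gen v : A v -> generated v.
Proof. by move=> Av S AS _; exact: AS. Qed.

Lemma generated_min (S : subspace M) : (forall a, A a -> S a) -> act_stable S ->
  forall v, generated v -> S v.
Proof. by move=> AS aS v; apply. Qed.
End Generated.

End Homomorphisms.

Arguments full {K} M.
Arguments gsub0 {K} M.

(** * Direct sums of shifts of one module *)

Section ShiftSum.
Variables (K : fieldType) (A : gradedRep K) (I : choiceType) (d : I -> int).

Definition psum : gradedRep K := dsumRep (fun i => shift (d i) A).

(** All summands [shift (d i) A] have the carrier of [A]; reading coordinates there avoids dependent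
    types in the statements. *)
Definition pfun (i : I) (u : psum) : A := u i.

Lemma psumP (u v : psum) : (forall i, pfun i u = pfun i v) -> u = v.
Proof. by move=> uv; apply: dsumP => i; exact: uv. Qed.

Lemma pfun_linear i : linear (pfun i).
Proof. by []. Qed.

Lemma pfun_act i a r u : pfun i (act a r u) = act a r (pfun i u).
Proof. by []. Qed.

Lemma pfun_component i r u : pfun i (component r u) = component (r - d i) (pfun i u).
Proof.
rewrite -component_shift.
apply: (@homog_ext K psum A (fun u => pfun i (component r u))
  (fun u => component r (pfun i u : shift (d i) A))).
- exact: lin_comp (@pfun_linear i) (@component_linear K psum r).
- exact: lin_comp (@component_linear K (shift (d i) A) r) (@pfun_linear i).
move=> s v sv; rewrite (component_id r sv) (component_id r (sv i)).
by case: eqP.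
Qed.

Definition mkpsum (f : I -> A) (ff : finite_set [set i | f i != 0]) : psum :=
  @DSum K I (fun i => shift (d i) A : lmodType K) f ff.

Fact pinj_fin i (u : A) : finite_set [set j : I | (if j == i then u else 0) != 0].
Proof.
apply: sub_finite_set (finite_set1 i) => j /=.
by case: (eqVneq j i) => //= _; rewrite eqxx.
Qed.
Definition pinj (i : I) (u : A) : psum := mkpsum (pinj_fin i u).

Lemma pfun_pinj j i u : pfun j (pinj i u) = if j == i then u else 0.
Proof. by []. Qed.

Lemma pfun_pinj_id i u : pfun i (pinj i u) = u.
Proof. by rewrite pfun_pinj eqxx. Qed.

Lemma pinj_linear i : linear (pinj i).
Proof.
move=> c u v; apply: psumP => j.
rewrite [RHS](pfun_linear j c (pinj i u) (pinj i v)) !pfun_pinj; case: eqP => // _.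
by rewrite scaler0 addr0.
Qed.

Lemma pinj_act i a r u : pinj i (act a r u) = act a r (pinj i u).
Proof.
apply: psumP => j; rewrite pfun_act !pfun_pinj.
by case: eqP => // _; rewrite linear0.
Qed.

Lemma pinj_grade i r u : grade A r u -> grade psum (r + d i) (pinj i u).
Proof.
move=> Au j; rewrite /= ; case: (eqVneq j i) => [->|_]; last exact: subspace0.
by rewrite addrK.
Qed.

Lemma psum_fsum u : u = \sum_(i \in [set: I]) pinj i (pfun i u).
Proof.
apply: psumP => j.
have [s us u0] := finsupp_seq (dsum_fin u).
have v0 i : i \notin s -> pfun i u = 0 by move=> /u0 /= /negP; rewrite negbK => /eqP.
rewrite (fsumE us) => [|i /v0 ->]; last exact: (lin0 (@pinj_linear i)).
rewrite (lin_sum _ _ (@pfun_linear j)).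
have [js|js] := boolP (j \in s); last first.
  rewrite v0 // big_seq big1 // => i si; rewrite pfun_pinj.
  by case: eqP => // ji; rewrite ji si in js.
rewrite (bigD1_seq j) // big1 => [|i /negPf ij]; last by rewrite pfun_pinj eq_sym ij.
by rewrite pfun_pinj eqxx; exact/esym/addr0.
Qed.

Lemma psum_ind (S : subspace psum) : (forall i u, S (pinj i u)) -> forall u, S u.
Proof.
move=> Si u; rewrite (psum_fsum u).
have [s us u0] := finsupp_seq (dsum_fin u).
rewrite (fsumE us); last first.
  move=> i /u0 /= /negP; rewrite negbK => /eqP ui; rewrite /pfun ui; exact: (lin0 (@pinj_linear i)).
by apply: subspace_sum.
Qed.

Section Lift.
Variables (U : lmodType K) (f : I -> A -> U).
Hypothesis fl : forall i, linear (f i).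

Definition plsum (u : psum) : U := \sum_(i \in [set: I]) f i (pfun i u).

Lemma plsum_linear : linear plsum.
Proof.
apply: fsum_linear => [i|u]; first exact: lin_comp (fl i) (@pfun_linear i).
apply: sub_finite_set (dsum_fin u) => i /=; rewrite /pfun; apply: contra_neq => ->.
exact: lin0.
Qed.

Lemma plsum_pinj i u : plsum (pinj i u) = f i u.
Proof.
rewrite /plsum (fsum1 (i0 := i)) ?pfun_pinj_id // => j /negPf ji.
by rewrite pfun_pinj ji lin0.
Qed.
End Lift.

Lemma plsum_act (X : gradedRep K) (f : I -> A -> X) : (forall i, linear (f i)) ->
  (forall i a r u, f i (act a r u) = act a r (f i u)) ->
  forall a r u, plsum f (act a r u) = act a r (plsum f u).
Proof.
move=> fl fa a r; have pl := plsum_linear fl.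
have l1 := lin_comp pl (@act_linear K psum a r).
have l2 := lin_comp (@act_linear K X a r) pl.
move=> u; apply: subr0_eq; apply: (psum_ind (S := subspace_ker (lin_sub l1 l2))) => i v.
change (plsum f (act a r (pinj i v)) - act a r (plsum f (pinj i v)) = 0).
by rewrite -pinj_act !plsum_pinj // fa subrr.
Qed.

Lemma plsum_hom (X : gradedRep K) (f : I -> A -> X) : (forall i, linear (f i)) ->
  (forall i a r u, f i (act a r u) = act a r (f i u)) ->
  (forall i r u, grade A r u -> grade X (r + d i) (f i u)) -> rep_hom (plsum f).
Proof.
move=> fl fa fg; split; [exact: plsum_linear|exact: plsum_act|].
move=> r u ur; rewrite /plsum.
have [s us u0] := finsupp_seq (dsum_fin u).
rewrite (fsumE us); last first.
  by move=> i /u0 /= /negP; rewrite negbK => /eqP ui; rewrite /pfun ui lin0.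
apply: subspace_sum => i; rewrite -[r](subrK (d i)); exact/fg/ur.
Qed.

End ShiftSum.

Definition wsum (K : fieldType) (lambda : nat) (I : choiceType) (d : I -> int) : gradedRep K :=
  psum (weyl K lambda) d.

(** * Layers as graphs, and chains of layers *)

Section Layers.
Variable K : fieldType.
Implicit Types M N P Q X Y : gradedRep K.

(* R is the graph of an epimorphism F -> P with kernel F'. *)
Record is_layer M P (F F' : gradedSub M) (R : M -> P -> Prop) : Prop := IsLayer {
  layer_lin : forall c u v p q, R u p -> R v q -> R (c *: u + v) (c *: p + q);
  layer_dom : forall v p, R v p -> F v;
  layer_tot : forall v, F v -> exists p, R v p;
  layer_sur : forall p, exists v, R v p;
  layer_act : forall a r v p, R v p -> R (act a r v) (act a r p);
  layer_cmp : forall r v p, R v p -> R (component r v) (component r p);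
  layer_fun : forall p, R 0 p -> p = 0;
  layer_ker : forall v, F' v <-> R v 0 }.

Definition layer M P (F F' : gradedSub M) : Prop := exists R : M -> P -> Prop, is_layer F F' R.
Arguments layer {M} P F F'.

Section LayerTheory.
Variables (M P : gradedRep K) (F F' : gradedSub M) (R : M -> P -> Prop).
Hypothesis RL : is_layer F F' R.

Lemma layer0 : R 0 0.
Proof. by apply/(layer_ker RL); exact: subspace0. Qed.

Lemma layerZ c v p : R v p -> R (c *: v) (c *: p).
Proof. by move=> /(layer_lin RL c) /(_ layer0); rewrite !addr0. Qed.

Lemma layerD u v p q : R u p -> R v q -> R (u + v) (p + q).
Proof. by move=> Ru /(layer_lin RL 1 Ru); rewrite !scale1r. Qed.

Lemma layerB u v p q : R u p -> R v q -> R (u - v) (p - q).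
Proof. by move=> Ru /(layerZ (-1)); rewrite !scaleN1r; exact: layerD. Qed.

Lemma layer_uniq v p q : R v p -> R v q -> p = q.
Proof.
move=> Rp Rq; apply: subr0_eq; apply: (layer_fun RL).
by have := layerB Rp Rq; rewrite subrr.
Qed.

Lemma layer_sub v : F' v -> F v.
Proof. by move/(layer_ker RL)/(layer_dom RL). Qed.

Lemma layer_ker0 v p : F' v -> R v p -> p = 0.
Proof. by move/(layer_ker RL) => R0 /layer_uniq; apply. Qed.

Lemma layer_mod u v p : F' (u - v) -> R v p -> R u p.
Proof. by move/(layer_ker RL) => /layerD R0 /R0; rewrite subrK add0r. Qed.

Definition layer_preim (G : gradedSub P) : gradedSub M.
Proof.
pose S : subspace M := @Subspace K M (fun v => exists2 p, R v p & G p)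
  (ex_intro2 _ _ 0 layer0 (subspace0 G))
  (fun c u v Hu Hv => match Hu, Hv with
     | ex_intro2 p Rp Gp, ex_intro2 q Rq Gq =>
       ex_intro2 _ _ (c *: p + q) (layer_lin RL c Rp Rq) (subspaceP c Gp Gq) end).
exists S => [a r v [p Rp Gp]|r v [p Rp Gp]].
  by exists (act a r p); [exact: (layer_act RL)|exact: gsub_act].
by exists (component r p); [exact: (layer_cmp RL)|exact: gsub_component].
Defined.

(** The third isomorphism theorem, obtained by composing the two graphs. *)
Lemma layer_comp Q (G G' : gradedSub P) : layer Q G G' ->
  layer Q (layer_preim G) (layer_preim G').
Proof.
case=> T TL; exists (fun v q => exists2 p, R v p & T p q); split.
- move=> c u v p q [p' Rp Tp] [q' Rq Tq]; exists (c *: p' + q'); first exact: (layer_lin RL).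
  exact: (layer_lin TL).
- by move=> v q [p Rp Tp]; exists p => //; exact: (layer_dom TL) Tp.
- by move=> v [p Rp /(layer_tot TL)[q Tq]]; exists q; exists p.
- by move=> q; have [p Tp] := layer_sur TL q; have [v Rv] := layer_sur RL p; exists v; exists p.
- move=> a r v q [p Rp Tp]; exists (act a r p); [exact: (layer_act RL)|exact: (layer_act TL)].
- move=> r v q [p Rp Tp].
  by exists (component r p); [exact: (layer_cmp RL)|exact: (layer_cmp TL)].
- by move=> q [p /(layer_fun RL) -> /(layer_fun TL)].
- move=> v; split=> [[p Rp /(layer_ker TL)]|[p Rp /(layer_ker TL)]]; by exists p.
Qed.
End LayerTheory.

Lemma layer_ext M P (F G F' G' : gradedSub M) : (forall v, F v <-> G v) ->
  (forall v, F' v <-> G' v) -> layer P F F' -> layer P G G'.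
Proof.
move=> FG FG' [R RL]; exists R; split.
- exact: layer_lin RL.
- by move=> v p /(layer_dom RL) /FG.
- by move=> v /FG /(layer_tot RL).
- exact: layer_sur RL.
- exact: layer_act RL.
- exact: layer_cmp RL.
- exact: layer_fun RL.
- by move=> v; rewrite -FG'; exact: layer_ker RL v.
Qed.

Lemma layer_refl M P (F F' : gradedSub M) : (forall v, F v <-> F' v) ->
  (forall p : P, p = 0) -> layer P F F'.
Proof.
move=> FF' P0; exists (fun v _ => F v); split=> //.
- by move=> c u v _ _; exact: subspaceP.
- by move=> v Fv; exists 0.
- by move=> p; exists 0; exact: subspace0.
- by move=> a r v _; exact: gsub_act.
- by move=> r v _; exact: gsub_component.
- by move=> v; rewrite FF'.
Qed.

Lemma layer_of_hom M P (F F' : gradedSub M) (f : M -> P) : linear f ->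
  (forall a r v, F v -> f (act a r v) = act a r (f v)) ->
  (forall r v, F v -> f (component r v) = component r (f v)) ->
  (forall p, exists2 v, F v & f v = p) ->
  (forall v, F' v <-> F v /\ f v = 0) -> layer P F F'.
Proof.
move=> lf af cf sf kf; exists (fun v p => F v /\ f v = p); split.
- by move=> c u v _ _ [Fu <-] [Fv <-]; split; [exact: subspaceP|exact: lf].
- by move=> v p [].
- by move=> v Fv; exists (f v).
- by move=> p; have [v Fv vp] := sf p; exists v.
- by move=> a r v p [Fv <-]; split; [exact: gsub_act|exact: af].
- by move=> r v p [Fv <-]; split; [exact: gsub_component|exact: cf].
- by move=> p [_ <-]; exact: lin0.
- exact: kf.
Qed.

Lemma layer_of_epi M P (F' : gradedSub M) (f : M -> P) : rep_hom f ->
  (forall p, exists v, f v = p) -> (forall v, F' v <-> f v = 0) -> layer P (full M) F'.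
Proof.
move=> hf sf kf; have [lf af _] := hf; apply: (layer_of_hom lf) => //.
- by move=> r v _; exact: hom_component.
- by move=> p; have [v vp] := sf p; exists v.
- by move=> v; rewrite kf; split=> [|[]].
Qed.

Lemma layer_target M P Q (F F' : gradedSub M) (f : P -> Q) : rep_hom f -> bijective f ->
  layer P F F' -> layer Q F F'.
Proof.
move=> hf [g fg gf] [R RL]; have [lf af _] := hf.
exists (fun v q => R v (g q)).
have lg : linear g by move=> c u v; apply: (can_inj fg); rewrite lf !gf.
have ag a r v : g (act a r v) = act a r (g v) by apply: (can_inj fg); rewrite af !gf.
have cg r v : g (component r v) = component r (g v).
  by apply: (can_inj fg); rewrite (hom_component hf) !gf.
split.
- by move=> c u v p q Ru Rv; rewrite lg; exact: (layer_lin RL).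
- by move=> v p; exact: (layer_dom RL).
- by move=> v /(layer_tot RL)[p Rp]; exists (f p); rewrite fg.
- by move=> q; exact: (layer_sur RL).
- by move=> a r v q Rq; rewrite ag; exact: (layer_act RL).
- by move=> r v q Rq; rewrite cg; exact: (layer_cmp RL).
- by move=> q /(layer_fun RL) gq; rewrite -[q]gf gq; exact: lin0.
- by move=> v; rewrite (lin0 lg); exact: (layer_ker RL).
Qed.

(* The sums of shifts have arbitrary index types here; finiteness of the multiplicities is recovered
   from that of the graded pieces. *)
Inductive chain M : gradedSub M -> Prop :=
| chain0 (F : gradedSub M) : (forall v, F v -> v = 0) -> chain F
| chainS (F F' : gradedSub M) lambda (I : choiceType) (d : I -> int) :
    layer (wsum K lambda d) F F' -> chain F' -> chain F.

Lemma chain_ext M (F G : gradedSub M) : (forall v, F v <-> G v) -> chain F -> chain G.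
Proof.
move=> FG cF; case: cF FG => {F} [F F0|F F' lambda I d L cF'] FG.
  by apply: chain0 => v /FG /F0.
by apply: (chainS (F' := F')) cF'; apply: layer_ext L.
Qed.

(** The chain of the quotient [P] is pulled back to submodules between [F'] and [F] and continued by
    the chain of [F']. *)
Lemma chain_pull M P (F F' : gradedSub M) : layer P F F' -> chain (full P) -> chain F' -> chain F.
Proof.
case=> R RL cP cF'; suff cG (G : gradedSub P) : chain G -> chain (layer_preim RL G).
  apply: chain_ext (cG _ cP) => v /=; split=> [[p /(layer_dom RL)] //|].
  by move=> /(layer_tot RL)[p]; exists p.
elim=> {cP} [{}G G0|{}G G' lambda I d L _ IH].
  apply: chain_ext cF' => v; rewrite (layer_ker RL) /=; split=> [Rv|[p Rp /G0 p0]].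
    by exists 0 => //; exact: (subspace0 G).
  by rewrite -p0.
by apply: (chainS (F' := layer_preim RL G')) IH; exact: (layer_comp RL L).
Qed.

Lemma chain_iso X Y (f : Y -> X) : rep_hom f -> injective f -> (forall x, exists y, f y = x) ->
  chain (full X) -> chain (full Y).
Proof.
move=> hf fi fs cX; have [lf _ _] := hf.
have c0 : chain (gsub0 Y) by apply: chain0.
apply: chain_pull cX c0; apply: (layer_of_epi hf) => // v /=; split=> [->|]; first exact: lin0.
by rewrite -(lin0 lf) => /fi.
Qed.

Lemma chain_mono X Y (f : X -> Y) : rep_hom f -> injective f -> (forall y, exists x, f x = y) ->
  chain (full X) -> chain (full Y).
Proof.
move=> hf fi fs; have [lf af gf] := hf.
pose g y := projT1 (cid (fs y)); have fg y : f (g y) = y by rewrite /g; case: cid.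
have gf' x : g (f x) = x by apply: fi; rewrite fg.
have lg : linear g by move=> c u v; apply: fi; rewrite lf !fg.
have hg : rep_hom g.
  split=> // [a r v|r v Yv]; first by apply: fi; rewrite af !fg.
  by apply: component_grade; apply: fi; rewrite (hom_component hf) fg grade_component_id.
by apply: (chain_iso hg) => [|x]; [exact: can_inj fg|exists (f x)].
Qed.

End Layers.
Arguments layer {K M} P F F'.

(** * Maps out of global Weyl modules and their sums *)

Section WeylHom.
Variable K : fieldType.

Definition highest_weight (M : gradedRep K) (lambda : nat) (w : M) : Prop :=
  [/\ forall r, act sl2_x r w = 0, act sl2_h 0 w = lambda%:R *: w
    & iter lambda.+1 (act sl2_y 0) w = 0].

Lemma weyl_gen_hw lambda : highest_weight lambda (weyl_gen K lambda).
Proof. exact: weyl_gen_rel. Qed.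

Lemma weyl_gen_grade lambda : grade (weyl K lambda) 0 (weyl_gen K lambda).
Proof. by apply: span_gen; exists [::] => //; rewrite /word_degree big_nil. Qed.

Lemma weyl_ext lambda (U : lmodType K) (f g : weyl K lambda -> U)
    (T : sl2 K -> nat -> U -> U) : linear f -> linear g ->
  (forall a r v, f (act a r v) = T a r (f v)) -> (forall a r v, g (act a r v) = T a r (g v)) ->
  f (weyl_gen K lambda) = g (weyl_gen K lambda) -> f =1 g.
Proof.
move=> lf lg af ag fg v; apply: subr0_eq.
apply: (weyl_generated (S := subspace_ker (lin_sub lf lg))) => [|a r u] /=.
  by rewrite fg subrr.
by move=> /subr0_eq E; rewrite af ag E subrr.
Qed.

Lemma weyl_hom lambda (M : gradedRep K) (w : M) (d : int) :
  highest_weight lambda w -> grade M d w ->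
  exists f : weyl K lambda -> M, [/\ linear f, f (weyl_gen K lambda) = w,
    forall a r v, f (act a r v) = act a r (f v)
    & forall r v, grade (weyl K lambda) r v -> grade M (r + d) (f v)].
Proof.
case=> wx wh wy wd; have [f [lf fw fa]] := weyl_universal wx wh wy.
exists f; split=> //.
(* [weyl_universal] says nothing about grades. The vectors all of whose components land in the right
   grade form a subspace that contains the generator and is stable under the action. *)
have [S SE] : exists S : subspace (weyl K lambda),
    forall v, S v <-> forall r, grade M (r + d) (f (component r v)).
  apply: subspace_of => [r|c u v fu fv r]; first by rewrite linear0 lin0 //; exact: subspace0.
  by rewrite linearP lf; exact: (subspaceP c (fu r) (fv r)).
suff SS v : S v by move=> r v /grade_component_id <-; have /SE := SS v.
apply: (weyl_generated (S := S)) => [|a s u /SE Su]; apply/SE => r.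
  rewrite (component_id r (@weyl_gen_grade lambda)).
  by case: eqP => [->|_]; rewrite ?add0r ?fw ?lin0 //; exact: subspace0.
rewrite component_act fa; have := act_grade a s (Su (r - s%:Z)).
by rewrite addrA [s%:Z + _]addrC subrK.
Qed.

Section Wsum.
Variables (lambda : nat) (I : choiceType) (d : I -> int).
Notation W := (weyl K lambda).
Notation P := (wsum K lambda d).
Notation w := (weyl_gen K lambda).

Definition wgen (i : I) : P := pinj d i w.

Lemma wgen_hw i : highest_weight lambda (wgen i).
Proof.
have [wx wh wy] := weyl_gen_hw lambda.
split=> [r||]; rewrite /wgen.
- by rewrite -pinj_act wx (lin0 (pinj_linear _ _)).
- by rewrite -pinj_act wh (linZ (pinj_linear _ _)).
rewrite (_ : iter _ _ _ = pinj d i (iter lambda.+1 (act sl2_y 0) w)).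
  by rewrite wy (lin0 (pinj_linear _ _)).
by elim: lambda.+1 => // k IH; rewrite !iterS IH pinj_act.
Qed.

Lemma wgen_grade i : grade P (d i) (wgen i).
Proof. by rewrite -[d i]add0r; apply: pinj_grade; exact: weyl_gen_grade. Qed.

Lemma wsum_generated (S : subspace P) : (forall i, S (wgen i)) ->
  (forall a r v, S v -> S (act a r v)) -> forall v, S v.
Proof.
move=> Sw Sa; apply: psum_ind => i.
apply: (weyl_generated (S := preim_subspace (pinj_linear d i) S)) => [|a r u] /=.
  exact: Sw.
by rewrite pinj_act; exact: Sa.
Qed.

Lemma wsum_ext (U : lmodType K) (f g : P -> U)
    (T : sl2 K -> nat -> U -> U) : linear f -> linear g ->
  (forall a r v, f (act a r v) = T a r (f v)) -> (forall a r v, g (act a r v) = T a r (g v)) ->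
  (forall i, f (wgen i) = g (wgen i)) -> f =1 g.
Proof.
move=> lf lg af ag fg v; apply: subr0_eq.
apply: (wsum_generated (S := subspace_ker (lin_sub lf lg))) => [i|a r u] /=.
  by rewrite fg subrr.
by move=> /subr0_eq E; rewrite af ag E subrr.
Qed.

Lemma wsum_hom (X : gradedRep K) (g : I -> X) : (forall i, highest_weight lambda (g i)) ->
  (forall i, grade X (d i) (g i)) ->
  exists2 f : P -> X, rep_hom f & forall i, f (wgen i) = g i.
Proof.
move=> gw gd; pose h i := projT1 (cid (weyl_hom (gw i) (gd i))).
have hP i : [/\ linear (h i), h i w = g i, forall a r v, h i (act a r v) = act a r (h i v)
    & forall r v, grade W r v -> grade X (r + d i) (h i v)].
  by rewrite /h; case: cid.
have hl i : linear (h i) by have [] := hP i.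
exists (plsum h).
  by apply: plsum_hom => // i; have [] := hP i.
by move=> i; rewrite plsum_pinj //; have [] := hP i.
Qed.

End Wsum.
End WeylHom.

(** * Tensor products of filtrations *)

Section TensorHom.
Variable K : fieldType.
Implicit Types M N P Q X Y : gradedRep K.

Lemma act_tens M N a r (v : M) (w : N) :
  act a r (tens v w : tensorRep M N) = tens (act a r v) w + tens v (act a r w).
Proof. exact: tensor_actE. Qed.

Lemma grade_tens M N i j (v : M) (w : N) : grade M i v -> grade N j w ->
  grade (tensorRep M N) (i + j) (tens v w).
Proof. by move=> Mv Nw; apply: span_gen; exists i, j, v, w. Qed.

Section LiftHom.
Variables (M N X : gradedRep K) (f : M -> N -> X) (d : int).
Hypotheses (fl : forall w, linear (f^~ w)) (fr : forall v, linear (f v)).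
Hypothesis fa : forall a r v w, act a r (f v w) = f (act a r v) w + f v (act a r w).

Lemma tensor_lift_act a r (t : tensorRep M N) :
  tensor_lift f (act a r t) = act a r (tensor_lift f t).
Proof.
have lf := tensor_lift_linear fl fr.
apply: (tensor_ext (lin_comp lf (@act_linear K (tensorRep M N) a r))
  (lin_comp (@act_linear K X a r) lf)) => v w.
change (tensor_lift f (act a r (tens v w : tensorRep M N)) = act a r (tensor_lift f (tens v w))).
rewrite act_tens (linD lf).
by rewrite !(tensor_liftE fl fr) fa.
Qed.

Hypothesis fg : forall i j v w, grade M i v -> grade N j w -> grade X (i + j + d) (f v w).

Lemma tensor_lift_grade r (t : tensorRep M N) :
  grade (tensorRep M N) r t -> grade X (r + d) (tensor_lift f t).
Proof.
have lf := tensor_lift_linear fl fr.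
apply: (span_min (S := preim_subspace lf (grade X (r + d)))) => _ [i [j [v [w [Mv Nw <- ->]]]]] /=.
by rewrite (tensor_liftE fl fr); exact: fg.
Qed.
End LiftHom.

Lemma tensor_lift_hom M N X (f : M -> N -> X) :
  (forall w, linear (f^~ w)) -> (forall v, linear (f v)) ->
  (forall a r v w, act a r (f v w) = f (act a r v) w + f v (act a r w)) ->
  (forall i j v w, grade M i v -> grade N j w -> grade X (i + j) (f v w)) ->
  rep_hom (tensor_lift f : tensorRep M N -> X).
Proof.
move=> fl fr fa fg; split; first exact: tensor_lift_linear.
  exact: tensor_lift_act.
move=> r v; rewrite -[r in grade X r]addr0; apply: tensor_lift_grade => // i j u w Mu Nw.
by rewrite addr0; exact: fg.
Qed.

Section Map.
Variables (M N X Y : gradedRep K) (f : M -> X) (g : N -> Y).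
Hypotheses (lf : linear f) (lg : linear g).

Definition tensor_map : tensorRep M N -> tensorRep X Y :=
  tensor_lift (fun v w => tens (f v) (g w)).

Fact tensor_map_l w : linear (fun v => tens (f v) (g w)).
Proof. exact: lin_comp (tens_linearl (g w)) lf. Qed.
Fact tensor_map_r v : linear (fun w => tens (f v) (g w)).
Proof. exact: lin_comp (tens_linear (f v)) lg. Qed.

Lemma tensor_map_linear : linear tensor_map.
Proof. exact: tensor_lift_linear tensor_map_l tensor_map_r. Qed.

Lemma tensor_mapE v w : tensor_map (tens v w) = tens (f v) (g w).
Proof. exact: tensor_liftE tensor_map_l tensor_map_r v w. Qed.

Lemma tensor_map_act : (forall a r v, f (act a r v) = act a r (f v)) ->
  (forall a r v, g (act a r v) = act a r (g v)) ->
  forall a r t, tensor_map (act a r t) = act a r (tensor_map t).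
Proof.
move=> af ag; apply: tensor_lift_act; [exact: tensor_map_l|exact: tensor_map_r|].
by move=> a r v w; rewrite act_tens af ag.
Qed.
End Map.

Lemma tensor_map_hom M N X Y (f : M -> X) (g : N -> Y) : rep_hom f -> rep_hom g ->
  rep_hom (tensor_map f g).
Proof.
case=> lf af gf [lg ag gg]; split; first exact: tensor_map_linear.
  exact: tensor_map_act.
move=> r t; rewrite -[r in grade (tensorRep X Y) r]addr0; apply: tensor_lift_grade.
- exact: tensor_map_l.
- exact: tensor_map_r.
- by move=> i j v w Mv Nw; rewrite addr0; apply: grade_tens; [exact: gf|exact: gg].
Qed.

Definition tensor_swap M N : tensorRep M N -> tensorRep N M :=
  tensor_lift (fun v w => tens w v).

Lemma tensor_swap_tens M N (v : M) (w : N) : tensor_swap (tens v w) = tens w v.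
Proof. by apply: tensor_liftE => [{}w|{}v]; [exact: tens_linear|exact: tens_linearl]. Qed.

Lemma tensor_swap_hom M N : rep_hom (@tensor_swap M N).
Proof.
apply: tensor_lift_hom => [w|v|a r v w|i j v w Mv Nw].
- exact: tens_linear.
- exact: tens_linearl.
- by rewrite act_tens addrC.
- by rewrite addrC; exact: grade_tens.
Qed.

Lemma tensor_swapK M N : cancel (@tensor_swap M N) (@tensor_swap N M).
Proof.
have [l1 _ _] := tensor_swap_hom M N; have [l2 _ _] := tensor_swap_hom N M.
apply: (tensor_ext (lin_comp l2 l1) (@lin_id K _)) => v w /=.
by rewrite !tensor_swap_tens.
Qed.

Lemma chain_swap M N : chain (full (tensorRep M N)) -> chain (full (tensorRep N M)).
Proof.
apply: (chain_mono (tensor_swap_hom M N)); first exact: can_inj (@tensor_swapK M N).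
by move=> t; exists (tensor_swap t); rewrite tensor_swapK.
Qed.

Section Assoc.
Variables X Y Z : gradedRep K.

Definition tensor_assocl_fun (x : X) : tensorRep Y Z -> tensorRep (tensorRep X Y) Z :=
  tensor_map (fun y => tens x y : tensorRep X Y) id.

Definition tensor_assocl : tensorRep X (tensorRep Y Z) -> tensorRep (tensorRep X Y) Z :=
  tensor_lift tensor_assocl_fun.

Let mapl x y z : tensor_assocl_fun x (tens y z) = tens (tens x y : tensorRep X Y) z.
Proof. exact: (@tensor_mapE Y Z (tensorRep X Y) Z (fun y => tens x y) id (tens_linear x) (@lin_id K Z) y z). Qed.
Let mapll x : linear (tensor_assocl_fun x).
Proof. exact: (@tensor_map_linear Y Z (tensorRep X Y) Z (fun y => tens x y) id (tens_linear x) (@lin_id K Z)). Qed.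

Lemma tensor_assocl_l t : linear (tensor_assocl_fun^~ t).
Proof.
move=> c x x'; apply: (tensor_ext (mapll _) (lin_add (lin_scale c (mapll x)) (mapll x'))) => y z /=.
by rewrite !mapl tens_linearl tens_linearl.
Qed.

Lemma tensor_assocl_hom : rep_hom tensor_assocl.
Proof.
apply: tensor_lift_hom => [t|x|a r x|i j x].
- exact: tensor_assocl_l.
- exact: mapll.
- have l1 := lin_comp (@act_linear K (tensorRep (tensorRep X Y) Z) a r) (mapll x).
  have l2 := lin_add (mapll (act a r x)) (lin_comp (mapll x) (@act_linear K (tensorRep Y Z) a r)).
  apply: (tensor_ext l1 l2) => y z.
  change (act a r (tensor_assocl_fun x (tens y z)) = tensor_assocl_fun (act a r x) (tens y z)
    + tensor_assocl_fun x (act a r (tens y z : tensorRep Y Z))).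
  by rewrite act_tens (linD (mapll x)) !mapl !act_tens (linD (tens_linearl z)) addrA.
- move=> t Xx; apply: (span_min (S := preim_subspace (mapll x) (grade _ (i + j)))).
  move=> _ [k [l [y [z [Yy Zz <- ->]]]]] /=; rewrite mapl addrA.
  by apply: grade_tens => //; exact: grade_tens.
Qed.

Lemma tensor_assocl_tens x y z : tensor_assocl (tens x (tens y z : tensorRep Y Z)) =
  tens (tens x y : tensorRep X Y) z.
Proof.
rewrite [LHS](tensor_liftE _ _) ; [exact: mapl|exact: tensor_assocl_l|exact: mapll].
Qed.

Definition tensor_assocr_fun (t : tensorRep X Y) (z : Z) : tensorRep X (tensorRep Y Z) :=
  tensor_map id (fun y => tens y z : tensorRep Y Z) t.

Definition tensor_assocr : tensorRep (tensorRep X Y) Z -> tensorRep X (tensorRep Y Z) :=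
  tensor_lift tensor_assocr_fun.

Let mapr z x y : tensor_assocr_fun (tens x y) z = tens x (tens y z : tensorRep Y Z).
Proof. exact: (@tensor_mapE X Y X (tensorRep Y Z) id (fun y => tens y z) (@lin_id K X) (tens_linearl z) x y). Qed.
Let maprl z : linear (tensor_assocr_fun^~ z).
Proof. exact: (@tensor_map_linear X Y X (tensorRep Y Z) id (fun y => tens y z) (@lin_id K X) (tens_linearl z)). Qed.

Lemma tensor_assocr_r t : linear (tensor_assocr_fun t).
Proof.
move=> c z z'; move: t.
apply: (tensor_ext (maprl _) (lin_add (lin_scale c (maprl z)) (maprl z'))) => x y /=.
by rewrite !mapr tens_linear tens_linear.
Qed.

Lemma tensor_assocr_hom : rep_hom tensor_assocr.
Proof.
apply: tensor_lift_hom => [z|t|a r t z|i j t z].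
- exact: maprl.
- exact: tensor_assocr_r.
- move: t.
  have l1 := lin_comp (@act_linear K (tensorRep X (tensorRep Y Z)) a r) (maprl z).
  have l2 := lin_add (lin_comp (maprl z) (@act_linear K (tensorRep X Y) a r)) (maprl (act a r z)).
  apply: (tensor_ext l1 l2) => x y.
  change (act a r (tensor_assocr_fun (tens x y) z) =
    tensor_assocr_fun (act a r (tens x y : tensorRep X Y)) z
    + tensor_assocr_fun (tens x y) (act a r z)).
  by rewrite act_tens (linD (maprl z)) !mapr !act_tens (linD (tens_linear x)) addrA.
- move=> + Zz; apply: (span_min (S := preim_subspace (maprl z) (grade _ (i + j)))).
  move=> _ [k [l [x [y [Xx Yy <- ->]]]]] /=; rewrite mapr -addrA.
  by apply: grade_tens => //; exact: grade_tens.
Qed.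

Lemma tensor_assocr_tens x y z : tensor_assocr (tens (tens x y : tensorRep X Y) z) =
  tens x (tens y z : tensorRep Y Z).
Proof.
rewrite [LHS](tensor_liftE _ _) ; [exact: mapr|exact: maprl|exact: tensor_assocr_r].
Qed.

Lemma tensor_assoclK : cancel tensor_assocl tensor_assocr.
Proof.
have [l1 _ _] := tensor_assocl_hom; have [l2 _ _] := tensor_assocr_hom.
move=> t; pose D := lin_sub (lin_comp l2 l1) (@lin_id K _).
apply: subr0_eq; move: t; apply: (tensor_ind (S := subspace_ker D)) => x t /=.
have lx : linear (fun t => tensor_assocr (tensor_assocl (tens x t)) - tens x t).
  exact: lin_sub (lin_comp l2 (lin_comp l1 (tens_linear x))) (tens_linear x).
move: t; apply: (tensor_ind (S := subspace_ker lx)) => y z /=.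
by rewrite tensor_assocl_tens tensor_assocr_tens subrr.
Qed.
End Assoc.

Section PsumTensor.
Variables (A Q : gradedRep K) (I : choiceType) (d : I -> int).

Let f_lin (i : I) : linear (@tensor_map A Q (psum A d) Q (pinj d i) id).
Proof. exact: (@tensor_map_linear A Q (psum A d) Q _ id (pinj_linear d i) (@lin_id K Q)). Qed.

Let f_act i a r t : @tensor_map A Q (psum A d) Q (pinj d i) id (act a r t) =
  act a r (@tensor_map A Q (psum A d) Q (pinj d i) id t).
Proof.
apply: tensor_map_act => //; first exact: pinj_linear.
by move=> {}a {}r v; exact: pinj_act.
Qed.

Definition psum_tensor : psum (tensorRep A Q) d -> tensorRep (psum A d) Q :=
  plsum (fun i => @tensor_map A Q (psum A d) Q (pinj d i) id).

Lemma psum_tensor_hom : rep_hom psum_tensor.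
Proof.
apply: plsum_hom => // i r t.
apply: tensor_lift_grade.
- by apply: tensor_map_l; exact: pinj_linear.
- exact: tensor_map_r.
- move=> j k v w Av Qw; rewrite addrAC; apply: grade_tens => //; exact: pinj_grade.
Qed.

Fact tensor_psum_fin (u : psum A d) (q : Q) :
  finite_set [set i : I | (tens (pfun i u) q : tensorRep A Q) != 0].
Proof.
apply: sub_finite_set (dsum_fin u) => i /=; apply: contra_neq; rewrite -/(pfun i u) => ->.
exact: (lin0 (tens_linearl q)).
Qed.

Definition tensor_psum : tensorRep (psum A d) Q -> psum (tensorRep A Q) d :=
  tensor_lift (fun u q => mkpsum d (tensor_psum_fin u q)).

Lemma tensor_psum_linl q : linear (fun u : psum A d => mkpsum d (tensor_psum_fin u q)).
Proof. by move=> c u v; apply: psumP => i; exact: tens_linearl. Qed.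

Lemma tensor_psum_linr u : linear (fun q : Q => mkpsum d (tensor_psum_fin u q)).
Proof. by move=> c q q'; apply: psumP => i; exact: tens_linear. Qed.

Lemma tensor_psum_linear : linear tensor_psum.
Proof. exact: tensor_lift_linear tensor_psum_linl tensor_psum_linr. Qed.

Lemma tensor_psum_tens i v q : tensor_psum (tens (pinj d i v) q) = pinj d i (tens v q : tensorRep A Q).
Proof.
rewrite [LHS](tensor_liftE tensor_psum_linl tensor_psum_linr); apply: psumP => j.
rewrite pfun_pinj -[LHS]/(tens (pfun j (pinj d i v)) q) pfun_pinj.
by case: eqP => // _; exact: (lin0 (tens_linearl q)).
Qed.

Lemma psum_tensorK : cancel psum_tensor tensor_psum.
Proof.
have [l1 _ _] := psum_tensor_hom; have D := lin_sub (lin_comp tensor_psum_linear l1) (@lin_id K _).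
move=> t; apply: subr0_eq; move: t; apply: (psum_ind (S := subspace_ker D)) => i t.
have D' := lin_comp D (pinj_linear d i); move: t.
apply: (tensor_ind (S := subspace_ker D')) => v q.
change (tensor_psum (psum_tensor (pinj d i (tens v q : tensorRep A Q)))
    - pinj d i (tens v q : tensorRep A Q) = 0).
rewrite /psum_tensor (plsum_pinj d f_lin) (@tensor_mapE A Q (psum A d) Q _ id (pinj_linear d i) (@lin_id K Q)).
by rewrite tensor_psum_tens subrr.
Qed.

Lemma tensor_psumK : cancel tensor_psum psum_tensor.
Proof.
have [l1 _ _] := psum_tensor_hom; have D := lin_sub (lin_comp l1 tensor_psum_linear) (@lin_id K _).
move=> t; apply: subr0_eq; move: t; apply: (tensor_ind (S := subspace_ker D)) => u q.
have D' := lin_comp D (tens_linearl q); move: u.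
apply: (psum_ind (S := subspace_ker D')) => i v.
change (psum_tensor (tensor_psum (tens (pinj d i v) q)) - tens (pinj d i v) q = 0).
rewrite tensor_psum_tens /psum_tensor (plsum_pinj d f_lin).
by rewrite (@tensor_mapE A Q (psum A d) Q _ id (pinj_linear d i) (@lin_id K Q)) subrr.
Qed.

End PsumTensor.

Section ChainPsum.
Variables (X : gradedRep K) (I : choiceType) (d : I -> int).

Definition psum_sub_space (G : gradedSub X) : subspace (psum X d) :=
  @Subspace K (psum X d) (fun u => forall i, G (pfun i u))
    (fun i => subspace0 G) (fun c u v Gu Gv i => subspaceP c (Gu i) (Gv i)).

Fact psum_sub_act (G : gradedSub X) a r u : psum_sub_space G u -> psum_sub_space G (act a r u).
Proof. by move=> Gu i; rewrite pfun_act; apply: gsub_act; exact: Gu. Qed.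
Fact psum_sub_component (G : gradedSub X) r u :
  psum_sub_space G u -> psum_sub_space G (component r u).
Proof. by move=> Gu i; rewrite pfun_component; apply: gsub_component; exact: Gu. Qed.

Definition psum_sub (G : gradedSub X) : gradedSub (psum X d) :=
  GradedSub (@psum_sub_act G) (@psum_sub_component G).

Lemma layer_psum lambda (J : choiceType) (e : J -> int) (G G' : gradedSub X) :
  layer (wsum K lambda e) G G' ->
  layer (wsum K lambda (fun ij : I * J => d ij.1 + e ij.2)) (psum_sub G) (psum_sub G').
Proof.
case=> R RL; have R0 := layer0 RL.
pose T := wsum K lambda (fun ij : I * J => d ij.1 + e ij.2).
have sfin i (p : T) : finite_set [set j : J | pfun (i, j) p != 0].
  apply: (@sub_finite_set _ _ (snd @` [set ij | pfun ij p != 0])).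
    by move=> j /= pj; exists (i, j).
  by apply: finite_image; exact: dsum_fin p.
pose sl i (p : T) : wsum K lambda e := mkpsum e (sfin i p).
(* [sl i p] is the part of [p] that belongs to the [i]-th copy of the layer. *)
have slE i j p : pfun j (sl i p) = pfun (i, j) p by [].
exists (fun u p => forall i, R (pfun i u) (sl i p)); split.
- move=> c u v p q Ru Rv i; rewrite [pfun i _](pfun_linear i).
  rewrite (_ : sl i _ = c *: sl i p + sl i q); first exact: (layer_lin RL).
  by apply: psumP => j; rewrite slE.
- by move=> u p Ru i; exact: (layer_dom RL) (Ru i).
- move=> u Gu; have /choice[f fR] : forall i, exists p, R (pfun i u) p.
    by move=> i; exact: (layer_tot RL) (Gu i).
  have f0 i : pfun i u = 0 -> f i = 0.
    by move=> ui; have := fR i; rewrite ui; exact: (layer_fun RL).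
  have ffin : finite_set [set ij : I * J | pfun ij.2 (f ij.1) != 0].
    apply: (@sub_finite_set _ _ (\bigcup_(i in [set i | pfun i u != 0])
        ((pair i) @` [set j | pfun j (f i) != 0]))).
      move=> [i j] /= fij; exists i; last by exists j.
      by apply: contra_neq fij => /f0 ->.
    by apply: bigcup_finite (dsum_fin u) _ => i _; apply: finite_image; exact: dsum_fin (f i).
  exists (mkpsum _ ffin) => i.
  by rewrite (_ : sl i _ = f i) //; apply: psumP.
(* Lifting a zero part to 0 keeps the support of the lift finite. *)
- move=> p; have /choice[f fR] : forall i, exists v, R v (sl i p) /\ (sl i p = 0 -> v = 0).
    move=> i; have [->|p0] := eqVneq (sl i p) 0; first by exists 0.
    by have [v Rv] := layer_sur RL (sl i p); exists v; split=> // /eqP; rewrite (negPf p0).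
  have ffin : finite_set [set i : I | f i != 0].
    apply: (@sub_finite_set _ _ (fst @` [set ij | pfun ij p != 0])).
      move=> i /= fi; apply: contrapT => ni; move/negP: fi; apply; apply/eqP.
      apply: (fR i).2; apply: psumP => j; rewrite slE; apply/eqP/negPn/negP => pj.
      by apply: ni; exists (i, j).
    by apply: finite_image; exact: dsum_fin p.
  by exists (mkpsum _ ffin) => i; exact: (fR i).1.
- move=> a r u p Ru i; rewrite pfun_act (_ : sl i _ = act a r (sl i p)).
    exact: (layer_act RL).
  by apply: psumP.
- move=> r u p Ru i; rewrite pfun_component (_ : sl i _ = component (r - d i) (sl i p)).
    exact: (layer_cmp RL).
  by apply: psumP => j; rewrite slE !pfun_component slE /= opprD addrA.
- move=> p R0p; apply: psumP => -[i j]; rewrite -slE.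
  by rewrite (layer_fun RL (R0p i)).
- move=> u; have sl0 i : sl i 0 = 0 by apply: psumP.
  split=> [Gu i|Ru i]; first by rewrite sl0; apply/(layer_ker RL); exact: Gu.
  by apply/(layer_ker RL); rewrite -(sl0 i); exact: Ru.
Qed.

Lemma chain_psum : chain (full X) -> chain (full (psum X d)).
Proof.
suff cG (G : gradedSub X) : chain G -> chain (psum_sub G).
  by move=> /cG; apply: chain_ext => u; split=> // _ i.
elim=> {G} [G G0|G G' lambda J e L _ IH].
  apply: chain0 => u Gu; apply: psumP => i; exact: G0 (Gu i).
by apply: (chainS (layer_psum L)) IH.
Qed.
End ChainPsum.

Lemma chain_psum_tensor (A Q : gradedRep K) (I : choiceType) (d : I -> int) :
  chain (full (tensorRep A Q)) -> chain (full (tensorRep (psum A d) Q)).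
Proof.
move=> /(chain_psum d); apply: (chain_mono (psum_tensor_hom A Q d)).
  exact: can_inj (@psum_tensorK A Q I d).
by move=> t; exists (tensor_psum t); rewrite tensor_psumK.
Qed.

(** * Exactness of the tensor product *)

Section LayerTensor.
Variables (M N : gradedRep K).

(** These generate the image of F (x) N in M (x) N. Taking homogeneous tensors only makes the span
    visibly graded; [tens_sub] recovers all others. *)
Definition tensor_sub_gens (F : gradedSub M) : set (tensorRep M N) :=
  [set t | exists i j v w, [/\ F v, grade M i v, grade N j w & t = tens v w]].

Definition tensor_sub_space (F : gradedSub M) : subspace (tensorRep M N) :=
  span (tensor_sub_gens F).

Lemma tens_sub (F : gradedSub M) v w : F v -> tensor_sub_space F (tens v w).
Proof.
move=> Fv; set S := tensor_sub_space F.
apply: (grading_ind (@grade_direct K N) (S := preim_subspace (tens_linear v) S)) => j {}w Nw /=.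
rewrite (homog_part_sum (@grade_direct K M) v).
have lw := @tens_linearl K M N w; rewrite (lin_fsum lw); last exact: homog_part_fin.
have [s us sP] := finsupp_seq (homog_part_fin (@grade_direct K M) v).
rewrite (fsumE us) => [|i /sP /negP]; last first.
  by rewrite negbK => /eqP ->; exact: lin0 lw.
apply: (subspace_sum (S := S)) => i; apply: span_gen.
exists i, j, (component i v), w; split=> //.
  exact: gsub_component.
exact: grade_component.
Qed.

Lemma tensor_sub_min (F : gradedSub M) (S : subspace (tensorRep M N)) :
  (forall v w, F v -> S (tens v w)) -> forall t, tensor_sub_space F t -> S t.
Proof. by move=> FS t; apply: span_min => _ [i [j [v [w [Fv _ _ ->]]]]]; exact: FS. Qed.

Definition tensor_sub (F : gradedSub M) : gradedSub (tensorRep M N).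
Proof.
exists (tensor_sub_space F) => [a r t|r t].
  apply: (tensor_sub_min (S := preim_subspace (@act_linear K (tensorRep M N) a r)
    (tensor_sub_space F))) => v w Fv.
  change (tensor_sub_space F (act a r (tens v w : tensorRep M N))).
  by rewrite act_tens; apply: subspaceD; apply: tens_sub => //; exact: gsub_act.
apply: (span_min (S := preim_subspace (@component_linear K (tensorRep M N) r)
  (tensor_sub_space F))) => t' [i [j [v [w [Fv Mv Nw ->]]]]].
change (tensor_sub_space F (component r (tens v w : tensorRep M N))).
rewrite (component_id r (grade_tens Mv Nw)); case: eqP => _; last exact: subspace0.
exact: tens_sub.
Defined.

(** The epimorphism from [F] to [P] is extended by a retraction to a linear map [f] on [M], so that
    f (x) id is defined; equivariance is claimed on [F] only. Its kernel is found from an inverse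
    [k] modulo F' (x) N, built from a section [s] whose failure to be linear lies in [F']. *)
Lemma layer_tensor P (F F' : gradedSub M) : layer P F F' ->
  layer (tensorRep P N) (tensor_sub F) (tensor_sub F').
Proof.
case=> R RL; have [p [lp Fp pid]] := subspace_retraction F.
pose f v := projT1 (cid (layer_tot RL (Fp v))).
have fR v : R (p v) (f v) by rewrite /f; case: cid.
have fE v q : F v -> R v q -> f v = q.
  by move=> Fv; apply: (layer_uniq RL); rewrite -{1}(pid _ Fv).
have lf : linear f.
  move=> c u v; apply: (layer_uniq RL (fR _)); rewrite lp; exact: (layer_lin RL).
have fF v : F v -> R v (f v) by move=> Fv; rewrite -{1}(pid _ Fv).
pose s q := projT1 (cid (layer_sur RL q)).
have sR q : R (s q) q by rewrite /s; case: cid.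
pose g := tensor_map f (@id N).
have lg : linear g by exact: tensor_map_linear lf (@lin_id K N).
have gE v w : g (tens v w) = tens (f v) w by exact: tensor_mapE lf (@lin_id K N) v w.
pose F'N := tensor_sub_space F'.
pose k (t : tensorRep P N) : vquot F'N :=
  tensor_lift (fun q w => vpi (tens (s q) w) : vquot F'N) t.
have kl w : linear (fun q => vpi (tens (s q) w) : vquot F'N).
  move=> c q q'; rewrite -linearP; apply/vpi_eq; rewrite -tens_linearl.
  rewrite -(linB (tens_linearl w)); apply: tens_sub; apply/(layer_ker RL).
  rewrite -(subrr (c *: q + q')); apply: (layerB RL) => //; exact: (layer_lin RL).
have kr q : linear (fun w => vpi (tens (s q) w) : vquot F'N).
  by move=> c w w'; rewrite -linearP tens_linear.
have lk : linear k by exact: tensor_lift_linear.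
have kE q w : k (tens q w) = vpi (tens (s q) w) by exact: tensor_liftE.
have kg t : tensor_sub F t -> k (g t) = vpi t.
  have D := lin_sub (lin_comp lk lg) (@vpi_linear K _ F'N).
  move=> Ft; apply: subr0_eq; move: t Ft.
  apply: (tensor_sub_min (S := subspace_ker D)) => v w Fv.
  change (k (g (tens v w)) - vpi (tens v w) = 0).
  rewrite gE kE; apply/eqP; rewrite subr_eq0; apply/eqP/vpi_eq.
  rewrite -(linB (tens_linearl w)); apply: tens_sub; apply/(layer_ker RL).
  by rewrite -(subrr (f v)); apply: (layerB RL) => //; exact: fF.
apply: (@layer_of_hom _ _ _ _ _ g) => //.
- move=> a r t; have D := lin_sub (lin_comp lg (@act_linear K (tensorRep M N) a r))
    (lin_comp (@act_linear K (tensorRep P N) a r) lg).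
  move=> Ft; apply: subr0_eq; move: t Ft; apply: (tensor_sub_min (S := subspace_ker D)) => v w Fv.
  change (g (act a r (tens v w : tensorRep M N)) - act a r (g (tens v w)) = 0).
  rewrite gE !act_tens (linD lg) !gE (fE (act a r v) (act a r (f v))) ?subrr //.
    exact: gsub_act.
  by apply: (layer_act RL); exact: fF.
- move=> r t; have D := lin_sub (lin_comp lg (@component_linear K (tensorRep M N) r))
    (lin_comp (@component_linear K (tensorRep P N) r) lg).
  move=> Ft; apply: subr0_eq; move: Ft; apply: (span_min (S := subspace_ker D)).
  move=> _ [i [j [v [w [Fv Mv Nw ->]]]]].
  change (g (component r (tens v w : tensorRep M N)) - component r (g (tens v w)) = 0).
  have Pv : grade P i (f v).
    have := layer_cmp RL i (fF _ Fv); rewrite (grade_component_id Mv) => /(fE _ _ Fv) ->.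
    exact: grade_component.
  rewrite gE (component_id r (grade_tens Mv Nw)) (component_id r (grade_tens Pv Nw)).
  by case: eqP => _; rewrite ?gE ?(lin0 lg) ?subrr // subr0.
- have lim : subspace (tensorRep P N) := im_subspace lg (tensor_sub F).
  suff sur q : im_subspace lg (tensor_sub F) q by move=> q; have [v Fv ->] := sur q; exists v.
  move: q; apply: tensor_ind => q w; exists (tens (s q) w).
    by apply: tens_sub; exact: (layer_dom RL) (sR q).
  by rewrite gE (fE _ _ (layer_dom RL (sR q)) (sR q)).
- move=> t; split=> [F't|[Ft g0]].
    split.
      move: t F't; apply: (tensor_sub_min (S := tensor_sub F)) => v w F'v.
      by apply: tens_sub; exact: (layer_sub RL).
    move: t F't; apply: (tensor_sub_min (S := subspace_ker lg)) => v w F'v /=.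
    rewrite gE (fE _ 0); first exact: (lin0 (tens_linearl w)).
      exact: (layer_sub RL).
    exact/(layer_ker RL).
  have := kg _ Ft; rewrite g0 (lin0 lk) => /esym; rewrite -[RHS](linear0 (@vpi K _ _)).
  by move/vpi_eq; rewrite subr0.
Qed.

End LayerTensor.

Lemma chain_tensorl M N : chain (full M) ->
  (forall lambda (I : choiceType) (d : I -> int),
    chain (full (tensorRep (wsum K lambda d) N))) ->
  chain (full (tensorRep M N)).
Proof.
move=> cM cP; suff cF (F : gradedSub M) : chain F -> chain (tensor_sub N F).
  apply: chain_ext (cF _ cM) => t; split=> // _; move: t.
  by apply: tensor_ind => v w; exact: tens_sub.
elim=> {cM} [{}F F0|{}F F' lambda I d L _ IH].
  apply: chain0; apply: (tensor_sub_min (S := gsub0 _)) => v w /F0 ->.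
  exact: (lin0 (tens_linearl w)).
by apply: (chain_pull (P := tensorRep (wsum K lambda d) N)) IH; [exact: layer_tensor|exact: cP].
Qed.

Lemma chain_tensor M N :
  (forall lambda mu, chain (full (tensorRep (weyl K lambda) (weyl K mu)))) ->
  chain (full M) -> chain (full N) -> chain (full (tensorRep M N)).
Proof.
move=> cW cM cN; apply: chain_tensorl => // lambda I d; apply: chain_psum_tensor.
apply: chain_swap; apply: chain_tensorl => // mu J e; apply: chain_psum_tensor.
exact: chain_swap.
Qed.

End TensorHom.

(** * The symmetric algebra of C^2[t] *)

Section SymmetricAlgebra.
Variable K : fieldType.

(* The letter (p, i) stands for e_p t^i in C^2[t]; the matrix a of sl_2 maps e_q
   to \sum_p a p q e_p. *)
Definition letter := ('I_2 * nat)%type.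

(** The linear extension of [f] to C^2[t], evaluated at (a t^r) l. With [f] arbitrary, the same
    computations serve for C^2[t] itself and for its symmetric algebra. *)
Definition letter_act (U : lmodType K) (f : letter -> U) (a : sl2 K) (r : nat) (l : letter) : U :=
  \sum_(p < 2) sl2_mx a p l.1 *: f (p, (l.2 + r)%N).

Lemma letter_act_linearl (U : lmodType K) (f : letter -> U) r l :
  linear (fun a => letter_act f a r l).
Proof.
move=> c a b; rewrite /letter_act scaler_sumr -big_split; apply: eq_bigr => p _ /=.
by rewrite !mxE scalerDl scalerA.
Qed.

Lemma letter_act_bracket (U : lmodType K) (f : letter -> U) a b r s l :
  letter_act f (sl2_bracket a b) (r + s) l =
  letter_act (letter_act f a r) b s l - letter_act (letter_act f b s) a r l.
Proof.
have comp c d m n : letter_act (letter_act f c m) d n l =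
    \sum_(p < 2) (sl2_mx c *m sl2_mx d) p l.1 *: f (p, (l.2 + (m + n))%N).
  rewrite /letter_act; under eq_bigr do rewrite scaler_sumr.
  rewrite exchange_big; apply: eq_bigr => p _ /=; rewrite mxE scaler_suml.
  by apply: eq_bigr => q _; rewrite scalerA mulrC [(m + n)%N]addnC addnA.
rewrite !comp [(s + r)%N]addnC -sumrB; apply: eq_bigr => p _ /=.
by rewrite -scalerBl !mxE.
Qed.

Section Letters.

Definition letters := free K letter.
HB.instance Definition _ := GRing.Lmodule.on letters.

Definition lgen (l : letter) : letters := free_gen K l.

Definition letters_act a r : letters -> letters := free_lift (letter_act lgen a r).

Lemma letters_act_linear a r : linear (letters_act a r).
Proof. exact: free_lift_linear. Qed.

Lemma letters_act_gen a r l : letters_act a r (lgen l) = letter_act lgen a r l.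
Proof. exact: free_lift_gen. Qed.

Lemma letters_ext (U : lmodType K) (f g : letters -> U) : linear f -> linear g ->
  (forall l, f (lgen l) = g (lgen l)) -> f =1 g.
Proof.
move=> lf lg fg v; apply: subr0_eq; apply: (free_ind (S := subspace_ker (lin_sub lf lg))) => l /=.
by rewrite -/(lgen l) fg subrr.
Qed.

Fact letters_act_linearl r v : linear (fun a => letters_act a r v).
Proof.
move=> c a b; move: v; apply: (letters_ext (letters_act_linear _ _)
  (lin_add (lin_scale c (letters_act_linear a r)) (letters_act_linear b r))) => l /=.
by rewrite !letters_act_gen letter_act_linearl.
Qed.

Lemma letters_act_letter a r (f : letter -> letters) b s l :
  letters_act a r (letter_act f b s l) = letter_act (fun l => letters_act a r (f l)) b s l.
Proof.
rewrite /letter_act (lin_sum _ _ (letters_act_linear a r)); apply: eq_bigr => p _.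
by rewrite (linZ (letters_act_linear a r)).
Qed.

Lemma eq_letter_act (U : lmodType K) (f g : letter -> U) a r l :
  f =1 g -> letter_act f a r l = letter_act g a r l.
Proof. by move=> fg; apply: eq_bigr => p _; rewrite fg. Qed.

Fact letters_act_bracket a b r s v :
  letters_act (sl2_bracket a b) (r + s) v =
  letters_act a r (letters_act b s v) - letters_act b s (letters_act a r v).
Proof.
have l2 a' r' b' s' := lin_comp (letters_act_linear a' r') (letters_act_linear b' s').
move: v; apply: (letters_ext (letters_act_linear _ _) (lin_sub (l2 a r b s) (l2 b s a r))) => l /=.
rewrite !letters_act_gen !letters_act_letter letter_act_bracket.
by congr (_ - _); apply: eq_letter_act => k; rewrite letters_act_gen.
Qed.

Definition letters_grade (n : int) : subspace letters :=
  span [set v | exists2 l : letter, (l.2)%:Z = n & v = lgen l].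

Definition letters_component (n : int) : letters -> letters :=
  free_lift (fun l => if n == (l.2)%:Z then lgen l else 0).

Fact letters_direct : is_grading letters_grade.
Proof.
have lc n := free_lift_linear (fun l : letter => if n == (l.2)%:Z then lgen l else 0).
apply: (grading_of_span (p := letters_component)) => //.
- move=> n m v mv.
  have lm : linear (fun v : letters => if n == m then v else 0).
    by case: eqP => _; [exact: lin_id|exact: lin_cst0].
  apply: (span_eq_lin (lc n) lm _ mv) => _ [l <- ->].
  exact: free_lift_gen.
- apply: free_ind => l; apply: span_gen; exists l.2.
  by apply: span_gen; exists l.
Qed.

Fact letters_act_grade a r s v : letters_grade s v -> letters_grade (r%:Z + s) (letters_act a r v).
Proof.
apply: (span_min (S := preim_subspace (letters_act_linear a r) (letters_grade (r%:Z + s)))).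
move=> _ [l <- ->].
change (letters_grade (r%:Z + l.2%:Z) (letters_act a r (lgen l))).
rewrite letters_act_gen; apply: (subspace_sum (S := letters_grade _)) => p.
apply: subspaceZ; apply: span_gen; exists (p, (l.2 + r)%N) => //=.
by rewrite PoszD addrC.
Qed.

Definition vecRep : gradedRep K :=
  GradedRep letters_act_linearl letters_act_linear letters_act_bracket
    letters_direct letters_act_grade.

Definition vgen (l : letter) : vecRep := lgen l.

Lemma act_vgen a r l : act a r (vgen l) = letter_act vgen a r l.
Proof. exact: letters_act_gen. Qed.

Lemma vgen_grade l : grade vecRep (l.2)%:Z (vgen l).
Proof. by apply: span_gen; exists l. Qed.

Lemma vec_ind (S : subspace vecRep) : (forall l, S (vgen l)) -> forall v, S v.
Proof. exact: free_ind. Qed.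

Definition coord (l : letter) (v : vecRep) : K := dsum_fun v l.

Lemma coord_linear l c u v : coord l (c *: u + v) = c * coord l u + coord l v.
Proof. by []. Qed.

Lemma coord_gen l k : coord l (vgen k) = (l == k)%:R.
Proof. by []. Qed.

End Letters.

Section Fock.
Notation word := (seq letter).

Inductive fock_rel : set (free K word) :=
| fock_rel_swap (u v : word) (k l : letter) : fock_rel
    (free_gen K (u ++ k :: l :: v) - free_gen K (u ++ l :: k :: v)).

(* The symmetric algebra of C^2[t] *)
Definition fock_space := presented fock_rel.
HB.instance Definition _ := GRing.Lmodule.on fock_space.

Definition fword (u : word) : fock_space := pgen u.

Lemma fword_swap u v k l : fword (u ++ k :: l :: v) = fword (u ++ l :: k :: v).
Proof.
apply: subr0_eq; rewrite /fword /pgen -linearB; apply: pi_rel0; exact: fock_rel_swap.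
Qed.

Section FockLift.
Variables (U : lmodType K) (f : word -> U).
Hypothesis fs : forall u v k l, f (u ++ k :: l :: v) = f (u ++ l :: k :: v).

Fact fock_lift_rel F : fock_rel F -> free_lift f F = 0.
Proof.
have ll := free_lift_linear f; case=> u v k l.
by rewrite (linB ll) !free_lift_gen fs subrr.
Qed.

Definition fock_lift : fock_space -> U := plift f.

Lemma fock_lift_linear : linear fock_lift.
Proof. exact: plift_linear fock_lift_rel. Qed.

Lemma fock_lift_word u : fock_lift (fword u) = f u.
Proof. exact: plift_gen fock_lift_rel u. Qed.
End FockLift.

Fact create_swap l u v k k' :
  fword (l :: (u ++ k :: k' :: v)) = fword (l :: (u ++ k' :: k :: v)).
Proof. exact: (fword_swap (l :: u)). Qed.

Definition create (l : letter) : fock_space -> fock_space := fock_lift (fun u => fword (l :: u)).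

Lemma create_linear l : linear (create l).
Proof. exact: fock_lift_linear (create_swap l). Qed.

Lemma create_word l u : create l (fword u) = fword (l :: u).
Proof. exact: fock_lift_word (create_swap l) u. Qed.

Lemma fock_ind (S : subspace fock_space) : (forall u, S (fword u)) -> forall f, S f.
Proof. exact: presented_ind. Qed.

Lemma fock_ext (U : lmodType K) (f g : fock_space -> U) : linear f -> linear g ->
  (forall u, f (fword u) = g (fword u)) -> f =1 g.
Proof. exact: presented_ext. Qed.

Lemma createC k l f : create k (create l f) = create l (create k f).
Proof.
have c2 k' l' := lin_comp (create_linear k') (create_linear l').
move: f; apply: (fock_ext (c2 k l) (c2 l k)) => u /=.
by rewrite !create_word (fword_swap [::]).
Qed.

Section Derivation.
Variable g : letter -> fock_space -> fock_space.
Hypothesis gl : forall l, linear (g l).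
Hypothesis gc : forall l k f, g l (create k f) = create k (g l f).

(** The Leibniz rule, where [g l] is multiplication by the image of the letter [l]; [gc] makes the
    result independent of the order of letters. Both the action of sl_2[t] and the partial
    derivatives are instances. *)
Fixpoint derive_word (u : word) : fock_space :=
  if u is l :: u' then g l (fword u') + create l (derive_word u') else 0.

Fact derive_word_swap u v k l :
  derive_word (u ++ k :: l :: v) = derive_word (u ++ l :: k :: v).
Proof.
elim: u => [|x u IH] /=; last by rewrite IH fword_swap.
rewrite -!create_word !(linD (create_linear _)) !gc createC.
by rewrite !addrA [create l _ + _]addrC.
Qed.

Definition derivation : fock_space -> fock_space := fock_lift derive_word.

Lemma derivation_linear : linear derivation.
Proof. exact: fock_lift_linear derive_word_swap. Qed.

Lemma derivation_nil : derivation (fword [::]) = 0.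
Proof. exact: fock_lift_word derive_word_swap [::]. Qed.

Lemma derivation_create l f : derivation (create l f) = g l f + create l (derivation f).
Proof.
move: f; apply: (fock_ext (lin_comp derivation_linear (create_linear l))
  (lin_add (gl l) (lin_comp (create_linear l) derivation_linear))) => u /=.
by rewrite create_word /derivation !(fock_lift_word derive_word_swap).
Qed.
End Derivation.

Lemma fock_ext_create (U : lmodType K) (f g : fock_space -> U) : linear f -> linear g ->
  f (fword [::]) = g (fword [::]) ->
  (forall l x, f x = g x -> f (create l x) = g (create l x)) -> f =1 g.
Proof.
move=> lf lg f0 fc; apply: fock_ext => //; elim=> // l u IH.
by rewrite -create_word; exact: fc.
Qed.

Fact letter_create_linear a r l : linear (fun f => letter_act (create^~ f) a r l).
Proof.
move=> c u v; rewrite /letter_act scaler_sumr -big_split; apply: eq_bigr => p _ /=.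
by rewrite create_linear scalerDr !scalerA mulrC.
Qed.

Fact letter_create_comm a r l k f : letter_act (create^~ (create k f)) a r l =
  create k (letter_act (create^~ f) a r l).
Proof.
rewrite /letter_act (lin_sum _ _ (create_linear k)); apply: eq_bigr => p _ /=.
by rewrite (linZ (create_linear k)) createC.
Qed.

Definition fock_act a r : fock_space -> fock_space :=
  derivation (fun l f => letter_act (create^~ f) a r l).

Lemma fock_act_linear a r : linear (fock_act a r).
Proof. exact: derivation_linear (letter_create_comm a r). Qed.

Lemma fock_act_nil a r : fock_act a r (fword [::]) = 0.
Proof. exact: derivation_nil (letter_create_comm a r). Qed.

Lemma fock_act_create a r l f :
  fock_act a r (create l f) = letter_act (create^~ f) a r l + create l (fock_act a r f).
Proof. exact: derivation_create (letter_create_linear a r) (letter_create_comm a r) l f. Qed.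

Fact fock_act_linearl r v : linear (fun a => fock_act a r v).
Proof.
move=> c a b; move: v; apply: (fock_ext_create (fock_act_linear _ _)
  (lin_add (lin_scale c (fock_act_linear a r)) (fock_act_linear b r))) => [|l x] /=.
  by rewrite !fock_act_nil scaler0 addr0.
move=> IH; rewrite !fock_act_create IH letter_act_linearl (create_linear l).
by rewrite scalerDr addrACA.
Qed.

Lemma fock_act_letter a r (f : letter -> fock_space) b s l :
  fock_act a r (letter_act f b s l) = letter_act (fun l => fock_act a r (f l)) b s l.
Proof.
rewrite /letter_act (lin_sum _ _ (fock_act_linear a r)); apply: eq_bigr => p _.
by rewrite (linZ (fock_act_linear a r)).
Qed.

Lemma letter_actD (U : lmodType K) (f g : letter -> U) a r l :
  letter_act (fun l => f l + g l) a r l = letter_act f a r l + letter_act g a r l.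
Proof. by rewrite -big_split; apply: eq_bigr => p _; rewrite scalerDr. Qed.

Fact fock_act_bracket a b r s v :
  fock_act (sl2_bracket a b) (r + s) v =
  fock_act a r (fock_act b s v) - fock_act b s (fock_act a r v).
Proof.
have l2 a' r' b' s' := lin_comp (fock_act_linear a' r') (fock_act_linear b' s').
move: v; apply: (fock_ext_create (fock_act_linear _ _)
  (lin_sub (l2 a r b s) (l2 b s a r))) => [|l x] /=.
  by rewrite !fock_act_nil !(lin0 (fock_act_linear _ _)) subrr.
move=> IH; rewrite !fock_act_create IH letter_act_bracket !(linD (fock_act_linear _ _)).
have E c m d n : fock_act c m (letter_act (create^~ x) d n l) =
    letter_act (letter_act (create^~ x) c m) d n l +
    letter_act (create^~ (fock_act c m x)) d n l.
  rewrite fock_act_letter -letter_actD; apply: eq_letter_act => k.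
  exact: fock_act_create.
rewrite (E a r b s) (E b s a r) (fock_act_create a r l (fock_act b s x)).
rewrite (fock_act_create b s l (fock_act a r x)) (linB (create_linear l)).
exact: cross_cancel.
Qed.

End Fock.
End SymmetricAlgebra.

Arguments create {K} l f.
Arguments coord {K} l v : simpl never.

Section FockRep.
Variable K : fieldType.
Notation word := (seq letter).
Notation fock_space := (fock_space K).
Notation fword := (fword K).

Definition wdeg (u : word) : nat := \sum_(l <- u) l.2.

Lemma wdeg_cons l u : wdeg (l :: u) = (l.2 + wdeg u)%N.
Proof. exact: big_cons. Qed.

Lemma wdeg_swap u v k l : wdeg (u ++ k :: l :: v) = wdeg (u ++ l :: k :: v).
Proof. by rewrite /wdeg !big_cat !big_cons /= (addnCA k.2). Qed.

Definition fock_grade (n : int) : subspace fock_space :=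
  span [set q | exists2 u, (wdeg u)%:Z = n & q = fword u].

Lemma fock_grade_create n l f : fock_grade n f -> fock_grade (n + (l.2)%:Z) (create l f).
Proof.
apply: (span_min (S := preim_subspace (create_linear l) (fock_grade (n + (l.2)%:Z)))).
move=> _ [u <- ->]; apply: span_gen; exists (l :: u); last exact: create_word.
by rewrite wdeg_cons PoszD addrC.
Qed.

Let comp_fun (n : int) (u : word) : fock_space := if n == (wdeg u)%:Z then fword u else 0.

Let comp_swap n u v k l : comp_fun n (u ++ k :: l :: v) = comp_fun n (u ++ l :: k :: v).
Proof. by rewrite /comp_fun wdeg_swap fword_swap. Qed.

Fact fock_direct : is_grading fock_grade.
Proof.
have lc n := fock_lift_linear (comp_swap n).
apply: (grading_of_span (p := fun n => fock_lift (comp_fun n)) lc).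
- move=> n m v mv.
  have lm : linear (fun v : fock_space => if n == m then v else 0).
    by case: eqP => _; [exact: lin_id|exact: lin_cst0].
  apply: (span_eq_lin (lc n) lm _ mv) => _ [u <- ->].
  exact: (fock_lift_word (comp_swap n)).
- apply: fock_ind => u; apply: span_gen; exists (wdeg u).
  by apply: span_gen; exists u.
Qed.

Fact fock_act_grade a r s v : fock_grade s v -> fock_grade (r%:Z + s) (fock_act a r v).
Proof.
apply: (span_min (S := preim_subspace (@fock_act_linear K a r) (fock_grade (r%:Z + s)))).
move=> _ [u <- ->]; change (fock_grade (r%:Z + (wdeg u)%:Z) (fock_act a r (fword u))).
elim: u => [|l u IH]; first by rewrite fock_act_nil; exact: subspace0.
rewrite -create_word fock_act_create; apply: subspaceD; last first.
  by rewrite wdeg_cons PoszD [l.2%:Z + _]addrC addrA; exact: fock_grade_create.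
apply: (subspace_sum (S := fock_grade _)) => p; apply: subspaceZ.
rewrite create_word; apply: span_gen; exists ((p, (l.2 + r)%N) :: u) => //.
by rewrite !wdeg_cons /= !PoszD addrA [r%:Z + _]addrC.
Qed.

Definition fockRep : gradedRep K :=
  GradedRep (@fock_act_linearl K) (@fock_act_linear K) (@fock_act_bracket K)
    fock_direct fock_act_grade.

Definition fw (u : word) : fockRep := fword u.

Lemma act_create a r l (f : fockRep) : act a r (create l f : fockRep) =
  letter_act (create^~ f) a r l + create l (act a r f).
Proof. exact: fock_act_create. Qed.

Lemma act_fock_nil a r : act a r (fw [::]) = 0.
Proof. exact: fock_act_nil. Qed.

Lemma fw_grade u : grade fockRep (wdeg u) (fw u).
Proof. by apply: span_gen; exists u. Qed.

Definition fdeg (n : nat) : subspace fock_space := span [set q | exists2 u, size u = n & q = fword u].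

Lemma fdeg_word u : fdeg (size u) (fword u).
Proof. by apply: span_gen; exists u. Qed.

Lemma fdeg_create n l f : fdeg n f -> fdeg n.+1 (create l f).
Proof.
apply: (span_min (S := preim_subspace (create_linear l) (fdeg n.+1))) => _ [u <- ->].
change (fdeg (size u).+1 (create l (fword u))); rewrite create_word.
exact: (@fdeg_word (l :: u)).
Qed.

Lemma fdeg_act n a r f : fdeg n f -> fdeg n (fock_act a r f).
Proof.
apply: (span_min (S := preim_subspace (@fock_act_linear K a r) (fdeg n))) => _ [u <- ->].
change (fdeg (size u) (fock_act a r (fword u))).
elim: u => [|l u IH]; first by rewrite fock_act_nil; exact: subspace0.
rewrite -create_word fock_act_create; apply: subspaceD; last exact: fdeg_create.
apply: (subspace_sum (S := fdeg _)) => p; apply: subspaceZ.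
by rewrite create_word; exact: (@fdeg_word ((p, (l.2 + r)%N) :: u)).
Qed.

Let size_fun (n : nat) (u : word) : fock_space := if size u == n then fword u else 0.

Let size_swap n u v k l : size_fun n (u ++ k :: l :: v) = size_fun n (u ++ l :: k :: v).
Proof. by rewrite /size_fun !size_cat /= fword_swap. Qed.

Definition fsize (n : nat) : fockRep -> fockRep := fock_lift (size_fun n).

Lemma fsize_linear n : linear (fsize n).
Proof. exact: fock_lift_linear (size_swap n). Qed.

Lemma fsize_word n u : fsize n (fw u) = if size u == n then fw u else 0.
Proof. exact: (fock_lift_word (size_swap n)). Qed.

Lemma fsize_fdeg n m f : fdeg m f -> fsize n f = if m == n then f else 0.
Proof.
have lm : linear (fun v : fock_space => if m == n then v else 0).
  by case: eqP => _; [exact: lin_id|exact: lin_cst0].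
move=> mf; apply: (span_eq_lin (fsize_linear n) lm _ mf) => _ [u <- ->].
exact: fsize_word.
Qed.

Lemma fdeg_fsize n f : fdeg n (fsize n f).
Proof.
move: f; apply: (fock_ind (S := preim_subspace (fsize_linear n) (fdeg n))) => u.
change (fdeg n (fsize n (fw u))); rewrite fsize_word.
by case: eqP => [<-|_]; [exact: fdeg_word|exact: subspace0].
Qed.

Lemma fsize_hom n : rep_hom (fsize n).
Proof.
split=> [|a r f|r f].
- exact: fsize_linear.
- move: f; apply: (fock_ext (lin_comp (fsize_linear n) (@fock_act_linear K a r))
    (lin_comp (@fock_act_linear K a r) (fsize_linear n))) => u.
  change (fsize n (fock_act a r (fword u)) = fock_act a r (fsize n (fw u))).
  have := fdeg_act a r (@fdeg_word u) => /(fsize_fdeg n) ->.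
  by rewrite fsize_word; case: eqP => // _; rewrite (lin0 (@fock_act_linear K a r)).
- apply: (span_min (S := preim_subspace (fsize_linear n) (fock_grade r))) => _ [u <- ->].
  change (fock_grade (wdeg u) (fsize n (fw u))); rewrite fsize_word.
  by case: eqP => _; [exact: fw_grade|exact: subspace0].
Qed.

(** * Partial derivatives on the symmetric algebra *)

Section Annihilation.

Fact delta_linear (k l : letter) : linear (fun f : fock_space => (l == k)%:R *: f).
Proof. by move=> c u v; rewrite scalerDr !scalerA mulrC. Qed.
Fact delta_comm (k l m : letter) (f : fock_space) :
  (l == k)%:R *: create m f = create m ((l == k)%:R *: f).
Proof. by rewrite (linZ (create_linear m)). Qed.

(** The partial derivative with respect to the variable [k]. *)
Definition ann (k : letter) : fock_space -> fock_space :=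
  derivation (fun l f => (l == k)%:R *: f).

Lemma ann_linear k : linear (ann k).
Proof. exact: derivation_linear (delta_comm k). Qed.

Lemma ann_nil k : ann k (fword [::]) = 0.
Proof. exact: derivation_nil (delta_comm k). Qed.

Lemma ann_create k l f : ann k (create l f) = (l == k)%:R *: f + create l (ann k f).
Proof. exact: derivation_create (delta_linear k) (delta_comm k) l f. Qed.

Lemma annC k l f : ann k (ann l f) = ann l (ann k f).
Proof.
have l2 k' l' := lin_comp (ann_linear k') (ann_linear l').
move: f; apply: (fock_ext_create (l2 k l) (l2 l k)) => [|x f] /=.
  by rewrite !ann_nil !(lin0 (ann_linear _)).
move=> IH; rewrite (ann_create l) (ann_create k) !(linD (ann_linear _)).
rewrite !(linZ (ann_linear _)) (ann_create k x) (ann_create l x) IH.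
by rewrite addrCA.
Qed.

Lemma fdeg_ann n k f : fdeg n.+1 f -> fdeg n (ann k f).
Proof.
apply: (span_min (S := preim_subspace (ann_linear k) (fdeg n))) => _ [u su ->].
change (fdeg n (ann k (fword u))).
elim: u n su => [//|l u IH] n [su]; rewrite -create_word ann_create.
apply: subspaceD; first by apply: subspaceZ; rewrite -su; exact: fdeg_word.
case: n su => [|n] su; last by apply: fdeg_create; exact: IH.
case: u su {IH} => // _.
by rewrite ann_nil (lin0 (create_linear l)); exact: subspace0.
Qed.

(* The index shift of ann_act: the letter k - r, if it exists. *)
Definition ann_sub (k : letter) (r : nat) (f : fock_space) : fock_space :=
  if (r <= k.2)%N then ann (k.1, (k.2 - r)%N) f else 0.

Lemma ann_sub_linear k r : linear (ann_sub k r).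
Proof. by rewrite /ann_sub; case: (r <= k.2)%N; [exact: ann_linear|exact: lin_cst0]. Qed.

Lemma ann_sub_create k r l f : ann_sub k r (create l f) =
  ((l.1, (l.2 + r)%N) == k)%:R *: f + create l (ann_sub k r f).
Proof.
rewrite /ann_sub; case: ifP => [rk|nrk].
  rewrite ann_create; congr ((nat_of_bool _)%:R *: _ + _); apply/eqP/eqP => [-> /=|<- /=].
    by rewrite subnK //; case: k {rk}.
  by rewrite addnK; case: l.
rewrite (lin0 (create_linear l)) addr0; case: eqP => [E|_]; last by rewrite scale0r.
by move: nrk; rewrite -E /= leq_addl.
Qed.

Lemma letter_sum_delta (a : sl2 K) r (k x : letter) (f : fock_space) :
  \sum_(p < 2) sl2_mx a p x.1 *: (((p, (x.2 + r)%N) == k)%:R *: f) =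
  \sum_(q < 2) sl2_mx a k.1 q *: (((x.1, (x.2 + r)%N) == (q, k.2))%:R *: f).
Proof.
case: k x => [p n] [q m] /=.
rewrite (bigD1 p) //= [LHS]addrC big1 ?add0r => [|i /negPf ip]; last first.
  by rewrite xpair_eqE ip scale0r scaler0.
rewrite (bigD1 q) //= [RHS]addrC big1 ?add0r => [|i /negPf iq]; last first.
  by rewrite xpair_eqE eq_sym iq scale0r scaler0.
by rewrite !xpair_eqE !eqxx.
Qed.

(** The action is the derivation given by a linear substitution of variables; its commutator with a
    partial derivative is the transposed substitution, which lowers the index of [k] by [r]. *)
Lemma ann_act k a r f : ann k (fock_act a r f) =
  fock_act a r (ann k f) + \sum_(q < 2) sl2_mx a k.1 q *: ann_sub (q, k.2) r f.
Proof.
have ls : linear (fun f => \sum_(q < 2) sl2_mx a k.1 q *: ann_sub (q, k.2) r f).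
  move=> c u v; rewrite scaler_sumr -big_split; apply: eq_bigr => q _ /=.
  by rewrite ann_sub_linear scalerDr !scalerA mulrC.
have la := @fock_act_linear K a r; have lk := ann_linear k.
move: f; apply: (fock_ext_create (lin_comp lk la) (lin_add (lin_comp la lk) ls)) => [|x f] /=.
  rewrite fock_act_nil !ann_nil (lin0 lk) (lin0 la) add0r big1 // => q _.
  by rewrite /ann_sub ann_nil if_same scaler0.
move=> IH; rewrite fock_act_create (linD lk) (ann_create k x (fock_act a r f)) IH.
rewrite (ann_create k x f) (linD la) (linZ la) (fock_act_create a r x (ann k f)).
rewrite (linD (create_linear x)) -!addrA.
under [in RHS]eq_bigr do rewrite ann_sub_create scalerDr.
rewrite big_split /=.
have -> : \sum_(i < 2) sl2_mx a k.1 i *: create x (ann_sub (i, k.2) r f) =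
    create x (\sum_(q < 2) sl2_mx a k.1 q *: ann_sub (q, k.2) r f).
  rewrite (lin_sum _ (fun q => sl2_mx a k.1 q *: ann_sub (q, k.2) r f) (create_linear x)).
  by apply: eq_bigr => q _; rewrite (linZ (create_linear x)).
have -> : ann k (letter_act (create^~ f) a r x) =
    letter_act (create^~ (ann k f)) a r x +
    \sum_(i < 2) sl2_mx a k.1 i *: (((x.1, (x.2 + r)%N) == (i, k.2))%:R *: f).
  rewrite /letter_act (lin_sum _ _ lk).
  under eq_bigr do rewrite (linZ lk) ann_create scalerDr.
  by rewrite big_split addrC letter_sum_delta.
set A := letter_act _ a r x; set B := \sum_(i < 2) _; set C := create x _; set D := \sum_(i < 2) _.
by rewrite !addrA [RHS](ACl (2*4*1*3*5))%AC.
Qed.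

Lemma ann_word_support u k : k \notin u -> ann k (fword u) = 0.
Proof.
elim: u => [|l u IH]; first by rewrite ann_nil.
rewrite inE negb_or => /andP[/negPf kl /IH E].
by rewrite -create_word ann_create E (lin0 (create_linear l)) eq_sym kl scale0r addr0.
Qed.

Lemma ann_finite f : finite_set [set k | ann k f != 0].
Proof.
have [S SE] : exists S : subspace fock_space, forall f, S f <-> finite_set [set k | ann k f != 0].
  apply: subspace_of => [|c u v fu fv].
    rewrite (_ : mkset _ = set0) //; apply/seteqP; split=> r //=.
    by rewrite (lin0 (ann_linear r)) eqxx.
  have [s [_ u0 v0]] := finsupp2 fu fv; apply: (finsupp_of_seq (s := s)) => k ks.
  by rewrite ann_linear u0 // v0 // scaler0 addr0.
apply/SE; move: f; apply: fock_ind => u; apply/SE.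
by apply: (finsupp_of_seq (s := u)) => k; exact: ann_word_support.
Qed.

(** Euler's identity for homogeneous polynomials, by induction on the length of a monomial. *)
Lemma euler n f : fdeg n f -> n%:R *: f = \sum_(k \in [set: letter]) create k (ann k f).
Proof.
move=> nf; pose e f := \sum_(k \in [set: letter]) create k (ann k f).
have fe f' : finite_set [set k | create k (ann k f') != 0].
  apply: sub_finite_set (ann_finite f') => k /=; apply: contra_neq => ->.
  exact: (lin0 (create_linear k)).
have le : linear e.
  by apply: fsum_linear => [k|//]; exact: lin_comp (create_linear k) (ann_linear k).
apply: (span_eq_lin (lin_scale n%:R (@lin_id K fock_space)) le _ nf) => _ [u <- ->] /=.
elim: u {n nf f} => [|l u IH].
  rewrite scale0r /e (fsumE (s := [::])) ?big_nil // => k _.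
  by rewrite ann_nil (lin0 (create_linear k)).
have [s [us u0 _]] := finsupp2 (fe (fword u)) (fe (fword u)).
(* [l] is put in front, even if [s] does not contain it, so that the term where the derivative hits
   [l] occurs exactly once. *)
pose s' := l :: rem l s.
have us' : uniq s' by rewrite /= mem_rem_uniqF // rem_uniq.
have s'0 k : k \notin s' -> k \notin s.
  by apply: contraNN => ks; rewrite inE mem_rem_uniq // inE; case: eqP.
have s'l k : k \notin s' -> (l == k) = false.
  by rewrite inE negb_or eq_sym => /andP[/negPf].
rewrite -create_word /e (fsumE us') => [|k ks]; last first.
  rewrite ann_create (s'l _ ks) scale0r add0r createC (u0 _ (s'0 _ ks)).
  exact: (lin0 (create_linear l)).
under eq_bigr do rewrite ann_create (linD (create_linear _)) (linZ (create_linear _)).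
rewrite big_split /= big_cons eqxx scale1r big_seq big1 ?addr0 => [|k ks]; last first.
  by case: eqP => [E|_]; rewrite ?scale0r //; move: ks; rewrite -E mem_rem_uniqF.
under eq_bigr do rewrite createC.
rewrite -(lin_sum _ _ (create_linear l)) -(fsumE us') => [|k /s'0 /u0 //].
by rewrite -/(e (fword u)) -IH (linZ (create_linear l)) -natr1 scalerDl scale1r addrC.
Qed.

End Annihilation.
End FockRep.

(** * Independence of 1, z, ..., z^n over symmetric polynomials *)

Section Vandermonde.
Variable K : numFieldType.

(** In characteristic 0 Euler's identity recovers a polynomial of positive degree from its
    derivatives. *)
Lemma ann_inj n (f : fock_space K) : fdeg K n.+1 f -> (forall k, ann k f = 0) -> f = 0.
Proof.
move=> nf f0; have := euler nf; rewrite (fsumE (s := [::])) ?big_nil => [|//|k _].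
  by move/eqP; rewrite scaler_eq0 pnatr_eq0 => /eqP.
by rewrite f0 (lin0 (create_linear k)).
Qed.

(* In C[t_1, ..., t_d] this says that a polynomial \sum_i z^i R_i of degree < d in z with
   R_i symmetric in the t_j vanishes if z = t_1 is a root; Q is the divided difference
   (R(z) - R(t_1)) / (z - t_1). *)
Lemma vandermonde d (R : nat -> fock_space K) : (forall i, fdeg K d (R i)) ->
  (forall i, (d <= i)%N -> R i = 0) ->
  (forall q m, \sum_(i < m.+1) ann (q, (m - i)%N) (R i) = 0) -> forall i, R i = 0.
Proof.
elim: d R => [|d IH] R Rd R0 Rm; first by move=> i; exact: R0.
have la k := @ann_linear K k.
pose Q x j c := \sum_(k < j.+1) ann (x, (j - k)%N) (R (c + k).+1).
have Rm' q m : \sum_(c < m.+1) ann (q, (m - c)%N) (R c.+1) = - ann (q, m.+1) (R 0).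
  apply/eqP; rewrite -addr_eq0 addrC; have := Rm q m.+1.
  by rewrite big_ord_recl subn0 => E; apply/eqP; rewrite -[RHS]E; congr (_ + _); apply: eq_bigr.
(* The coefficients of e_x t_1^j in the divided difference satisfy the hypotheses with one variable
   fewer: t_2 is a root of [Q], since by symmetry it is one of [R]. *)
have Q0 x j c : Q x j c = 0.
  move: c; apply: IH => [c|c dc|y m].
  - by apply: (subspace_sum (S := fdeg K d)) => k; exact: fdeg_ann.
  - rewrite /Q big1 // => k _; rewrite R0 ?(lin0 (la _)) //.
    by rewrite ltnS (leq_trans dc) // leq_addr.
  (* The factor t_1 - t_2 is cancelled by induction on the exponent [j] of t_1: the sum for [j.+1]
     at [m] equals the sum for [j] at [m.+1]. *)
  elim: j m => [|j IHj] m.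
    under eq_bigr => c _ do rewrite /Q big_ord1 subn0 addn0 annC.
    rewrite -(lin_sum _ _ (la _)) Rm' -scaleN1r (linZ (la _)) annC.
    have := Rm x 0; rewrite big_ord1 subn0 => ->.
    by rewrite (lin0 (la _)) scaler0.
  rewrite -[RHS](IHj m.+1) [RHS]big_ord_recl /= subn0 /Q.
  under eq_bigr => c _ do rewrite big_ord_recl subn0 addn0 (linD (la _)) annC.
  rewrite big_split /= -(lin_sum _ _ (la _)) Rm'; congr (_ + _).
    rewrite Rm' -!scaleN1r !(linZ (la _)) annC.
    by [].
  apply: eq_bigr => c _; rewrite /bump /= !add1n subSS; congr (ann _ _).
  by apply: eq_bigr => k _; rewrite /bump /= add1n subSS addnS addSn.
(* Descending induction: once the later coefficients vanish, [Q x j i] reduces to a derivative of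
   [R i.+1]. *)
have RS n i : (d < i + n)%N -> R i.+1 = 0.
  elim: n i => [|n IHn] i din; first by apply: R0; rewrite addn0 in din; exact: ltnW.
  apply: (ann_inj (Rd _)) => -[x j]; have := Q0 x j i.
  rewrite /Q big_ord_recl subn0 addn0 big1 ?addr0 // => k _.
  rewrite lift0 addnS IHn ?(lin0 (la _)) //.
  by rewrite (leq_trans din) // addnS addSn ltnS leq_add2r leq_addr.
case=> [|i]; last by apply: (RS d.+1); rewrite addnS ltnS leq_addl.
apply: (ann_inj (Rd _)) => -[q m]; have := Rm q m.
rewrite big_ord_recl subn0 big1 ?addr0 // => k _.
by rewrite lift0 (RS d.+1) ?(lin0 (la _)) // addnS ltnS leq_addl.
Qed.

End Vandermonde.

Lemma foldr_perm (T : eqType) (U : Type) (f : T -> U -> U) (z : U) (s t : seq T) :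
  (forall x y u, f x (f y u) = f y (f x u)) -> perm_eq s t -> foldr f z s = foldr f z t.
Proof.
move=> fC; elim: s t => [|x s IH] t.
  by rewrite perm_sym => /perm_nilP ->.
move=> /[dup] /perm_mem /(_ x); rewrite mem_head => /esym /splitPr[t1 t2].
rewrite perm_sym -cat1s perm_catCA perm_cons perm_sym => /IH /= ->.
by elim: t1 => //= y t1 <-; exact: fC.
Qed.

(** * Global Weyl modules as symmetric powers *)

Section Sl2Identities.
Variables (K : fieldType) (M : gradedRep K).
Implicit Type v : M.

Lemma sl2_bracket_self (a : sl2 K) : sl2_bracket a a = 0.
Proof. by apply: val_inj; exact: subrr. Qed.

Lemma act0l r v : act (0 : sl2 K) r v = 0.
Proof. exact: (lin0 (@act_linearl K M r v)). Qed.

Lemma act_selfC (a : sl2 K) r s v : act a r (act a s v) = act a s (act a r v).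
Proof.
apply/eqP; rewrite -subr_eq0 -act_bracket sl2_bracket_self act0l; exact: eqxx.
Qed.

Lemma act_hy r s v : act sl2_h r (act sl2_y s v) =
  act sl2_y s (act sl2_h r v) - 2%:R *: act sl2_y (r + s) v.
Proof.
have := act_bracket sl2_h sl2_y r s v; rewrite sl2_hy (linZ (@act_linearl K M _ v)).
by rewrite scaleNr => ->; rewrite addrC subrK.
Qed.

Lemma act_xy r s v : act sl2_x r (act sl2_y s v) =
  act sl2_y s (act sl2_x r v) + act sl2_h (r + s) v.
Proof. by rewrite -sl2_xy act_bracket addrC subrK. Qed.

Lemma act_xh r s v : act sl2_x r (act sl2_h s v) =
  act sl2_h s (act sl2_x r v) - 2%:R *: act sl2_x (r + s) v.
Proof.
have := act_bracket sl2_h sl2_x s r v; rewrite sl2_hx (linZ (@act_linearl K M _ v)).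
by rewrite addnC => ->; rewrite opprB addrC subrK.
Qed.

Lemma sl2_span (a : sl2 K) : a = sl2_mx a 0 0 *: sl2_h + sl2_mx a 0 1 *: sl2_x + sl2_mx a 1 0 *: sl2_y.
Proof.
have := sl2_tr a; rewrite unfold_in /mxtrace big_ord_recl big_ord1 => /eqP.
have -> : lift ord0 ord0 = 1 :> 'I_2 by apply: val_inj.
move=> /(canRL (addKr _)) a11; rewrite addr0 in a11.
apply: val_inj; apply/matrixP => i j; rewrite /= !mxE.
case: (unliftP ord0 i) => [i'|] ->; case: (unliftP ord0 j) => [j'|] -> /=.
- rewrite !ord1 (_ : lift ord0 ord0 = 1); last by apply: val_inj.
  by rewrite a11 /= !mulr0 sub0r mulrN1 !addr0.
- rewrite !ord1 (_ : lift ord0 ord0 = 1); last by apply: val_inj.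
  by rewrite /= subrr !mulr0 mulr1 !add0r.
- rewrite !ord1 (_ : lift ord0 ord0 = 1); last by apply: val_inj.
  by rewrite /= subrr !mulr0 mulr1 !addr0 add0r.
- by rewrite /= subr0 mulr1 !mulr0 !addr0.
Qed.

Lemma act_sl2_ind (S : subspace M) r v : S (act sl2_h r v) -> S (act sl2_x r v) ->
  S (act sl2_y r v) -> forall a, S (act a r v).
Proof.
move=> Sh Sx Sy a; have la := @act_linearl K M r v.
by rewrite (sl2_span a) !(linD la) !(linZ la); do ![apply: subspaceD|apply: subspaceZ].
Qed.

Definition ys (b : seq nat) v := foldr (act sl2_y) v b.
Definition hs (c : seq nat) v := foldr (act sl2_h) v c.
Definition y0s (m : nat) v := iter m (act sl2_y 0) v.

Lemma ys_perm b b' v : perm_eq b b' -> ys b v = ys b' v.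
Proof. by apply: foldr_perm => r s u; exact: act_selfC. Qed.

Lemma hs_perm b b' v : perm_eq b b' -> hs b v = hs b' v.
Proof. by apply: foldr_perm => r s u; exact: act_selfC. Qed.

Lemma ys_cat b b' v : ys (b ++ b') v = ys b (ys b' v).
Proof. exact: foldr_cat. Qed.

Lemma y0s_ys m v : y0s m v = ys (nseq m 0) v.
Proof. by elim: m => //= m <-. Qed.

Lemma ys_linear b : linear (ys b).
Proof.
elim: b => [//|r b IH] c u v; rewrite /ys /= -!/(ys b _) IH; exact: linearP.
Qed.

Lemma hs_x0 c v : (forall r, act sl2_x r v = 0) -> forall r, act sl2_x r (hs c v) = 0.
Proof.
move=> x0; elim: c => [//|s c IH] r; rewrite /= -/(hs c v) act_xh !IH.
by rewrite linear0 scaler0 subrr.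
Qed.

Let al (a : sl2 K) r := @act_linear K M a r.

Lemma h_y0s d m v : act sl2_h d (y0s m v) =
  y0s m (act sl2_h d v) - (m.*2)%:R *: act sl2_y d (y0s m.-1 v).
Proof.
elim: m => [|m IH]; first by rewrite /= scale0r subr0.
rewrite /= -!/(y0s _ _) act_hy IH addn0 (linB (al _ _)) (linZ (al _ _)) -addrA -opprD.
congr (_ - _); case: m {IH} => [|m]; first by rewrite scale0r add0r.
by rewrite act_selfC -[act sl2_y 0 (y0s _ _)]/(y0s m.+1 v) -scalerDl -natrD addn2.
Qed.

Lemma x_y0s d m v : (forall r, act sl2_x r v = 0) -> act sl2_x d (y0s m v) =
  m%:R *: y0s m.-1 (act sl2_h d v) - (m * m.-1)%:R *: act sl2_y d (y0s m.-2 v).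
Proof.
move=> x0; elim: m => [|m IH]; first by rewrite /= x0 !scale0r subrr.
rewrite /= -!/(y0s _ _) act_xy IH addn0 h_y0s (linB (al _ _)) !(linZ (al _ _)).
case: m {IH} => [|m]; first by rewrite /= muln0 !scale0r !subr0 add0r scale1r.
rewrite addrACA -opprD; congr (_ - _).
  rewrite -[act sl2_y 0 (y0s _ _)]/(y0s m.+1 (act sl2_h d v)).
  by rewrite -{2}[y0s m.+1 _]scale1r -scalerDl natr1.
case: m => [|m]; first by rewrite /= muln0 scale0r add0r.
rewrite act_selfC -[act sl2_y 0 (y0s _ _)]/(y0s m.+1 v) -scalerDl -natrD; congr (_%:R *: _).
by rewrite /= -mul2n [(2 * _)%N]mulnC -mulnDr addn2 mulnC.
Qed.

(** The commutator of h t^d with y t^s is a multiple of y t^(d+s), so moving h to the right produces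
    only words in y of the same length. *)
Lemma h_ys_mod (S : subspace M) b d v :
  (forall b', size b' = size b -> S (ys b' v)) ->
  S (act sl2_h d (ys b v) - ys b (act sl2_h d v)).
Proof.
elim: b S => [|s b IH] S Sb; first by rewrite subrr; exact: subspace0.
rewrite /= -!/(ys b _) act_hy addrAC -(linB (al _ _)).
apply: subspaceB; last by apply: subspaceZ; exact: (Sb ((d + s)%N :: b)).
apply: (IH (preim_subspace (@act_linear K M sl2_y s) S)) => b' sb'.
by apply: (Sb (s :: b')); rewrite /= sb'.
Qed.

(** The commutator of x t^d with y t^s is h t^(d+s), so moving x to the right produces words with
    one y replaced by an h. *)
Lemma x_ys_mod (S : subspace M) b d v :
  (forall b1 b2 e, (size b1 + size b2).+1 = size b -> S (ys b1 (act sl2_h e (ys b2 v)))) ->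
  S (act sl2_x d (ys b v) - ys b (act sl2_x d v)).
Proof.
elim: b S => [|s b IH] S Sb; first by rewrite subrr; exact: subspace0.
rewrite /= -!/(ys b _) act_xy addrAC -(linB (al _ _)).
apply: subspaceD; last exact: (Sb [::] b).
apply: (IH (preim_subspace (@act_linear K M sl2_y s) S)) => b1 b2 e sb.
by apply: (Sb (s :: b1)); rewrite /= -sb.
Qed.

End Sl2Identities.

(** * Straightening in the global Weyl module *)

Section Straightening.
Variables (K : numFieldType) (n : nat).
Notation W := (weyl K n).
Notation w := (weyl_gen K n).

(** The filtration of W(n) by the length of words in y and h; straightening shows in [weyl_pbw] that
    length [n] already gives everything. *)
Definition pbw (j : nat) : subspace W :=
  span [set v | exists b c, (size b + size c <= j)%N /\ v = ys b (hs c w)].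

Lemma pbw_gen j b c : (size b + size c <= j)%N -> pbw j (ys b (hs c w)).
Proof. by move=> bc; apply: span_gen; exists b, c. Qed.

Lemma pbw_le i j v : (i <= j)%N -> pbw i v -> pbw j v.
Proof.
move=> ij; apply: spanS => _ [b [c [bc ->]]]; exists b, c; split=> //.
exact: leq_trans ij.
Qed.

Lemma pbw_y j s v : pbw j v -> pbw j.+1 (act sl2_y s v).
Proof.
apply: (span_min (S := preim_subspace (@act_linear K W sl2_y s) (pbw j.+1))).
by move=> _ [b [c [bc ->]]]; apply: (pbw_gen (b := s :: b)).
Qed.

Lemma pbw_h j s v : pbw j v -> pbw j.+1 (act sl2_h s v).
Proof.
apply: (span_min (S := preim_subspace (@act_linear K W sl2_h s) (pbw j.+1))).
move=> _ [b [c [bc ->]]].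
change (pbw j.+1 (act sl2_h s (ys b (hs c w)))).
rewrite -[act _ _ _](subrK (ys b (hs (s :: c) w))); apply: subspaceD.
  apply: (pbw_le (leqnSn j)); apply: h_ys_mod => b' sb'.
  by apply: pbw_gen; rewrite sb'.
by apply: pbw_gen; rewrite /= addnS.
Qed.

(** Moving to the right, x turns a y into an h, which keeps the length, and it kills every
    [hs c w]. *)
Lemma pbw_x j s v : pbw j v -> pbw j (act sl2_x s v).
Proof.
apply: (span_min (S := preim_subspace (@act_linear K W sl2_x s) (pbw j))).
move=> _ [b [c [bc ->]]].
change (pbw j (act sl2_x s (ys b (hs c w)))).
have [wx _ _] := weyl_gen_hw K n.
elim: b j bc => [|r b IH] j bc; first by rewrite hs_x0 //; exact: subspace0.
case: j bc => [//|j] bc.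
rewrite -[ys (r :: b) _]/(act sl2_y r (ys b (hs c w))) act_xy; apply: subspaceD.
  by apply: pbw_y; exact: IH.
by apply: pbw_h; exact: pbw_gen.
Qed.

Let x_hs c r : act sl2_x r (hs c w) = 0.
Proof. by apply: hs_x0 => s; have [wx _ _] := weyl_gen_hw K n; exact: wx. Qed.

Let natZ_inj (k : nat) (v : W) : k.+1%:R *: v = 0 -> v = 0.
Proof. by move/eqP; rewrite scaler_eq0 pnatr_eq0 => /eqP. Qed.

(** Apply h t^d to y^(n+1) f = 0 and x t^d to y^(n+2) f = 0. The vector y^(n+1) (h t^d) f comes out
    as 2(n+1) and as n + 1 times (y t^d) y^n f, so it is twice itself. *)
Lemma weyl_y0s c : y0s n.+1 (hs c w) = 0.
Proof.
elim: c => [|d c IH]; first by have [] := weyl_gen_hw K n.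
rewrite -[hs (d :: c) w]/(act sl2_h d (hs c w)); set f := hs c w in IH *.
have /eqP := h_y0s d n.+1 f; rewrite IH linear0 eq_sym subr_eq0 => /eqP E1.
have /eqP := x_y0s d n.+2 (x_hs c); rewrite -/f.
rewrite -[y0s n.+2 f]/(act sl2_y 0 (y0s n.+1 f)) IH !linear0 eq_sym subr_eq0 /= natrM -scalerA.
rewrite -subr_eq0 -scalerBr => /eqP /natZ_inj /eqP; rewrite subr_eq0 => /eqP E2.
move: E1; rewrite -addnn natrD scalerDl -E2 => /eqP.
by rewrite -[X in X == _]addr0 (inj_eq (addrI _)) eq_sym => /eqP.
Qed.

(** Polarisation: applying h t^d to the relation for [k] turns one factor y t^0 into y t^d with
    coefficient 2(n + 1 - k), and the other terms vanish by induction. *)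
Lemma weyl_ys_y0s k b c : size b = k -> (k <= n.+1)%N -> ys b (y0s (n.+1 - k) (hs c w)) = 0.
Proof.
elim: k b c => [|k IH] b c; first by move=> /size0nil -> _; rewrite subn0; exact: weyl_y0s.
case/lastP: b => [//|b d]; rewrite size_rcons => -[sb] kn; set f := hs c w.
have E g : ys (rcons b d) g = ys b (act sl2_y d g) by rewrite /ys foldr_rcons.
(* [natZ_inj] takes the predecessor of the positive coefficient 2(n + 1 - k). *)
rewrite E; apply: (@natZ_inj ((n.+1 - k).*2.-1)).
rewrite prednK ?double_gt0 ?subn_gt0 //.
have Ib b' c' : size b' = k -> ys b' (y0s (n.+1 - k) (hs c' w)) = 0.
  by move=> sb'; apply: IH => //; exact: ltnW.
suff : ys b (act sl2_h d (y0s (n.+1 - k) f)) = 0.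
  rewrite h_y0s (linB (ys_linear b)) (linZ (ys_linear b)) (Ib b (d :: c)) //.
  by rewrite sub0r subnS => /eqP; rewrite oppr_eq0 => /eqP.
have := @h_ys_mod K W (gsub0 W) b d (y0s (n.+1 - k) f).
rewrite (Ib b c) // linear0 sub0r => H; apply/eqP; rewrite -oppr_eq0; apply/eqP/H => b' sb'.
by apply: Ib; rewrite sb'.
Qed.

(* The relations y(b_1) ... y(b_(n+1)) = 0 are transported, one y at a time, to
   y(b_1) ... y(b_k) h(c_1) ... h(c_l) = 0 with k + l = n + 1, modulo shorter products. *)
Lemma pbw_reduce l b c : size c = l -> (size b + l)%N = n.+1 -> pbw n (ys b (hs c w)).
Proof.
elim: l b c => [|l IH] b c; first by move=> /size0nil -> ; rewrite addn0 => bn;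
  have := @weyl_ys_y0s n.+1 b [::] bn (leqnn _); rewrite subnn => ->; exact: subspace0.
case: c => [//|g c] [sc]; set f := hs c w; set k := size b => kl.
have nkl : n = (k + l)%N by move: kl; rewrite addnS => -[].
have gen b' m : (size b' + m <= k)%N -> pbw n (ys b' (y0s m f)).
  move=> bm; rewrite y0s_ys -ys_cat; apply: (@pbw_gen n (b' ++ nseq m 0%N) c); rewrite size_cat size_nseq sc.
  by apply: (@leq_trans (k + l)); rewrite ?leq_add2r // -nkl.
have geny b' d m : (size b' + m < k)%N -> pbw n (ys b' (act sl2_y d (y0s m f))).
  move=> bm; rewrite -[ys b' _](foldr_rcons (act sl2_y) _ b' d) -/(ys _ _).
  by apply: gen; rewrite size_rcons addSn.
(* Of the [k] factors y, [j] have arbitrary index and form [b'], the others are y t^0. The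
   hypothesis is the case [j - 1]. *)
have step j : (forall b' e, (size b').+1 = j -> (j <= k)%N -> pbw n (ys b' (y0s (k - size b') (act sl2_h e f)))) ->
    forall b' e, size b' = j -> (j <= k)%N -> pbw n (ys b' (y0s (k - j) (act sl2_h e f))).
  move=> H b' e sb' jk; set m := (k - j)%N.
  have jm : (j + m)%N = k by rewrite subnKC.
  (* This word has one h fewer and one y more, still n + 1 factors, so the outer induction applies
     before x acts. *)
  have top : pbw n (act sl2_x e (ys b' (y0s m.+1 f))).
    by apply: pbw_x; rewrite y0s_ys -ys_cat; apply: IH; rewrite // size_cat size_nseq sb' addnS jm addSn -nkl.
  (* Where x meets a factor of [b'] it leaves an h and one arbitrary factor fewer: the case [j - 1],
     up to shorter words. Where it meets a factor y t^0, the wanted word appears, m + 1 times in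
     all. *)
  have : pbw n (ys b' (act sl2_x e (y0s m.+1 f))).
    rewrite -[ys b' _](subKr (act sl2_x e (ys b' (y0s m.+1 f)))).
    apply: subspaceB => //; apply: x_ys_mod => b1 b2 e' s12; rewrite sb' in s12.
    have s12m : (size b1 + size b2 + m.+1)%N = k by rewrite addnS -addSn s12.
    rewrite -[act sl2_h e' _](subrK (ys b2 (act sl2_h e' (y0s m.+1 f)))).
    rewrite (linD (ys_linear b1)); apply: subspaceD.
      apply: (@h_ys_mod K W (preim_subspace (ys_linear b1) (pbw n))) => b'' sb''.
      change (pbw n (ys b1 (ys b'' (y0s m.+1 f)))); rewrite -ys_cat; apply: gen.
      by rewrite size_cat sb'' s12m.
    rewrite -ys_cat h_y0s (linB (ys_linear _)) (linZ (ys_linear _)); apply: subspaceB.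
      have -> : m.+1 = (k - size (b1 ++ b2))%N by rewrite size_cat -s12m addKn.
      by apply: H; rewrite ?size_cat ?s12.
    by apply: subspaceZ; apply: geny; rewrite size_cat /= -s12m addnS.
  rewrite (x_y0s e m.+1 (x_hs c)) (linB (ys_linear b')) !(linZ (ys_linear b')) => H'.
  have {}H' : pbw n (m.+1%:R *: ys b' (y0s m (act sl2_h e f))).
    rewrite -[_ *: _](subrK ((m.+1 * m)%:R *: ys b' (act sl2_y e (y0s m.-1 f)))).
    apply: subspaceD => //; case: (m) jm => [|m'] jm'; first by rewrite muln0 scale0r; exact: subspace0.
    by apply: subspaceZ; apply: geny; rewrite sb' -jm' addnS.
  by have := subspaceZ (m.+1%:R^-1) H'; rewrite scalerK // pnatr_eq0.
suff inner j : forall b' e, size b' = j -> (j <= k)%N ->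
    pbw n (ys b' (y0s (k - j) (act sl2_h e f))).
  by have := inner k b g erefl (leqnn k); rewrite subnn.
elim: j => [|j IHj]; apply: step => // b' e [sb'] jk.
by rewrite sb'; apply: IHj => //; exact: ltnW.
Qed.

Lemma weyl_pbw (v : W) : pbw n v.
Proof.
have pS j u : pbw j u -> (j <= n.+1)%N -> pbw n u.
  move=> ju; rewrite leq_eqVlt => /predU1P[jn|jn]; last exact: pbw_le ju.
  move: ju; rewrite jn; apply: span_min => _ [b [c [+ ->]]]; rewrite leq_eqVlt => /predU1P[bc|bc].
    exact: pbw_reduce bc.
  exact: pbw_gen.
move: v; apply: weyl_generated; first exact: (@pbw_gen n [::] [::]).
move=> a r v nv; move: a; apply: act_sl2_ind.
- by apply: (pS n.+1) => //; exact: pbw_h.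
- exact: pbw_x.
- by apply: (pS n.+1) => //; exact: pbw_y.
Qed.

End Straightening.

Section LetterAction.
Variables (K : fieldType) (U : lmodType K) (f : letter -> U).

Definition la (i : nat) : letter := (0, i).
Definition lb (i : nat) : letter := (1, i).

Lemma letter_act2 (a : sl2 K) r l : letter_act f a r l =
  sl2_mx a 0 l.1 *: f (la (l.2 + r)%N) + sl2_mx a 1 l.1 *: f (lb (l.2 + r)%N).
Proof.
rewrite /letter_act big_ord_recl big_ord1.
by rewrite (_ : lift ord0 ord0 = 1) //; apply: val_inj.
Qed.

Lemma letter_act_xa r i : letter_act f sl2_x r (la i) = 0.
Proof. by rewrite letter_act2 !mxE /= !scale0r addr0. Qed.
Lemma letter_act_xb r i : letter_act f sl2_x r (lb i) = f (la (i + r)).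
Proof. by rewrite letter_act2 !mxE /= scale0r scale1r addr0. Qed.
Lemma letter_act_ya r i : letter_act f sl2_y r (la i) = f (lb (i + r)).
Proof. by rewrite letter_act2 !mxE /= scale0r scale1r add0r. Qed.
Lemma letter_act_yb r i : letter_act f sl2_y r (lb i) = 0.
Proof. by rewrite letter_act2 !mxE /= !scale0r addr0. Qed.
Lemma letter_act_ha r i : letter_act f sl2_h r (la i) = f (la (i + r)).
Proof. by rewrite letter_act2 !mxE /= subr0 subrr scale0r scale1r addr0. Qed.
Lemma letter_act_hb r i : letter_act f sl2_h r (lb i) = - f (lb (i + r)).
Proof. by rewrite letter_act2 !mxE /= subrr sub0r scale0r scaleN1r add0r. Qed.

Lemma letterP (l : letter) : (exists i, l = la i) \/ (exists i, l = lb i).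
Proof.
case: l => [[[|[|//]] h] i]; [left|right]; exists i; congr (_, _); exact: val_inj.
Qed.
End LetterAction.

Lemma perm_swap_head (T : eqType) (x y : T) s : perm_eq (x :: y :: s) (y :: x :: s).
Proof. by apply/permPl; exact: (perm_catCA [:: x] [:: y] s). Qed.

(** * Comparison of W(n) with the symmetric power *)

Section WeylFock.
Variable K : numFieldType.
Notation F := (fockRep K).
Notation fw := (fw K).
Implicit Type u : seq letter.

Lemma create_fw l u : create l (fw u) = fw (l :: u).
Proof. exact: create_word. Qed.

Lemma fw_perm u u' : perm_eq u u' -> fw u = fw u'.
Proof.
have E v : fw v = foldr create (fw [::]) v by elim: v => //= l v <-; rewrite create_fw.
by move=> uu'; rewrite (E u) (E u'); apply: foldr_perm uu' => k l f; exact: createC.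
Qed.

Lemma act_fw a r l u : act a r (fw (l :: u)) =
  letter_act (fun k => fw (k :: u)) a r l + create l (act a r (fw u)).
Proof.
rewrite -create_fw act_create; congr (_ + _); apply: eq_letter_act => k.
exact: create_fw.
Qed.

Definition vac (n : nat) : F := fw (nseq n (la 0)).

Lemma act_x_vac n r : act sl2_x r (vac n) = 0.
Proof.
elim: n => [|n IH]; first exact: act_fock_nil.
by rewrite -[vac n.+1]/(fw (la 0 :: nseq n (la 0))) act_fw letter_act_xa IH (lin0 (create_linear _)) addr0.
Qed.

Lemma act_vac (g : sl2 K) (l : letter) n r :
  (forall f : letter -> F, letter_act f g r (la 0) = f l) ->
  act g r (vac n) = n%:R *: fw (l :: nseq n.-1 (la 0)).
Proof.
move=> gl; elim: n => [|n IH]; first by rewrite scale0r; exact: act_fock_nil.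
rewrite -[vac n.+1]/(fw (la 0 :: nseq n (la 0))) act_fw gl IH (linZ (create_linear _)) create_fw -natr1 scalerDl scale1r addrC.
case: n {IH} => [|n]; first by rewrite !scale0r.
by congr (_ *: _ + _); apply: fw_perm; exact: perm_swap_head.
Qed.

Lemma act_h0_vac n : act sl2_h 0 (vac n) = n%:R *: vac n.
Proof.
rewrite (act_vac (l := la 0)) => [|f]; last by rewrite letter_act_ha.
by case: n => [|n //]; rewrite !scale0r.
Qed.

Definition bcount n k : subspace F :=
  span [set q | exists u, [/\ size u = n, count (fun l => l.1 == 1) u = k & q = fw u]].

Lemma bcount_gen u : bcount (size u) (count (fun l => l.1 == 1) u) (fw u).
Proof. by apply: span_gen; exists u. Qed.

Lemma bcount_create n k l f : bcount n k f -> bcount n.+1 ((l.1 == 1) + k) (create l f).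
Proof.
apply: (span_min (S := preim_subspace (create_linear l) (bcount n.+1 ((l.1 == 1) + k)))).
move=> _ [u [<- <- ->]]; change (bcount (size u).+1 ((l.1 == 1) + count (fun l => l.1 == 1) u)
  (create l (fw u))).
by rewrite create_fw; exact: (@bcount_gen (l :: u)).
Qed.

Lemma bcount_y n k r f : bcount n k f -> bcount n k.+1 (act sl2_y r f).
Proof.
apply: (span_min (S := preim_subspace (@act_linear K F sl2_y r) (bcount n k.+1))).
move=> _ [u [<- <- ->]].
change (bcount (size u) (count (fun l => l.1 == 1) u).+1 (act sl2_y r (fw u))).
elim: u => [|l u IH]; first by rewrite act_fock_nil; exact: subspace0.
rewrite act_fw; apply: subspaceD; last by rewrite -addnS; exact: bcount_create.
have [[i ->]|[i ->]] := letterP l; last by rewrite letter_act_yb; exact: subspace0.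
by rewrite letter_act_ya; exact: (@bcount_gen (lb (i + r) :: u)).
Qed.

Lemma bcount_big n k f : (n < k)%N -> bcount n k f -> f = 0.
Proof.
move=> nk; apply: (span_min (S := gsub0 F)) => x [u [su cu _]].
by have := count_size (fun l : letter => l.1 == 1) u; rewrite su cu leqNgt nk.
Qed.

(** For the relation on y: each y creates a letter e_1, and a word of length [n] has room for only
    [n] of them. *)
Lemma vac_hw n : highest_weight n (vac n).
Proof.
split=> [r||]; [exact: act_x_vac|exact: act_h0_vac|].
suff b k : bcount n k (iter k (act sl2_y 0) (vac n)) by exact: bcount_big (b n.+1).
elim: k => [|k IH]; last exact: bcount_y.
apply: span_gen; exists (nseq n (la 0)); split=> //; first exact: size_nseq.
by rewrite count_nseq mul0n.
Qed.

Lemma vac_grade n : grade F 0 (vac n).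
Proof.
apply: span_gen; exists (nseq n (la 0)) => //.
by rewrite /wdeg; elim: n => [|n IH]; rewrite ?big_nil //= big_cons add0n.
Qed.

Definition nonvac (l : letter) : bool := l != la 0.

(** The filtration of degree [n] by the number of letters other than the vacuum letter (0, 0); the
    comparison with W(n) is triangular for it. *)
Definition lev n j : subspace F :=
  span [set q | exists u, [/\ size u = n, (count nonvac u < j)%N & q = fw u]].

Lemma lev_gen n j u : size u = n -> (count nonvac u < j)%N -> lev n j (fw u).
Proof. by move=> su cu; apply: span_gen; exists u. Qed.

Lemma lev_le n i j f : (i <= j)%N -> lev n i f -> lev n j f.
Proof.
move=> ij; apply: spanS => _ [u [su cu ->]]; exists u; split=> //.
exact: leq_trans ij.
Qed.

Lemma lev_create n j l f : lev n j f -> lev n.+1 (nonvac l + j) (create l f).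
Proof.
apply: (span_min (S := preim_subspace (create_linear l) (lev n.+1 (nonvac l + j)))).
move=> _ [u [<- cu ->]]; change (lev (size u).+1 (nonvac l + j) (create l (fw u))).
by rewrite create_fw; apply: lev_gen; rewrite //= ltn_add2l.
Qed.

Lemma lev_act n j a r f : lev n j f -> lev n j.+1 (act a r f).
Proof.
apply: (span_min (S := preim_subspace (@act_linear K F a r) (lev n j.+1))).
move=> _ [u [<- cu ->]]; change (lev (size u) j.+1 (act a r (fw u))).
elim: u j cu => [|l u IH] j cu; first by rewrite act_fock_nil; exact: subspace0.
rewrite act_fw; apply: subspaceD.
  apply: (subspace_sum (S := lev _ _)) => p; apply: subspaceZ; apply: lev_gen => //=.
  apply: (@leq_trans (1 + count nonvac u).+1); first by rewrite ltnS leq_add2r leq_b1.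
  by rewrite ltnS add1n; apply: leq_trans cu; rewrite /= ltnS leq_addl.
have := @lev_create _ (count nonvac u).+2 l _ (IH _ (ltnSn _)); apply: lev_le.
by rewrite !addnS ltnS.
Qed.

(** The leading term replaces one of the [m] vacuum letters by [l]; acting on a letter of [v]
    creates no further non-vacuum letter. *)
Lemma lev_act_vac (g : sl2 K) (l : letter) r v m :
  (forall f : letter -> F, letter_act f g r (la 0) = f l) -> all nonvac v ->
  lev (size v + m) (size v).+1
    (act g r (fw (v ++ nseq m (la 0))) - m%:R *: fw (l :: v ++ nseq m.-1 (la 0))).
Proof.
move=> gl; elim: v => [|k v IH].
  rewrite -[fw _]/(vac m) (act_vac m gl) subrr => _; exact: subspace0.
case/andP=> nk nv; rewrite cat_cons act_fw -addrA; apply: subspaceD.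
  apply: (subspace_sum (S := lev _ _)) => p; apply: subspaceZ; apply: lev_gen => //=.
    by rewrite size_cat size_nseq.
  rewrite count_cat count_nseq /nonvac eqxx mul0n addn0 !ltnS.
  by rewrite (leq_trans (leq_add (leq_b1 _) (count_size _ _))).
rewrite -[_ *: fw _](_ : create k (m%:R *: fw (l :: v ++ nseq m.-1 (la 0))) = _).
  rewrite -(linB (create_linear k)); have := @lev_create _ _ k _ (IH nv).
  by rewrite nk.
rewrite (linZ (create_linear k)) create_fw; congr (_ *: _); apply: fw_perm.
exact: perm_swap_head.
Qed.

(* The word with b-indices b, a-indices c, completed by n - |b| - |c| letters (0, 0) *)
Definition pword n (b c : seq nat) : seq letter :=
  ([seq lb i | i <- b] ++ [seq la i | i <- c]) ++ nseq (n - (size b + size c)) (la 0).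

(** Each factor converts one of the vacuum letters still present, whence the falling factorial. Zero
    indices in [c] are excluded because h t^0 gives a vacuum letter back. *)
Lemma ys_hs_vac n b c : all (fun i => i != 0%N) c -> (size b + size c <= n)%N ->
  lev n (size b + size c)
    (ys b (hs c (vac n)) - (n ^_ (size b + size c))%:R *: fw (pword n b c)).
Proof.
have nb b' c' : all (fun i => i != 0%N) c' -> all nonvac ([seq lb i | i <- b'] ++ [seq la i | i <- c']).
  move=> c0; rewrite all_cat !all_map; apply/andP; split.
    by apply/allP => i _; rewrite /= /nonvac xpair_eqE.
  by apply: sub_all c0 => i /=; rewrite /nonvac xpair_eqE.
have step (g : sl2 K) (l : letter) r b' c' b'' c'' (X : F) :
    (forall f : letter -> F, letter_act f g r (la 0) = f l) -> all (fun i => i != 0%N) c' ->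
    (size b'' + size c'' = (size b' + size c').+1)%N -> (size b'' + size c'' <= n)%N ->
    perm_eq (pword n b'' c'') (l :: ([seq lb i | i <- b'] ++ [seq la i | i <- c'])
      ++ nseq (n - (size b' + size c')).-1 (la 0)) ->
    lev n (size b' + size c') (X - (n ^_ (size b' + size c'))%:R *: fw (pword n b' c')) ->
    lev n (size b'' + size c'')
      (act g r X - (n ^_ (size b'' + size c''))%:R *: fw (pword n b'' c'')).
  move=> gl c0 E En pe LX; rewrite E; rewrite E in En; rewrite (fw_perm pe).
  set N := (size b' + size c')%N in E En LX pe *; set m := (n - N)%N in pe *.
  have sv : size ([seq lb i | i <- b'] ++ [seq la i | i <- c']) = N.
    by rewrite size_cat !size_map.
  rewrite -[act g r X](subrK (act g r ((n ^_ N)%:R *: fw (pword n b' c')))) -addrA.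
  apply: subspaceD.
    by rewrite -(linB (@act_linear K F g r)); exact: lev_act.
  rewrite (linZ (@act_linear K F g r)) ffactnSr natrM -scalerA -scalerBr; apply: subspaceZ.
  have := @lev_act_vac g l r _ m gl (nb b' c' c0); rewrite sv.
  by rewrite subnKC //; exact: ltnW.
elim: b => [|s b IHb]; last first.
  move=> c0 bc; apply: (step sl2_y (lb s) s b c) => //.
  - by move=> f; rewrite letter_act_ya.
  - by rewrite /pword /= subnS.
  - by apply: IHb => //; exact: ltnW.
elim: c => [_ _|s c IHc]; first by rewrite /pword subn0 ffactn0 scale1r subrr; exact: subspace0.
case/andP=> s0 c0 cn; apply: (step sl2_h (la s) s [::] c) => //.
- by move=> f; rewrite letter_act_ha.
- by rewrite /pword /= !add0n subnS.
- by apply: IHc => //; exact: ltnW.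
Qed.

Section Iso.
Variable n : nat.
Notation W := (weyl K n).
Notation w := (weyl_gen K n).

Definition isb (l : letter) : bool := l.1 == 1.
Definition isa (l : letter) : bool := (l.1 == 0) && (l.2 != 0%N).
Definition bs u : seq nat := [seq l.2 | l <- u & isb l].
Definition as_ u : seq nat := [seq l.2 | l <- u & isa l].

(** A linear candidate for the inverse, correct only up to triangular terms: a monomial prescribes
    which y and h to apply to the generator. *)
Definition rho_word u : W := ys (bs u) (hs (as_ u) w).

Fact rho_swap u v k l : rho_word (u ++ k :: l :: v) = rho_word (u ++ l :: k :: v).
Proof.
have p : perm_eq (u ++ k :: l :: v) (u ++ l :: k :: v).
  by rewrite perm_cat2l perm_swap_head.
rewrite /rho_word (@hs_perm K W _ (as_ (u ++ l :: k :: v))).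
  by apply: ys_perm; apply: perm_map; exact: perm_filter.
by apply: perm_map; exact: perm_filter.
Qed.

Definition rho : F -> W := fock_lift rho_word.

Lemma rho_linear : linear rho.
Proof. exact: fock_lift_linear rho_swap. Qed.

Lemma rho_fw u : rho (fw u) = rho_word u.
Proof. exact: fock_lift_word rho_swap u. Qed.

Lemma pword_canon u : perm_eq u (pword (size u) (bs u) (as_ u)) /\
  (size (bs u) + size (as_ u))%N = count nonvac u.
Proof.
elim: u => [|l u [IHp IHc]] //; move: IHp; rewrite /pword => IHp.
have cs : (size (bs u) + size (as_ u) <= size u)%N by rewrite IHc; exact: count_size.
have [[i ->]|[i ->]] := letterP l; last first.
  rewrite [bs _](_ : _ = i :: bs u) // [as_ _](_ : _ = as_ u) // /= addSn subSS.
  by split; [rewrite perm_cons|rewrite IHc].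
rewrite [bs _](_ : _ = bs u) //; case: i => [|i].
  rewrite [as_ _](_ : _ = as_ u) //= subSn //; split=> //.
  by rewrite perm_sym perm_catC /= perm_cons perm_catC perm_sym.
rewrite [as_ _](_ : _ = i.+1 :: as_ u) //= addnS subSS IHc; split=> //; rewrite -IHc -catA /=.
by rewrite perm_sym perm_catC /= perm_cons perm_catC catA perm_sym.
Qed.

Lemma weyl_rho (v : W) : exists2 f, fdeg K n f & v = rho f.
Proof.
suff : im_subspace rho_linear (fdeg K n) v by [].
move: (weyl_pbw v); apply: span_min => _ [b [c [bc ->]]].
(* Factors h t^0 act by the scalar [n] and are dropped. *)
have hsZ (c' : seq nat) : exists k : nat,
    hs c' w = (n ^ k)%:R *: hs [seq i <- c' | i != 0%N] w.
  elim: c' => [|i c' [k IH]]; first by exists 0; rewrite scale1r.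
  have hi : hs (i :: c') w = (n ^ k)%:R *: act sl2_h i (hs [seq i <- c' | i != 0%N] w).
    by rewrite -[LHS]/(act sl2_h i (hs c' w)) IH (linZ (@act_linear K W _ _)).
  case: i hi => [|i] hi; last by exists k.
  pose c0 := [seq i <- c' | i != 0%N]; exists k.+1.
  change (hs (0%N :: c') w = (n ^ k.+1)%:R *: hs c0 w); rewrite hi -/c0.
  have -> : act sl2_h 0 (hs c0 w) = n%:R *: hs c0 w.
    have [_ wh _] := weyl_gen_hw K n.
    elim: (c0) => [//|j c1 IHc]; rewrite -[hs (j :: c1) w]/(act sl2_h j (hs c1 w)) act_selfC IHc.
    by rewrite (linZ (@act_linear K W _ _)).
  by rewrite scalerA -natrM expnSr.
have [k ->] := hsZ c; set c0 := filter _ _; rewrite (linZ (ys_linear b)); apply: subspaceZ.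
have bc0 : (size b + size c0 <= n)%N.
  by apply: leq_trans bc; rewrite leq_add2l size_filter count_size.
exists (fw (pword n b c0)).
  have sz : size (pword n b c0) = n by rewrite /pword !size_cat !size_map size_nseq subnKC.
  by rewrite -[X in fdeg K X]sz; exact: fdeg_word.
rewrite rho_fw /rho_word.
have -> : bs (pword n b c0) = b.
  rewrite /bs /pword !filter_cat !filter_map !map_cat.
  rewrite (eq_filter (a2 := xpredT)) // filter_predT.
  rewrite (eq_filter (a2 := xpred0)) // filter_pred0 /=.
  rewrite (_ : filter _ (nseq _ _) = [::]); last first.
    by apply/eqP; rewrite -size_eq0 size_filter count_nseq.
  by rewrite !cats0 -map_comp map_id.
have -> : as_ (pword n b c0) = c0; last by [].
rewrite /as_ /pword !filter_cat !filter_map !map_cat.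
rewrite (eq_filter (a2 := xpred0)) // filter_pred0 /=.
rewrite (eq_filter (a2 := fun i => i != 0%N)) // (_ : filter _ (nseq _ _) = [::]); last first.
  by apply/eqP; rewrite -size_eq0 size_filter count_nseq.
by rewrite cats0 -map_comp map_id /c0 filter_id.
Qed.

(** The composite [th] of [rho] and [p] is triangular for [lev] with diagonal entries [n ^_ j],
    nonzero for j <= n, hence bijective on degree [n]. So [p] reaches all of that degree, and as
    [rho] maps it onto W(n), [p] is injective. *)
Lemma weyl_fock : exists f : W -> F, [/\ rep_hom f, f w = vac n, injective f
  & forall x, fdeg K n x <-> exists v, f v = x].
Proof.
have [p [lp pw pa pg]] := weyl_hom (vac_hw n) (vac_grade n).
have pys b v : p (ys b v) = ys b (p v) by elim: b => //= s b <-; exact: pa.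
have phs c v : p (hs c v) = hs c (p v) by elim: c => //= s c <-; exact: pa.
pose th x := p (rho x); have lth : linear th := lin_comp lp rho_linear.
have thw u : size u = n ->
    lev n (count nonvac u) (th (fw u) - (n ^_ (count nonvac u))%:R *: fw u).
  move=> su; have [pu <-] := pword_canon u; rewrite su in pu; rewrite {2}(fw_perm pu) /th rho_fw /rho_word.
  rewrite pys phs pw; apply: ys_hs_vac.
    by rewrite all_map; apply/allP => l; rewrite mem_filter => /andP[/andP[]].
  by rewrite (pword_canon u).2 -su; exact: count_size.
have thl j x : lev n j.+1 x -> lev n j (th x - (n ^_ j)%:R *: x).
  apply: (span_min (S := preim_subspace (lin_sub lth (lin_scale (n ^_ j)%:R (@lin_id K F))) (lev n j))).
  move=> y [u [su]]; rewrite ltnS leq_eqVlt => /predU1P[<- ->|cu ->]; first exact: thw.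
  change (lev n j (th (fw u) - (n ^_ j)%:R *: fw u)).
  rewrite -[th _](subrK ((n ^_ (count nonvac u))%:R *: fw u)) -addrA; apply: subspaceD.
    by apply: lev_le (thw _ su); exact: ltnW.
  by apply: subspaceB; apply: subspaceZ; exact: lev_gen.
have lev0 x : lev n 0 x -> x = 0.
  by apply: (span_min (S := gsub0 F)) => y [u []].
have fl x : fdeg K n x -> lev n n.+1 x.
  by apply: spanS => _ [u su ->]; exists u; split=> //; rewrite ltnS -su count_size.
have n0 j : (j <= n)%N -> (n ^_ j)%:R != 0 :> K by rewrite pnatr_eq0 -lt0n ffact_gt0.
have inj x : fdeg K n x -> th x = 0 -> x = 0.
  move=> /fl nx tx; suff H j : (j <= n.+1)%N -> lev n j x -> x = 0 by exact: (H n.+1).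
  elim: j => [_ /lev0 //|j IH] jn jx; apply: IH; first exact: ltnW.
  have := thl _ _ jx; rewrite tx sub0r => /subspaceN; rewrite opprK => /(subspaceZ (n ^_ j)%:R^-1).
  by rewrite scalerK // n0.
have sur x : fdeg K n x -> im_subspace lth (full F) x.
  move=> /fl nx; suff H j y : (j <= n.+1)%N -> lev n j y -> im_subspace lth (full F) y.
    exact: (H n.+1).
  elim: j y => [y _ /lev0 ->|j IH y jn jy]; first exact: subspace0.
  have -> : y = (n ^_ j)%:R^-1 *: (th y - (th y - (n ^_ j)%:R *: y)).
    by rewrite subKr scalerK // n0.
  apply: subspaceZ; apply: subspaceB; first by exists y.
  by apply: IH; [exact: ltnW|exact: thl].
exists p; split=> //.
- by split=> // r v /pg; rewrite addr0.
- move=> v v' /eqP; rewrite -subr_eq0 -(linB lp) => /eqP.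
  have [x nx E] := weyl_rho (v - v'); rewrite E => /(inj _ nx) x0.
  by apply: subr0_eq; rewrite E x0; exact: lin0 rho_linear.
- move=> x; split=> [/sur[y _ ->]|[v <-]]; first by exists (rho y).
  move: v; apply: (weyl_generated (S := preim_subspace lp (fdeg K n))) => [|a r v].
    by rewrite /= pw -{1}[n](size_nseq n (la 0)); exact: fdeg_word.
  by rewrite /= pa; exact: fdeg_act.
Qed.

End Iso.
End WeylFock.

(** * Weights *)

Section Weights.
Variable K : numFieldType.
Implicit Types M Q P : gradedRep K.

Definition wvec M (k : int) (v : M) : Prop := act sl2_h 0 v = k%:~R *: v.

Definition irange (N : nat) : seq int := [seq i%:Z - N%:Z | i <- iota 0 N.*2.+1].

Lemma mem_irange N (a : int) : (a \in irange N) = (`|a| <= N)%N.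
Proof.
apply/mapP/idP => [[j]|aN].
  by rewrite mem_iota add0n => /andP[_ jN] ->; lia.
exists (absz (a + N%:Z)); last by lia.
by rewrite mem_iota add0n; apply/andP; split=> //; lia.
Qed.

Definition wstep M (k a : int) (u : M) : M :=
  (k%:~R - a%:~R)^-1 *: (act sl2_h 0 u - a%:~R *: u).

(* Lagrange interpolation in h: the projection to the weight k along the other weights
   of absolute value at most N *)
Definition wproj M (N : nat) (k : int) (v : M) : M :=
  foldr (wstep k) v [seq a <- irange N | a != k].

Lemma wstep_linear M k a : linear (@wstep M k a).
Proof.
apply: lin_scale; apply: lin_sub; first exact: act_linear.
exact: lin_scale (@lin_id K M).
Qed.

Lemma wproj_linear M N k : linear (@wproj M N k).
Proof.
rewrite /wproj; elim: [seq _ <- _ | _] => [//|a s IH] c u v /=.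
by rewrite IH wstep_linear.
Qed.

Lemma wproj_stable M N k (S : subspace M) v : (forall u, S u -> S (act sl2_h 0 u)) ->
  S v -> S (wproj N k v).
Proof.
move=> Sh Sv; rewrite /wproj; elim: [seq _ <- _ | _] => [//|a s IH] /=.
by apply: subspaceZ; apply: subspaceB; [exact: Sh|exact: subspaceZ].
Qed.

Lemma wstep_wvec M k a l (v : M) : wvec l v ->
  wstep k a v = ((k%:~R - a%:~R)^-1 * (l%:~R - a%:~R)) *: v.
Proof. by move=> lv; rewrite /wstep lv -scalerBl scalerA. Qed.

(** On a vector of weight [k] every interpolation factor is 1; on another weight [l] the factor at
    [l] is 0, provided [l] is in the range. *)
Lemma wproj_wvec M N k l (v : M) : wvec l v -> (k == l) || (`|l| <= N)%N ->
  wproj N k v = if k == l then v else 0.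
Proof.
case: eqVneq => [<- lv _|kl lv /= lN].
  rewrite /wproj; have : all (fun a => a != k) [seq a <- irange N | a != k] by exact: filter_all.
  elim: [seq _ <- _ | _] => [//|a s IH] /= /andP[ak /IH ->].
  by rewrite (wstep_wvec _ _ lv) mulVf ?scale1r // subr_eq0 eqr_int eq_sym.
have : l \in [seq a <- irange N | a != k].
  by rewrite mem_filter eq_sym kl mem_irange.
rewrite /wproj; elim: [seq _ <- _ | _] => [//|a s IH]; rewrite inE => /predU1P[<-|/IH E] /=.
  rewrite -/(wproj _ _ _).
  have w0 : wvec l (foldr (wstep k) v s).
    elim: s {IH} => [//|b s IH] /=; rewrite (wstep_wvec _ _ IH) /wvec.
    by rewrite (linZ (@act_linear K M sl2_h 0)) IH !scalerA mulrC.
  by rewrite (wstep_wvec _ _ w0) subrr mulr0 scale0r.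
by rewrite E /wstep linear0 scaler0 subrr scaler0.
Qed.

Definition wt N M : Prop :=
  forall v : M, span [set u | exists2 k : int, (`|k| <= N)%N & wvec k u] v.

Lemma wt_wproj N M k (v : M) : wt N M -> wvec k (wproj N k v).
Proof.
move=> wM; have lp := @wproj_linear M N k.
have D := lin_sub (lin_comp (@act_linear K M sl2_h 0) lp) (lin_scale k%:~R lp).
apply: subr0_eq; move: (wM v).
apply: (span_min (S := subspace_ker D)) => u [l lN lu].
change (act sl2_h 0 (wproj N k u) - k%:~R *: wproj N k u = 0).
rewrite (wproj_wvec lu) ?lN ?orbT //; case: eqP => [->|_]; first by rewrite lu subrr.
by rewrite linear0 scaler0 subrr.
Qed.

Lemma wt_big N M k (v : M) : wt N M -> wvec k v -> (N < `|k|)%N -> v = 0.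
Proof.
move=> wM kv Nk; have <- : wproj N k v = v by rewrite (wproj_wvec kv) eqxx.
move: (wM v); apply: (span_min (S := subspace_ker (@wproj_linear M N k))) => u [l lN lu] /=.
rewrite (wproj_wvec lu) ?lN ?orbT //; case: eqP => // kl.
by move: lN; rewrite -kl leqNgt Nk.
Qed.

Lemma wvec_hom M Q (f : M -> Q) k v : linear f -> (forall a r u, f (act a r u) = act a r (f u)) ->
  wvec k v -> wvec k (f v).
Proof. by move=> lf af kv; rewrite /wvec -af kv (linZ lf). Qed.

Lemma wvec_component M k r (v : M) : wvec k v -> wvec k (component r v).
Proof.
move=> kv; have := component_act r sl2_h 0 v; rewrite subr0 /wvec => <-.
by rewrite kv (linZ (@component_linear K M r)).
Qed.

Lemma wvec_x M k r (v : M) : wvec k v -> wvec (k + 2) (act sl2_x r v).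
Proof.
move=> kv; have := act_bracket sl2_h sl2_x 0 r v; rewrite add0n sl2_hx.
rewrite (linZ (@act_linearl K M r v)) kv (linZ (@act_linear K M sl2_x r)) => /eqP.
rewrite eq_sym subr_eq => /eqP; rewrite /wvec => ->.
by rewrite -scalerDl intrD addrC.
Qed.

Lemma wvec_y M k r (v : M) : wvec k v -> wvec (k - 2) (act sl2_y r v).
Proof.
move=> kv; rewrite /wvec act_hy kv (linZ (@act_linear K M sl2_y r)) add0n.
by rewrite -scalerBl intrB.
Qed.

Lemma wt_tensor N N' M Q : wt N M -> wt N' Q -> wt (N + N') (tensorRep M Q).
Proof.
move=> wM wQ; rewrite /wt; set A := span _; apply: (tensor_ind (S := A)) => v v'.
move: (wM v); apply: (span_min (S := preim_subspace (tens_linearl v') A)) => u [k kN ku].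
move: (wQ v'); apply: (span_min (S := preim_subspace (tens_linear u) A)) => u' [k' kN' ku'].
apply: span_gen; exists (k + k'); first by lia.
by rewrite /wvec act_tens ku ku' (linZ (tens_linearl _)) (linZ (tens_linear _)) -scalerDl intrD.
Qed.

Lemma wt_psum N M (I : choiceType) (d : I -> int) : wt N M -> wt N (psum M d).
Proof.
move=> wM; rewrite /wt; set A := span _; apply: (psum_ind (S := A)) => i v.
move: (wM v); apply: (span_min (S := preim_subspace (pinj_linear d i) A)) => u [k kN ku].
apply: span_gen; exists k => //; apply: wvec_hom ku; first exact: pinj_linear.
exact: pinj_act.
Qed.

(** The projector is a polynomial in h, so it respects every graph [R]. *)
Lemma layer_wproj M P (F F' : gradedSub M) (R : M -> P -> Prop) N k v p :
  is_layer F F' R -> R v p -> R (wproj N k v) (wproj N k p).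
Proof.
move=> RL Rvp; rewrite /wproj; elim: [seq _ <- _ | _] => [//|a s IH] /=.
apply: (layerZ RL); apply: (layerB RL); first exact: (layer_act RL).
exact: (layerZ RL).
Qed.

Definition bounded_below M (p0 : int) : Prop := forall p, p < p0 -> forall v, grade M p v -> v = 0.

Lemma bounded_tensor M Q p q : bounded_below M p -> bounded_below Q q ->
  bounded_below (tensorRep M Q) (p + q).
Proof.
move=> bM bQ r rpq t; apply: (span_min (S := gsub0 _)) => _ [i [j [v [w [Mv Qw ij ->]]]]].
change (tens v w = 0); have [ip|pi] := ltP i p.
  by rewrite (bM _ ip _ Mv) (lin0 (tens_linearl _)).
have jq : j < q by rewrite ltNge; apply/negP => qj; move: rpq; rewrite -ij ltNge lerD.
by rewrite (bQ _ jq _ Qw) (lin0 (tens_linear _)).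
Qed.

End Weights.

(** * W(n) as a retract of the symmetric algebra *)

Section WeylModel.
Variable K : numFieldType.
Notation F := (fockRep K).
Notation fw := (fw K).

Definition word_weight (u : seq letter) : int := \sum_(l <- u) (if l.1 == 0 then 1 else -1).

Lemma fw_wvec u : wvec (word_weight u) (fw u).
Proof.
rewrite /word_weight; elim: u => [|l u IH].
  by rewrite big_nil /wvec scale0r; exact: act_fock_nil.
rewrite big_cons /wvec act_fw IH (linZ (create_linear l)) create_fw intrD scalerDl.
congr (_ + _); have [[i ->]|[i ->]] := letterP l; rewrite ?letter_act_ha ?letter_act_hb addn0 /=.
  by rewrite scale1r.
by rewrite scaleN1r.
Qed.

Lemma word_weight_size u : (`|word_weight u| <= size u)%N.
Proof.
rewrite /word_weight; elim: u => [|l u IH]; first by rewrite big_nil.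
have H (x : int) k : (`|x| <= k)%N -> (absz (1 + x)%R <= k.+1)%N by lia.
have H' (x : int) k : (`|x| <= k)%N -> (absz (-1 + x)%R <= k.+1)%N by lia.
by rewrite big_cons; case: eqP => _; [exact: H|exact: H'].
Qed.

(** [q] first projects to degree [n]; being defined on the whole symmetric algebra, it spares a
    separate module for the symmetric power. *)
Lemma weyl_model n : exists (p : weyl K n -> F) (q : F -> weyl K n),
  [/\ rep_hom p, rep_hom q, p (weyl_gen K n) = vac K n, cancel p q
    & forall x, fdeg K n x -> p (q x) = x].
Proof.
have [p [hp pw pi pf]] := weyl_fock K n; have [lp ap gp] := hp.
have qx x : exists v, p v = fsize n x by apply/pf; exact: fdeg_fsize.
pose q x := projT1 (cid (qx x)); have pq x : p (q x) = fsize n x by rewrite /q; case: cid.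
have [lf af gf] := fsize_hom K n.
exists p, q; split=> //.
- split=> [c u v|a r v|r v Fv].
  + by apply: pi; rewrite lp !pq lf.
  + by apply: pi; rewrite ap !pq af.
  + by apply: component_grade; apply: pi; rewrite (hom_component hp) pq grade_component_id //; exact: gf.
- move=> v; apply: pi; rewrite pq (fsize_fdeg n (m := n)) ?eqxx //.
  by apply/pf; exists v.
- by move=> x nx; rewrite pq (fsize_fdeg n nx) eqxx.
Qed.

Lemma weyl_model_sig n : {pq : (weyl K n -> F) * (F -> weyl K n) |
  [/\ rep_hom pq.1, rep_hom pq.2, pq.1 (weyl_gen K n) = vac K n, cancel pq.1 pq.2
    & forall x, fdeg K n x -> pq.1 (pq.2 x) = x]}.
Proof. by apply: cid; have [p [q pqP]] := weyl_model n; exists (p, q). Qed.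

Definition emb n : weyl K n -> F := (sval (weyl_model_sig n)).1.
Definition ret n : F -> weyl K n := (sval (weyl_model_sig n)).2.

Lemma emb_retP n : [/\ rep_hom (@emb n), rep_hom (ret n), emb (weyl_gen K n) = vac K n,
  cancel (@emb n) (ret n) & forall x, fdeg K n x -> emb (ret n x) = x].
Proof. exact: svalP (weyl_model_sig n). Qed.

Lemma emb_linear n : linear (@emb n). Proof. by have [[]] := emb_retP n. Qed.
Lemma ret_linear n : linear (ret n). Proof. by have [_ []] := emb_retP n. Qed.
Lemma emb_act n a r v : @emb n (act a r v) = act a r (emb v).
Proof. by have [[]] := emb_retP n. Qed.
Lemma ret_act n a r v : ret n (act a r v) = act a r (ret n v).
Proof. by have [_ []] := emb_retP n. Qed.
Lemma emb_gen n : emb (weyl_gen K n) = vac K n. Proof. by have [] := emb_retP n. Qed.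
Lemma embK n : cancel (@emb n) (ret n). Proof. by have [] := emb_retP n. Qed.
Lemma retK n x : fdeg K n x -> emb (ret n x) = x. Proof. by have [_ _ _ _ h] := emb_retP n; exact: h. Qed.
Lemma ret_vac n : ret n (vac K n) = weyl_gen K n. Proof. by rewrite -emb_gen embK. Qed.

Lemma vac_fdeg n : fdeg K n (vac K n).
Proof. by rewrite -[X in fdeg K X](size_nseq n (la 0)); exact: fdeg_word. Qed.

Lemma emb_fdeg n (v : weyl K n) : fdeg K n (emb v).
Proof.
move: v; apply: (weyl_generated (S := preim_subspace (@emb_linear n) (fdeg K n))) => [|a r v] /=.
  by rewrite emb_gen; exact: vac_fdeg.
by rewrite emb_act; exact: fdeg_act.
Qed.

Lemma vac_neq0 n : vac K n != 0.
Proof.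
(* The linear form with value 1 on every word respects the swaps and separates the vacuum from 0. *)
pose f (u : seq letter) : K^o := 1.
have sw u v (k l : letter) : f (u ++ k :: l :: v) = f (u ++ l :: k :: v) by [].
apply/eqP => v0; have := fock_lift_word sw (nseq n (la 0)).
rewrite -[fword _ _]/(vac K n) v0 (lin0 (fock_lift_linear sw)) => /eqP.
by rewrite eq_sym oner_eq0.
Qed.

Lemma weyl_gen_neq0 n : weyl_gen K n != 0.
Proof.
apply: contra_neq (vac_neq0 n) => w0; by rewrite -emb_gen w0; exact: (lin0 (@emb_linear n)).
Qed.

Lemma weyl_wt n : wt n (weyl K n).
Proof.
move=> v; rewrite -(embK v); set A := span _; move: (emb_fdeg v).
apply: (span_min (S := preim_subspace (@ret_linear n) A)) => _ [u su ->].
apply: span_gen; exists (word_weight u); first by rewrite -su; exact: word_weight_size.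
by apply: wvec_hom (fw_wvec u); [exact: ret_linear|exact: ret_act].
Qed.

Lemma vec_wt : wt 1 (vecRep K).
Proof.
rewrite /wt; set A := span _; apply: (vec_ind (S := A)) => l; apply: span_gen.
exists (word_weight [:: l]); first exact: (word_weight_size [:: l]).
rewrite /word_weight big_seq1 /wvec act_vgen.
have [[i ->]|[i ->]] := letterP l; rewrite ?letter_act_ha ?letter_act_hb addn0 /=.
  by rewrite scale1r.
by rewrite scaleN1r.
Qed.

Lemma fock_bounded : bounded_below F 0.
Proof.
move=> p p0 v; apply: (span_min (S := gsub0 F)) => x [u up _].
by move: p0; rewrite -up.
Qed.

Lemma weyl_bounded n : bounded_below (weyl K n) 0.
Proof.
move=> p p0 v Wv; have [[_ _ gp] _ _ pi _] := emb_retP n.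
by apply: (can_inj pi); rewrite (lin0 (@emb_linear n)); exact: fock_bounded p0 _ (gp _ _ Wv).
Qed.

Lemma vec_bounded : bounded_below (vecRep K) 0.
Proof.
move=> p p0 v; apply: (span_min (S := gsub0 (vecRep K))) => x [l lp _].
by move: p0; rewrite -lp.
Qed.

Lemma top_word (u : seq letter) : wdeg u = 0%N -> word_weight u = size u -> u = nseq (size u) (la 0).
Proof.
elim: u => [//|l u IH]; rewrite wdeg_cons /word_weight big_cons -/(word_weight u) /=.
have := word_weight_size u => wu /eqP; rewrite addn_eq0 => /andP[/eqP l0 /eqP u0].
have [[i E]|[i E]] := letterP l; rewrite E /= => sw; last by lia.
by rewrite -IH //; [move: l0; rewrite E /= => ->|lia].
Qed.

(** Weight [n] and degree 0 leave only the vacuum monomial. This is why endomorphisms of W(n) of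
    degree 0 are scalars. *)
Lemma weyl_top n (v : weyl K n) : wvec n v -> grade (weyl K n) 0 v ->
  exists c, v = c *: weyl_gen K n.
Proof.
move=> wv Wv; have [[lp ap gp] _ pg pi _] := emb_retP n.
suff [c E] : exists c, emb v = c *: vac K n.
  by exists c; apply: (can_inj pi); rewrite E (linZ lp) pg.
have [S SE] := line_subspace (vac K n); apply/SE.
pose T (x : F) : F := wproj n n (fsize n x).
have lT : linear T := lin_comp (@wproj_linear K F n n) (@fsize_linear K n).
have TE : T (emb v) = emb v.
  rewrite /T (fsize_fdeg n (emb_fdeg v)) eqxx.
  by rewrite (wproj_wvec (l := n)) ?eqxx //; exact: wvec_hom.
rewrite -TE; move: (gp _ _ Wv).
apply: (span_min (S := preim_subspace lT S)) => _ [u [u0] ->]; change (S (T (fw u))); rewrite /T.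
rewrite fsize_word; case: eqP => [su|_]; last by rewrite (lin0 (@wproj_linear K F n n)); exact: subspace0.
rewrite (wproj_wvec (fw_wvec u)); last by rewrite -su word_weight_size orbT.
case: eqP => [wu|_]; last exact: subspace0.
apply/SE; exists 1; rewrite scale1r; congr (fw _).
by rewrite -su; apply: top_word; [case: u0|rewrite -wu su].
Qed.

End WeylModel.

(** * The tensor product with C^2[t] *)

Lemma rep_hom_inv (K : fieldType) (M N : gradedRep K) (f : M -> N) : rep_hom f -> injective f ->
  (forall y, exists x, f x = y) -> exists g : N -> M, [/\ rep_hom g, cancel f g & cancel g f].
Proof.
move=> hf fi fs; have [lf af gf] := hf.
pose g y := projT1 (cid (fs y)); have fg : cancel g f by move=> y; rewrite /g; case: cid.
have gf' : cancel f g by move=> x; apply: fi; rewrite fg.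
exists g; split=> //; split=> [c u v|a r v|r v Nv]; first by apply: fi; rewrite lf !fg.
  by apply: fi; rewrite af !fg.
by apply: component_grade; apply: fi; rewrite (hom_component hf) fg grade_component_id.
Qed.

Lemma quot_hom (K : fieldType) (M : gradedRep K) (S : gradedSub M) :
  rep_hom (fun v => vpi v : quotRep S).
Proof.
split=> [|a r v|r v Mv]; first exact: vpi_linear.
  by rewrite -quot_act_pi.
by exists v.
Qed.

Lemma sum_pad (V : nmodType) (G : nat -> V) a b :
  (forall i, (a <= i < a + b)%N -> G i = 0) -> \sum_(i < a + b) G i = \sum_(i < a) G i.
Proof.
move=> G0; rewrite big_split_ord /= [X in _ + X]big1 ?addr0 // => i _.
by rewrite G0 // leq_addr ltn_add2l ltn_ord.
Qed.

Lemma rep_hom_linear (K : fieldType) (M N : gradedRep K) (f : M -> N) : rep_hom f -> linear f.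
Proof. by case. Qed.

Section ImSub.
Variables (K : fieldType) (M N : gradedRep K) (f : M -> N) (hf : rep_hom f).

Definition im_space : subspace N := im_subspace (rep_hom_linear hf) (full M).

Fact im_act a r v : im_space v -> im_space (act a r v).
Proof. by case=> u _ ->; exists (act a r u) => //; case: hf. Qed.
Fact im_component r v : im_space v -> im_space (component r v).
Proof. by case=> u _ ->; exists (component r u) => //; rewrite (hom_component hf). Qed.

Definition im_sub : gradedSub N := GradedSub im_act im_component.
End ImSub.

Lemma im_subP (K : fieldType) (M N : gradedRep K) (f : M -> N) (hf : rep_hom f) y :
  im_sub hf y <-> exists x, f x = y.
Proof. by split=> [[x _ ->]|[x <-]]; [exists x|exists x]. Qed.

Lemma layer_of_mono (K : fieldType) (M P : gradedRep K) (f : P -> M) (hf : rep_hom f) :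
  injective f -> layer P (im_sub hf) (gsub0 M).
Proof.
move=> fi; have [lf af _] := hf; exists (fun v p => f p = v); split.
- by move=> c u v p q <- <-; rewrite lf.
- by move=> v p <-; apply/im_subP; exists p.
- by move=> v /im_subP[p <-]; exists p.
- by move=> p; exists (f p).
- by move=> a r v p <-; rewrite af.
- by move=> r v p <-; rewrite (hom_component hf).
- by move=> p; rewrite -(lin0 lf) => /fi.
- by move=> v; rewrite (lin0 lf); split=> [->|<-].
Qed.

Section WeylVec.
Variables (K : numFieldType) (n : nat).
Notation F := (fockRep K).
Notation fw := (fw K).
Notation V := (vecRep K).
Notation W := (weyl K n).
Notation w := (weyl_gen K n).
Notation X := (tensorRep W V).
Notation vgen := (vgen K).

Section Coordinates.

Fact vcoord_l k x : linear (fun v : W => coord k x *: emb v).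
Proof. by apply: lin_scale; exact: emb_linear. Qed.
Fact vcoord_r k v : linear (fun x : V => coord k x *: emb (v : W)).
Proof. by move=> c x y; rewrite coord_linear scalerDl scalerA. Qed.

(** The coefficient of the basis vector [k] of V, taken in the symmetric algebra so that derivatives
    apply to it. *)
Definition vcoord (k : letter) : X -> F := tensor_lift (fun (v : W) (x : V) => coord k x *: emb v).

Lemma vcoord_linear k : linear (vcoord k).
Proof. exact: tensor_lift_linear (vcoord_l k) (vcoord_r k). Qed.

Lemma vcoord_tens k v x : vcoord k (tens v x) = coord k x *: emb v.
Proof. exact: tensor_liftE (vcoord_l k) (vcoord_r k) v x. Qed.

Lemma vcoord_fin t : finite_set [set k | vcoord k t != 0].
Proof.
have [S SE] : exists S : subspace X, forall t, S t <-> finite_set [set k | vcoord k t != 0].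
  apply: subspace_of => [|c u v fu fv].
    rewrite (_ : mkset _ = set0) //; apply/seteqP; split=> r //=.
    by rewrite (lin0 (vcoord_linear r)) eqxx.
  have [s [_ u0 v0]] := finsupp2 fu fv; apply: (finsupp_of_seq (s := s)) => k ks.
  by rewrite vcoord_linear u0 // v0 // scaler0 addr0.
apply/SE; move: t; apply: tensor_ind => v x; apply/SE.
apply: sub_finite_set (dsum_fin x) => k /=; rewrite vcoord_tens /coord.
by apply: contra_neq => ->; rewrite scale0r.
Qed.

Lemma vcoord_sep t : (forall k, vcoord k t = 0) -> t = 0.
Proof.
pose G k t := tens (ret n (vcoord k t)) (vgen k) : X.
have lG k : linear (G k).
  exact: lin_comp (tens_linearl (vgen k)) (lin_comp (@ret_linear K n) (vcoord_linear k)).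
have fG u : finite_set [set k | G k u != 0].
  apply: sub_finite_set (vcoord_fin u) => k /=; apply: contra_neq; rewrite /G => ->.
  by rewrite (lin0 (@ret_linear K n)) (lin0 (tens_linearl _)).
have lS : linear (fun u => \sum_(k \in [set: letter]) G k u) by exact: fsum_linear.
move=> t0; have -> : t = \sum_(k \in [set: letter]) G k t; last first.
  rewrite (fsumE (s := [::])) ?big_nil // => k _; rewrite /G t0.
  by rewrite (lin0 (@ret_linear K n)) (lin0 (tens_linearl _)).
move: t {t0}; apply: (tensor_ext (@lin_id K X) lS) => v x.
have [s us xs] := finsupp_seq (dsum_fin x).
have xs0 k : k \notin s -> coord k x = 0.
  by move=> /xs /= /negP; rewrite negbK => /eqP.
rewrite (fsumE us) => [|k ks]; last first.
  rewrite /G vcoord_tens (xs0 _ ks) scale0r.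
  by rewrite (lin0 (@ret_linear K n)) (lin0 (tens_linearl _)).
rewrite [x in LHS](free_sum x) /free_lift (fsumE us) => [|k /xs0 E]; last first.
  by rewrite -/(coord k x) E scale0r.
rewrite (lin_sum _ _ (tens_linear v)); apply: eq_bigr => k _.
transitivity (coord k x *: tens v (vgen k)); first exact: (linZ (tens_linear v)).
have -> : G k (tens v x) = tens (coord k x *: v) (vgen k).
  by rewrite /G vcoord_tens; congr tens; rewrite (linZ (@ret_linear K n)); congr (_ *: _); exact: embK.
exact/esym/(linZ (tens_linearl (vgen k)) (coord k x) v).
Qed.

Definition vcoord_sub (k : letter) (r : nat) (t : X) : F :=
  if (r <= k.2)%N then vcoord (k.1, (k.2 - r)%N) t else 0.

Lemma coord_act k a r (x : V) : coord k (act a r x) =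
  \sum_(q < 2) sl2_mx a k.1 q * (if (r <= k.2)%N then coord (q, (k.2 - r)%N) x else 0).
Proof.
pose f (x : V) : K^o := coord k (act a r x).
pose g (x : V) : K^o :=
  \sum_(q < 2) sl2_mx a k.1 q * (if (r <= k.2)%N then coord (q, (k.2 - r)%N) x else 0).
have lf : linear f by move=> c u v; rewrite /f (@act_linear K V a r c u v) coord_linear.
have lg : linear g.
  move=> c u v; rewrite /g scaler_sumr -big_split; apply: eq_bigr => q _ /=.
  case: ifP => _; last by rewrite !mulr0 scaler0 addr0.
  by rewrite mulrDr; congr (_ + _); exact: mulrCA.
rewrite -[LHS]/(f x) -[RHS]/(g x); move: x; apply: (letters_ext lf lg) => l.
have El : act a r (vgen l) = sl2_mx a 0 l.1 *: vgen (la (l.2 + r)%N) +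
    sl2_mx a 1 l.1 *: vgen (lb (l.2 + r)%N) by rewrite act_vgen letter_act2.
rewrite /f /g -[lgen K l]/(vgen l) El.
rewrite (coord_linear k) [coord _ (_ *: _)](_ : _ = sl2_mx a 1 l.1 * coord k (vgen (lb (l.2 + r)))) //.
have E (p q : 'I_2) (m m' : nat) : coord (p, m) (vgen (q, m')) = ((p == q) && (m == m'))%:R.
  by rewrite coord_gen xpair_eqE.
rewrite big_ord_recl big_ord1 (_ : lift ord0 ord0 = 1); last exact: val_inj.
case: k {lf lg f g} => p m; case: l {El} => [q m'] /=; rewrite /la /lb !E.
have [rm|rm] := leqP r m; last first.
  rewrite !mulr0 addr0 (_ : (m == _) = false) ?andbF ?mulr0 ?addr0 //.
  by apply/negbTE; rewrite neq_ltn (leq_trans rm) // leq_addl.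
rewrite (_ : (m - r == m')%N = (m == m' + r)%N); last by apply/eqP/eqP; lia.
case: (m == _)%N; rewrite ?andbF ?andbT ?mulr0 //.
have [[i [-> _]]|[i [-> _]]] := letterP (p, 0%N); have [[j [-> _]]|[j [-> _]]] := letterP (q, 0%N).
all: by rewrite /= ?mulr1 ?mulr0 ?addr0 ?add0r.
Qed.

Lemma vcoord_act k a r t : vcoord k (act a r t) =
  act a r (vcoord k t) + \sum_(q < 2) sl2_mx a k.1 q *: vcoord_sub (q, k.2) r t.
Proof.
have la := @act_linear K X a r; have laF := @act_linear K F a r.
have lk := vcoord_linear k.
have ls : linear (fun t => \sum_(q < 2) sl2_mx a k.1 q *: vcoord_sub (q, k.2) r t).
  move=> c u v; rewrite scaler_sumr -big_split; apply: eq_bigr => q _ /=.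
  rewrite /vcoord_sub /=; case: ifP => _; last by rewrite !scaler0 addr0.
  by rewrite vcoord_linear scalerDr !scalerA mulrC.
move: t; apply: (tensor_ext (lin_comp lk la) (lin_add (lin_comp laF lk) ls)) => v x.
change (vcoord k (act a r (tens v x : X)) = act a r (vcoord k (tens v x))
  + \sum_(q < 2) sl2_mx a k.1 q *: vcoord_sub (q, k.2) r (tens v x)).
rewrite act_tens (linD lk) !vcoord_tens (linZ laF) emb_act coord_act scaler_suml.
congr (_ + _); apply: eq_bigr => q _; rewrite -scalerA; congr (_ *: _).
by rewrite /vcoord_sub /=; case: ifP => _; rewrite ?scale0r ?vcoord_tens.
Qed.
End Coordinates.

(** * The symplectic contraction *)

Section Contraction.
Notation e0 := (0 : 'I_2).
Notation e1 := (1 : 'I_2).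

(* The t^p-component of the map W (x) C^2[t] -> W' (x) C[t] that contracts one factor of W
   with C^2[t] by the symplectic form of C^2. *)
Definition contract (p : nat) (t : X) : F :=
  \sum_(i < p.+1) (ann (e0, i : nat) (vcoord (e1, (p - i)%N) t)
                 - ann (e1, i : nat) (vcoord (e0, (p - i)%N) t)).

Lemma contract_linear p : linear (contract p).
Proof.
move=> c u v; rewrite /contract scaler_sumr -big_split; apply: eq_bigr => i _ /=.
by rewrite !vcoord_linear !(@ann_linear K) scalerBr opprD addrACA.
Qed.

(** Multiplication by t^r on either factor reduces the contraction sum to the one for p - r: here
    the [r] smallest indices drop out, in [shiftr] the [r] largest. *)
Let shiftl x y r p t : \sum_(i < p.+1) ann_sub (x, i : nat) r (vcoord (y, (p - i)%N) t) =
  \sum_(i < (p - r).+1) (if (r <= p)%N then ann (x, i : nat) (vcoord (y, (p - r - i)%N) t) else 0).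
Proof.
have [rp|pr] := leqP r p; last first.
  rewrite !big1 // => i _; rewrite /ann_sub /= leqNgt (leq_trans _ pr) //.
have E : p.+1 = (r + (p - r).+1)%N by rewrite addnS subnKC.
rewrite E big_split_ord /= big1 ?add0r => [|i _]; last first.
  by rewrite /ann_sub /= leqNgt ltn_ord.
by apply: eq_bigr => i _; rewrite /ann_sub /= leq_addr addKn subnDA.
Qed.

Let shiftr x y r p t : \sum_(i < p.+1) ann (x, i : nat) (vcoord_sub (y, (p - i)%N) r t) =
  \sum_(i < (p - r).+1) (if (r <= p)%N then ann (x, i : nat) (vcoord (y, (p - r - i)%N) t) else 0).
Proof.
have la k := @ann_linear K k.
have [rp|pr] := leqP r p; last first.
  rewrite !big1 // => i _; rewrite /vcoord_sub /= (_ : (r <= _)%N = false) ?(lin0 (la _)) //.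
  by apply/negbTE; lia.
have E : p.+1 = ((p - r).+1 + r)%N by rewrite addSn subnK.
rewrite E (sum_pad (G := fun i => ann (x, i) (vcoord_sub (y, (p - i)%N) r t))) => [|i pri].
  apply: eq_bigr => i _; rewrite /vcoord_sub /= (_ : (r <= _)%N); last first.
    by have := ltn_ord i; lia.
  by rewrite (_ : (p - i - r)%N = (p - r - i)%N) //; lia.
by rewrite /vcoord_sub /= (_ : (r <= _)%N = false) ?(lin0 (la _)) //; apply/negbTE; lia.
Qed.

(** The correction terms of the two factors are brought to common sums [E x y], and they cancel
    because the symplectic form is invariant under traceless matrices. *)
Lemma contract_act p a r t : contract p (act a r t) = act a r (contract p t).
Proof.
have la k := @ann_linear K k; have laF := @act_linear K F a r.
pose E x y := \sum_(i < (p - r).+1)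
  (if (r <= p)%N then ann (x, i : nat) (vcoord (y, (p - r - i)%N) t) else 0).
have half x y : \sum_(i < p.+1) ann (x, i : nat) (vcoord (y, (p - i)%N) (act a r t)) =
    act a r (\sum_(i < p.+1) ann (x, i : nat) (vcoord (y, (p - i)%N) t) : F) +
    (\sum_(q < 2) sl2_mx a x q *: E q y + \sum_(q < 2) sl2_mx a y q *: E x q).
  have tm (i : nat) : ann (x, i) (vcoord (y, (p - i)%N) (act a r t)) =
      fock_act a r (ann (x, i) (vcoord (y, (p - i)%N) t)) +
      (\sum_(q < 2) sl2_mx a x q *: ann_sub (q, i) r (vcoord (y, (p - i)%N) t) +
       \sum_(q < 2) sl2_mx a y q *: ann (x, i) (vcoord_sub (q, (p - i)%N) r t)).
    rewrite vcoord_act (linD (la _)) [ann _ (@act K F a r _)](@ann_act K (x, i) a r) /= -addrA.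
    congr (_ + (_ + _)).
    rewrite (lin_sum _ (fun q => sl2_mx a y q *: vcoord_sub (q, (p - i)%N) r t) (la _)).
    by apply: eq_bigr => q _; rewrite (linZ (la _)).
  under eq_bigr do rewrite tm.
  rewrite big_split /= big_split /=; congr (_ + (_ + _)).
  - exact/esym/(@lin_sum K F F (act a r) _ (index_enum _)
      (fun i : 'I_p.+1 => ann (x, i : nat) (vcoord (y, (p - i)%N) t)) laF).
  - rewrite exchange_big; apply: eq_bigr => q _ /=; rewrite -scaler_sumr; congr (_ *: _).
    exact: shiftl.
  - rewrite exchange_big; apply: eq_bigr => q _ /=; rewrite /E -(shiftr x q r p t) scaler_sumr.
    by [].
pose S x y t : F := \sum_(i < p.+1) ann (x, i : nat) (vcoord (y, (p - i)%N) t).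
have C u : contract p u = S e0 e1 u - S e1 e0 u by exact: sumrB.
have tr : sl2_mx a 0 0 = - sl2_mx a 1 1.
  have := sl2_tr a; rewrite unfold_in /mxtrace big_ord_recl big_ord1 addr_eq0 => /eqP.
  by rewrite (_ : lift ord0 ord0 = 1) //; exact: val_inj.
have s2 (f : 'I_2 -> F) : \sum_(q < 2) f q = f 0 + f 1.
  by rewrite big_ord_recl big_ord1 (_ : lift ord0 ord0 = 1) //; exact: val_inj.
have Sa x y : S x y (act a r t) = act a r (S x y t) +
    (sl2_mx a x 0 *: E 0 y + sl2_mx a x 1 *: E 1 y +
    (sl2_mx a y 0 *: E x 0 + sl2_mx a y 1 *: E x 1)).
  by have := half x y; rewrite !s2; apply.
rewrite (C (act a r t)) (C t) (Sa e0 e1) (Sa e1 e0) (linB laF (S e0 e1 t) (S e1 e0 t)).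
move: (act a r (S e0 e1 t)) (act a r (S e1 e0 t)) => P Q.
rewrite tr !scaleNr; move: (E 0 0) (E 0 1) (E 1 0) (E 1 1) => E00 E01 E10 E11.
rewrite opprD addrACA -[RHS]addr0; congr (_ + _).
move: (_ *: E01) (_ *: E11) (_ *: E00) (_ *: E10) => A B D G.
apply/eqP; rewrite subr_eq0 addrC addrACA -[X in _ == X]addrA.
by rewrite addrA subrK [G + _]addrA subrr add0r.
Qed.
End Contraction.

(** * The submodules W(n+1) of W(n) (x) V and the quotient *)

Section Cartan.

(** The square of y is 0 on V, so at most one factor y lands there. *)
Lemma y0s_tens m (v : W) i : y0s m (tens v (vgen (la i)) : X) =
  tens (y0s m v) (vgen (la i)) + m%:R *: tens (y0s m.-1 v) (vgen (lb i)).
Proof.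
have ya : act sl2_y 0 (vgen (la i)) = vgen (lb i) by rewrite act_vgen letter_act_ya addn0.
have yb : act sl2_y 0 (vgen (lb i)) = 0 by rewrite act_vgen letter_act_yb.
elim: m => [|m IH]; first by rewrite scale0r addr0.
rewrite -[LHS]/(act sl2_y 0 (y0s m (tens v (vgen (la i)) : X))) IH (linD (@act_linear K X sl2_y 0)).
rewrite (linZ (@act_linear K X sl2_y 0)) !act_tens ya yb (lin0 (tens_linear _)) addr0 -addrA.
congr (_ + _); rewrite -[X in X + _]scale1r; case: m {IH} => [|m].
  by rewrite scale0r addr0.
by rewrite -scalerDl nat1r.
Qed.

Lemma cartan_hw i : highest_weight n.+1 (tens w (vgen (la i)) : X).
Proof.
have [wx wh wy] := weyl_gen_hw K n; split=> [r||].
- rewrite act_tens wx act_vgen letter_act_xa.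
  by rewrite (lin0 (tens_linear _)) (lin0 (tens_linearl _)) addr0.
- rewrite act_tens wh act_vgen letter_act_ha addn0 (linZ (tens_linearl _)).
  by rewrite -natr1 scalerDl scale1r.
- have w1 : y0s n.+1 w = 0 by exact: wy.
  have w2 : y0s n.+2 w = 0 by rewrite -[LHS]/(act sl2_y 0 (y0s n.+1 w)) w1 linear0.
  rewrite [LHS](y0s_tens n.+2 w i) w2 w1 (lin0 (tens_linearl _)) (lin0 (tens_linearl _)).
  by rewrite scaler0 addr0.
Qed.

Lemma cartan_grade i : grade X i%:Z (tens w (vgen (la i))).
Proof. by rewrite -[i%:Z]add0r; apply: grade_tens; [exact: (@weyl_gen_grade K n)|exact: (@vgen_grade K (la i))]. Qed.

Let cartan_ex (i : nat) := weyl_hom (cartan_hw i) (@cartan_grade i).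

Definition cartan (i : nat) : weyl K n.+1 -> X := projT1 (cid (cartan_ex i)).

Lemma cartanP i : [/\ linear (cartan i), cartan i (weyl_gen K n.+1) = tens w (vgen (la i)),
    forall a r v, cartan i (act a r v) = act a r (cartan i v)
    & forall r v, grade (weyl K n.+1) r v -> grade X (r + i%:Z) (cartan i v)].
Proof. by rewrite /cartan; case: cid. Qed.

Lemma cartan_linear i : linear (cartan i). Proof. by have [] := cartanP i. Qed.
Lemma cartan_act i a r v : cartan i (act a r v) = act a r (cartan i v).
Proof. by have [] := cartanP i. Qed.
Lemma cartan_gen i : cartan i (weyl_gen K n.+1) = tens w (vgen (la i)).
Proof. by have [] := cartanP i. Qed.

Lemma ann_sub_sub q m r i (f : fock_space K) :
  (if (r <= m)%N then ann_sub (q, (m - r)%N) i f else 0) =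
  (if (i <= m)%N then ann_sub (q, (m - i)%N) r f else 0).
Proof.
rewrite /ann_sub /=; case: (leqP r m) => rm; case: (leqP i m) => im //.
- have -> : (i <= m - r)%N = (r <= m - i)%N by lia.
  by rewrite -!subnDA addnC.
- by rewrite leqNgt (_ : (_ < _)%N) //; lia.
- by rewrite leqNgt (_ : (_ < _)%N) //; lia.
Qed.

Lemma ann_nseq k l m : ann k (fw (nseq m l)) = (m%:R * (l == k)%:R) *: fw (nseq m.-1 l).
Proof.
elim: m => [|m IH]; first by rewrite mul0r scale0r; exact: ann_nil.
rewrite -[fw (nseq m.+1 l)]/(fw (l :: nseq m l)) -create_fw ann_create IH.
rewrite (linZ (create_linear l)) create_fw -nat1r mulrDl mul1r scalerDl /=; congr (_ + _).
by case: m {IH} => [|m //]; rewrite !mul0r !scale0r.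
Qed.

Lemma ann_la1_la0 k j m : ann k (fw (nseq j (la 1) ++ nseq m (la 0))) =
  (j%:R * (la 1 == k)%:R) *: fw (nseq j.-1 (la 1) ++ nseq m (la 0)) +
  (m%:R * (la 0 == k)%:R) *: fw (nseq j (la 1) ++ nseq m.-1 (la 0)).
Proof.
elim: j => [|j IH]; first by rewrite mul0r scale0r add0r; exact: ann_nseq.
rewrite -[fw (nseq j.+1 _ ++ _)]/(fw (la 1 :: (nseq j (la 1) ++ nseq m (la 0)))).
rewrite -create_fw ann_create IH (linD (create_linear _)) !(linZ (create_linear _)) !create_fw.
rewrite addrA -nat1r mulrDl mul1r scalerDl /=; congr (_ + _ + _).
by case: j {IH} => [|j //]; rewrite !mul0r !scale0r.
Qed.

(** This identifies [cartan i] with polarisation: f goes to the sum over letters l of df/dl (x) t^i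
    l, divided by n + 1 to fit the value on the generator. *)
Lemma vcoord_cartan k i v : vcoord k (cartan i v) = n.+1%:R^-1 *: ann_sub k i (emb v).
Proof.
have lE := @emb_linear K n.+1.
have lL k' : linear (fun v => vcoord k' (cartan i v)).
  exact: lin_comp (vcoord_linear k') (cartan_linear i).
have lR k' : linear (fun v => n.+1%:R^-1 *: ann_sub k' i (emb (v : weyl K n.+1))).
  by apply: lin_scale; exact: lin_comp (@ann_sub_linear K k' i) lE.
have [S SE] : exists S : subspace (weyl K n.+1), forall v, S v <->
    forall k, vcoord k (cartan i v) = n.+1%:R^-1 *: ann_sub k i (emb v).
  apply: subspace_of => [k'|c u u' Su Su' k']; first by rewrite (lin0 (lL k')) (lin0 (lR k')).
  by rewrite (lL k') (lR k') Su Su'.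
suff /SE : S v by [].
move: v; apply: weyl_generated => [|a r v /SE IH]; apply/SE => k'.
  rewrite cartan_gen vcoord_tens !emb_gen /ann_sub; case: (leqP i k'.2) => ik.
    rewrite ann_nseq scalerA mulrA mulVf ?pnatr_eq0 // mul1r /=; congr (_ *: _).
    rewrite coord_gen; case: k' ik => q m /= im; rewrite /la !xpair_eqE eq_sym.
    by congr (_ %:R); congr (nat_of_bool (_ && _)); apply/eqP/eqP; lia.
  rewrite scaler0 coord_gen (_ : _ == _ = false) ?scale0r //.
  by apply/negbTE/eqP => E; move: ik; rewrite E /= ltnn.
rewrite cartan_act vcoord_act IH emb_act.
have -> : ann_sub k' i (act a r (emb v)) = act a r (ann_sub k' i (emb v) : F) +
    \sum_(q < 2) sl2_mx a k'.1 q *: (if (i <= k'.2)%N then ann_sub (q, (k'.2 - i)%N) r (emb v) else 0).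
  rewrite /ann_sub; case: (leqP i k'.2) => ik; first by rewrite [LHS](@ann_act K).
  rewrite (lin0 (@act_linear K F a r)) big1 ?addr0 // => q _; exact: scaler0.
rewrite scalerDr; congr (_ + _); first exact: (linZ (@act_linear K F a r)).
rewrite scaler_sumr; apply: eq_bigr => q _; rewrite scalerA mulrC -scalerA; congr (_ *: _).
rewrite -ann_sub_sub /vcoord_sub /=; case: ifP => _; first exact: IH.
by rewrite scaler0.
Qed.

(** The image of the generator involves only e_0, on which the alternating form vanishes;
    equivariance does the rest. *)
Lemma contract_cartan p i v : contract p (cartan i v) = 0.
Proof.
have lz := @lin_cst0 K (weyl K n.+1) F.
move: v; apply: (weyl_ext (T := fun a r (f : F) => act a r f)
  (lin_comp (contract_linear p) (cartan_linear i)) lz) => [a r v|a r v|] /=.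
- by rewrite cartan_act; exact: contract_act.
- exact/esym/(lin0 (@act_linear K F a r)).
rewrite cartan_gen /contract big1 // => j _; rewrite !vcoord_tens !coord_gen emb_gen.
have E1 m : ((1 : 'I_2, m) == la i) = false by rewrite xpair_eqE.
have E2 m : (la 0 == (1 : 'I_2, m)) = false by rewrite xpair_eqE.
rewrite E1 scale0r (linZ (@ann_linear K _)) !ann_nseq E2.
by rewrite mulr0 scale0r scaler0 (lin0 (@ann_linear K _)) subrr.
Qed.

Definition cartan_sum : wsum K n.+1 (fun i : 'I_n.+1 => (i : nat)%:Z) -> X :=
  plsum (fun i : 'I_n.+1 => cartan i).

Lemma cartan_sum_hom : rep_hom cartan_sum.
Proof.
by apply: plsum_hom => [i|i|i]; [exact: cartan_linear|exact: cartan_act|have [] := cartanP i].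
Qed.

Lemma cartan_sumE u : cartan_sum u = \sum_(i < n.+1) cartan i (pfun i u).
Proof.
rewrite /cartan_sum /plsum (fsumE (s := enum 'I_n.+1)) ?enum_uniq ?big_enum //.
by move=> i; rewrite mem_enum.
Qed.

(** In coordinates, a vector of the kernel gives a polynomial in z with coefficients [R i] that has
    the root t_1, so [vandermonde] applies. *)
Lemma cartan_sum_inj : injective cartan_sum.
Proof.
have [lc _ _] := cartan_sum_hom.
suff H u : cartan_sum u = 0 -> u = 0.
  by move=> u v E; apply/subr0_eq/H; rewrite (linB lc) E subrr.
move=> u0; pose R i : fock_space K := if insub i is Some j then emb (pfun (j : 'I_n.+1) u) else 0.
have RE (j : 'I_n.+1) : R j = emb (pfun j u) by rewrite /R valK.
have R0 i : (n.+1 <= i)%N -> R i = 0.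
  by move=> ni; rewrite /R insubF // ltnNge ni.
have Rd i : fdeg K n.+1 (R i).
  by rewrite /R; case: insub => [j|]; [exact: emb_fdeg|exact: subspace0].
have Rm q m : \sum_(i < m.+1) ann (q, (m - i)%N) (R i) = 0.
  pose G i := ann_sub (q, m) i (R i).
  have -> : \sum_(i < m.+1) ann (q, (m - i)%N) (R i) = \sum_(i < m.+1) G i.
    by apply: eq_bigr => i _; rewrite /G /ann_sub /= -ltnS ltn_ord.
  (* The range i <= m is traded for i <= n: terms with i > m vanish by [ann_sub], terms with i > n
     because [R i] is 0. *)
  rewrite -(@sum_pad _ G m.+1 n.+1) => [|i /andP[mi _]]; last first.
    by rewrite /G /ann_sub /= leqNgt mi.
  rewrite addnC sum_pad => [|i /andP[ni _]]; last first.
    by rewrite /G R0 // (lin0 (@ann_sub_linear K _ _)).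
  have := congr1 (vcoord (q, m)) u0; rewrite (lin0 (vcoord_linear _)) cartan_sumE.
  rewrite (lin_sum _ _ (vcoord_linear _)).
  under eq_bigr do rewrite vcoord_cartan -RE.
  rewrite -scaler_sumr => /eqP; rewrite scaler_eq0 invr_eq0 pnatr_eq0 /= => /eqP.
  by [].
apply: psumP => i; have := vandermonde Rd R0 Rm i; rewrite RE.
have lE := @emb_linear K n.+1; have [_ _ _ eK _] := emb_retP K n.+1.
by rewrite -(lin0 lE) => /(can_inj eK).
Qed.

Definition cartan_sub : gradedSub X := im_sub cartan_sum_hom.

Lemma cartan_in i v : (i <= n)%N -> cartan_sub (cartan i v).
Proof.
move=> ni; apply/im_subP; exists (pinj _ (Ordinal (ni : (i < n.+1)%N)) v).
by rewrite /cartan_sum plsum_pinj // => j; exact: cartan_linear.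
Qed.

Lemma ann_sub_la k i j m : ann_sub k i (fw (nseq j (la 1) ++ nseq m (la 0))) =
  (j%:R * (la i.+1 == k)%:R) *: fw (nseq j.-1 (la 1) ++ nseq m (la 0)) +
  (m%:R * (la i == k)%:R) *: fw (nseq j (la 1) ++ nseq m.-1 (la 0)).
Proof.
rewrite /ann_sub; case: (leqP i k.2) => ik.
  rewrite ann_la1_la0; case: k ik => q p /= ip; rewrite /la !xpair_eqE.
  by congr ((_ * (nat_of_bool (_ && _))%:R) *: _ + (_ * (nat_of_bool (_ && _))%:R) *: _);
    apply/eqP/eqP; lia.
have E p : (i <= p)%N -> (la p == k) = false.
  by move=> ip; apply/negbTE/eqP => E; move: ik; rewrite -E /= ltnNge ip.
by rewrite !E // !mulr0 !scale0r addr0.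
Qed.

(* Cayley-Hamilton: z^(n+1) = \sum_(j >= 1) (-1)^(j+1) e_j z^(n+1-j) *)
Lemma cayley_hamilton i : (n < i)%N ->
  \sum_(j < n.+2) ((-1) ^+ j *+ 'C(n.+1, j)) *:
    cartan (i - j) (ret n.+1 (fw (nseq j (la 1) ++ nseq (n.+1 - j) (la 0)))) = 0.
Proof.
move=> ni; apply: vcoord_sep => k; rewrite (lin_sum _ _ (vcoord_linear k)).
(* The word with j letters e_0 t and n + 1 - j letters e_0 stands for e_j divided by C(n+1, j),
   whence the binomial factor. *)
pose D m : K := (la m == k)%:R.
pose G j := D (i - j)%N *: fw (nseq j (la 1) ++ nseq (n - j) (la 0)).
have term (j : 'I_n.+2) : vcoord k (((-1) ^+ j *+ 'C(n.+1, j)) *: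
      cartan (i - j) (ret n.+1 (fw (nseq j (la 1) ++ nseq (n.+1 - j) (la 0))))) =
    n.+1%:R^-1 *: (((-1) ^+ j *+ ('C(n.+1, j) * j)) *: G j.-1 +
     ((-1) ^+ j *+ ('C(n.+1, j) * (n.+1 - j))) *: G j).
  rewrite (linZ (vcoord_linear k)) vcoord_cartan retK; last first.
    rewrite -[X in fdeg K X](_ : size (nseq j (la 1) ++ nseq (n.+1 - j) (la 0)) = _).
      exact: fdeg_word.
    by rewrite size_cat !size_nseq subnKC // -ltnS.
  rewrite scalerA mulrC -scalerA; congr (_ *: _).
  rewrite ann_sub_la scalerDr !scalerA !mulrA !mulr_natr -!mulrnA ?/G ?/D ?scalerA.
  congr (_ + _); last by rewrite mulnA -subnS subSS.
  case: j => -[|j] /= jn; first by rewrite mul0n !muln0 mul0n mulr0n !scale0r.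
  by rewrite mulnA subSS subnSK // (leq_trans _ ni).
under eq_bigr do rewrite term.
rewrite -scaler_sumr big_split /= big_ord_recl muln0 mulr0n scale0r add0r.
rewrite [X in _ + X]big_ord_recr /= subnn muln0 mulr0n scale0r addr0 -big_split big1 ?scaler0 //.
(* The two families cancel termwise: C(n+1, j+1) (j+1) = C(n+1, j) (n+1-j). *)
move=> j _; rewrite /bump /= ?add1n ?add0n -scalerDl exprS mulN1r mulNrn.
by rewrite mulnC mul_bin_left mulnC addNr scale0r.
Qed.

Lemma cartan_all i v : cartan_sub (cartan i v).
Proof.
elim/ltn_ind: i v => i IH v; have [/cartan_in //|ni] := leqP i n.
move: v; apply: (weyl_generated (S := preim_subspace (cartan_linear i) cartan_sub)) => [|a r v].
  change (cartan_sub (cartan i (weyl_gen K n.+1))); have := cayley_hamilton ni; rewrite big_ord_recl expr0 bin0 scale1r subn0.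
  rewrite -[fw _]/(vac K n.+1) ret_vac => /eqP; rewrite addr_eq0 => /eqP ->.
  apply: (subspaceN (S := cartan_sub)); apply: (subspace_sum (S := cartan_sub)) => j.
  apply: subspaceZ; apply: IH.
  by rewrite /= /bump add1n ltn_subrL /= (leq_ltn_trans _ ni).
change (cartan_sub (cartan i v) -> cartan_sub (cartan i (act a r v))).
by rewrite cartan_act; exact: gsub_act.
Qed.

(** The identity av (x) u = a(v (x) u) - v (x) au reduces the first factor to the generator. *)
Lemma weyl_vec_generated (S : subspace X) : act_stable S ->
  (forall i, S (tens w (vgen (la i)))) -> (forall i, S (tens w (vgen (lb i)))) -> forall t, S t.
Proof.
move=> Sa Sla Slb; apply: tensor_ind => v x; move: x.
have [T TE] : exists T : subspace W, forall v, T v <-> forall x, S (tens v x).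
  apply: subspace_of => [x|c u u' Su Su' x]; first by rewrite (lin0 (tens_linearl x)); exact: subspace0.
  by rewrite tens_linearl; exact: (subspaceP c (Su x) (Su' x)).
apply/TE; move: v; apply: weyl_generated => [|a r v /TE Tv]; apply/TE => x.
  move: x; apply: (vec_ind (S := preim_subspace (tens_linear w) S)) => l.
  by have [[i ->]|[i ->]] := letterP l; [exact: Sla|exact: Slb].
have -> : tens (act a r v) x = act a r (tens v x : X) - tens v (act a r x) :> X.
  by rewrite act_tens addrK.
by apply: subspaceB => //; exact: Sa.
Qed.

Lemma cartan_la i : cartan_sub (tens w (vgen (la i))).
Proof. by rewrite -cartan_gen; exact: cartan_all. Qed.

Lemma y0s_tens_lb m (v : W) i : y0s m (tens v (vgen (lb i)) : X) = tens (y0s m v) (vgen (lb i)).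
Proof.
have yb : act sl2_y 0 (vgen (lb i)) = 0 by rewrite act_vgen letter_act_yb.
elim: m => [//|m IH]; rewrite -[LHS]/(act sl2_y 0 (y0s m (tens v (vgen (lb i)) : X))) IH.
by rewrite act_tens yb (lin0 (tens_linear _)) addr0.
Qed.

(** Since y^(n+1) w = 0, applying y^(n+1) to w (x) e_0 t^i gives n + 1 times this vector. *)
Lemma cartan_lb i : cartan_sub (tens (y0s n w) (vgen (lb i))).
Proof.
have w1 : y0s n.+1 w = 0 by have [] := weyl_gen_hw K n.
have := y0s_tens n.+1 w i; rewrite w1 (lin0 (tens_linearl _)) add0r => E.
have n1 : n.+1%:R != 0 :> K by rewrite pnatr_eq0.
rewrite -[tens _ _](scalerK n1) -E; apply: (subspaceZ (S := cartan_sub)).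
elim: n.+1 => [|m IH]; first exact: cartan_la.
exact: (gsub_act _ _ IH).
Qed.

Notation Q := (quotRep cartan_sub).

Definition pi_lb (p : nat) : Q := vpi (tens w (vgen (lb p))).

Lemma quot0 t : cartan_sub t -> vpi t = 0 :> Q.
Proof. by move=> h; apply: (vpi0 h). Qed.

Lemma pi_lb_hw m p : n = m.+1 -> highest_weight m (pi_lb p).
Proof.
move=> nm; have [lq aq _] := quot_hom cartan_sub; have [wx wh wy] := weyl_gen_hw K n.
split=> [r||]; rewrite /pi_lb.
- rewrite -aq act_tens wx act_vgen letter_act_xb (lin0 (tens_linearl _)) add0r.
  by apply: quot0; exact: cartan_la.
- rewrite -aq act_tens wh act_vgen letter_act_hb addn0 (linZ (tens_linearl _)).
  rewrite -[- vgen _]scaleN1r (linZ (tens_linear _)) -scalerDl.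
  have -> : n%:R + -1 = m%:R :> K by rewrite nm -natr1 addrK.
  exact: (linZ lq).
- have -> : iter m.+1 (act sl2_y 0) (vpi (tens w (vgen (lb p))) : Q) =
      vpi (y0s m.+1 (tens w (vgen (lb p)) : X)).
    by elim: m.+1 => // k IH; rewrite iterS IH -aq.
  by rewrite -nm y0s_tens_lb; apply: quot0; exact: cartan_lb.
Qed.

Lemma pi_lb_grade p : grade Q p%:Z (pi_lb p).
Proof.
have [_ _ gq] := quot_hom cartan_sub; apply: gq; rewrite -[p%:Z]add0r.
by apply: grade_tens; [exact: (@weyl_gen_grade K n)|exact: (@vgen_grade K (lb p))].
Qed.

Lemma contract_lb p q : contract p (tens w (vgen (lb q))) =
  ((p == q)%:R * n%:R) *: vac K n.-1.
Proof.
have E1 m m' : ((1 : 'I_2, m) == lb m') = (m == m') by rewrite xpair_eqE.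
have E0 m m' : ((0 : 'I_2, m) == lb m') = false by rewrite xpair_eqE.
rewrite /contract big_ord_recl big1 ?addr0 => [|j _]; last first.
  rewrite !vcoord_tens !coord_gen emb_gen E0 scale0r (lin0 (@ann_linear K _)) subr0.
  rewrite (linZ (@ann_linear K _)) ann_nseq (_ : (la 0 == _) = false) ?mulr0 ?scale0r ?scaler0 //.
rewrite !vcoord_tens !coord_gen emb_gen E0 E1 subn0 scale0r (lin0 (@ann_linear K _)) subr0.
by rewrite (linZ (@ann_linear K _)) ann_nseq eqxx mulr1 scalerA.
Qed.

(** The map [s] from the sum of shifts of W(n-1) to the quotient by [cartan_sub] is onto, because
    the classes of w (x) e_1 t^p generate the quotient, and injective, because the contractions
    recover each coordinate up to the factor [n]. *)
Lemma chain_weyl_vec : chain (full X).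
Proof.
have cC : chain cartan_sub.
  apply: chainS (layer_of_mono cartan_sum_hom cartan_sum_inj) _.
  by apply: chain0.
(* For n = 0 the vectors w (x) e_1 t^i already lie in [cartan_sub], and there is a single layer. *)
have [n0|[m nm]] : n = 0%N \/ exists m, n = m.+1 by case: (n) => [|m]; [left|right; exists m].
  apply: chain_ext cC => t; split=> // _; move: t.
  apply: (weyl_vec_generated (S := cartan_sub)) => [a r v|i|i]; first exact: gsub_act.
    exact: cartan_la.
  have y0 : y0s n w = w := congr1 (fun k => y0s k w) n0.
  by have := cartan_lb i; rewrite y0.
have [s hs sg] := @wsum_hom K m nat (fun p : nat => p%:Z) Q pi_lb
  (fun p => pi_lb_hw p nm) pi_lb_grade.
have [ls as_ _] := hs; have [lq aq _] := quot_hom cartan_sub.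
pose D p (q : Q) : F := vlift (contract p) q.
have cl p := contract_linear p.
have c0 p t : cartan_sub t -> contract p t = 0.
  move=> /im_subP[u <-]; rewrite cartan_sumE (lin_sum _ _ (cl p)) big1 // => i _.
  exact: contract_cartan.
have lD p : linear (D p) by exact: vlift_linear (cl p) (c0 p).
have DE p t : D p (vpi t) = contract p t by exact: vlift_pi (cl p) (c0 p) t.
have Da p a r q : D p (act a r q) = act a r (D p q).
  by rewrite -[q]vpi_repr -aq !DE contract_act.
have Ds p u : D p (s u) = n%:R *: emb (pfun p u).
  move: u; apply: (wsum_ext (T := fun a r (f : F) => act a r f)).
  - exact: lin_comp (lD p) ls.
  - by apply: lin_scale; exact: lin_comp (@emb_linear K m) (@pfun_linear _ _ _ _ p).
  - by move=> a r v; rewrite /= as_ Da.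
  - move=> a r v; rewrite pfun_act emb_act.
    exact/esym/(linZ (@act_linear K F a r)).
  move=> q; rewrite /comp sg DE contract_lb /wgen pfun_pinj nm /=; case: eqP => _.
    by rewrite mul1r emb_gen.
  by rewrite mul0r scale0r (lin0 (@emb_linear K m)) scaler0.
have n1 : n%:R != 0 :> K by rewrite nm pnatr_eq0.
have si : injective s.
  suff H u : s u = 0 -> u = 0 by move=> u v E; apply/subr0_eq/H; rewrite (linB ls) E subrr.
  move=> u0; apply: psumP => p; have := Ds p u; rewrite u0 (lin0 (lD p)) => /esym/eqP.
  rewrite scaler_eq0 (negPf n1) /= => /eqP; rewrite -(lin0 (@emb_linear K m)).
  by have [_ _ _ eK _] := emb_retP K m => /(can_inj eK).
have ss q : exists u, s u = q.
  rewrite -[q]vpi_repr; move: (repr q) => t.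
  suff [u _ ->] : preim_subspace lq (im_sub hs) t by exists u.
  move: t; apply: weyl_vec_generated => [a r t [u _ E]|i|i].
  - exists (act a r u) => //; change (vpi (act a r t) = s (act a r u) :> Q).
    by rewrite as_ -E aq.
  - exists 0 => //; rewrite (lin0 ls); apply: quot0; exact: cartan_la.
  - by exists (wgen K m (fun p : nat => p%:Z) i) => //; rewrite sg.
have [g [hg gs sgK]] := rep_hom_inv hs si ss.
apply: chainS cC; apply: (layer_target hg); first by exists s.
apply: layer_of_epi (quot_hom cartan_sub) _ _ => [q|v]; first by exists (repr q); exact: vpi_repr.
split=> [/quot0 //|]; rewrite -(lin0 lq) => /vpi_eq; by rewrite subr0.
Qed.

End Cartan.
End WeylVec.

(** * Filtrations by weight and their retracts *)

Lemma quot_map (K : fieldType) (M : gradedRep K) (S : gradedSub M) :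
  exists q : M -> quotRep S, [/\ rep_hom q, forall v, q v = 0 <-> S v & forall p, exists v, q v = p].
Proof.
exists (fun v => vpi v); have hq := quot_hom S; have [lq _ _] := hq; split=> // [v|p].
  by rewrite -(lin0 lq); split=> [/vpi_eq|Sv]; [rewrite subr0|apply/vpi_eq; rewrite subr0].
by exists (repr p); exact: vpi_repr.
Qed.

Section Standard.
Variable K : numFieldType.
Implicit Types M P : gradedRep K.

Definition weight_gens M (F : gradedSub M) (nu : nat) : set M :=
  [set v | F v /\ exists2 k : int, (nu <= `|k|)%N & wvec k v].

Fact weight_gens_component M (F : gradedSub M) nu r v :
  weight_gens F nu v -> weight_gens F nu (component r v).
Proof.
case=> Fv [k nk kv]; split; first exact: gsub_component.
by exists k => //; exact: wvec_component.
Qed.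

(** The generators are taken in [F] rather than in [M], because the induction along a chain compares
    the truncations of its successive members. *)
Definition trunc M (F : gradedSub M) nu : gradedSub M := generated (@weight_gens_component M F nu).

Lemma trunc_gen M (F : gradedSub M) (nu : nat) (k : int) v :
  F v -> (nu <= `|k|)%N -> wvec k v -> trunc F nu v.
Proof. by move=> Fv nk kv; apply: generated_gen; split=> //; exists k. Qed.

Lemma trunc_sub M (F : gradedSub M) nu v : trunc F nu v -> F v.
Proof. by apply: generated_min => [u []|a r u] //; exact: gsub_act. Qed.

Lemma trunc_le M (F F' : gradedSub M) nu nu' : (forall v, F v -> F' v) -> (nu' <= nu)%N ->
  forall v, trunc F nu v -> trunc F' nu' v.
Proof.
move=> FF' nn; apply: generated_min => [u [Fu [k nk ku]]|a r u]; last exact: gsub_act.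
by apply: trunc_gen ku; [exact: FF'|exact: leq_trans nk].
Qed.

Lemma trunc_big N M (F : gradedSub M) nu v : wt N M -> (N < nu)%N -> trunc F nu v -> v = 0.
Proof.
move=> wM Nn; apply: (generated_min (S := gsub0 M)) => [u [_ [k nk ku]]|a r u u0].
  by apply: wt_big wM ku _; exact: leq_trans nk.
exact: (gsub_act a r u0).
Qed.

Lemma irange_uniq N : uniq (irange N).
Proof. by rewrite /irange map_inj_uniq ?iota_uniq // => a b /addIr []. Qed.

Lemma wproj_sum N M (v : M) : wt N M -> v = \sum_(k <- irange N) wproj N k v.
Proof.
move=> wM; have ls : linear (fun v : M => \sum_(k <- irange N) wproj N k v).
  move=> c u u'; rewrite scaler_sumr -big_split; apply: eq_bigr => k _ /=.
  exact: wproj_linear.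
apply: (span_eq_lin (@lin_id K M) ls _ (wM v)) => u [k kN ku] /=.
rewrite (bigD1_seq k) ?mem_irange ?irange_uniq //.
rewrite (wproj_wvec ku) eqxx //= big1 ?addr0 // => l /negPf lk.
by rewrite (wproj_wvec ku) lk //= kN.
Qed.

Lemma wproj_sub N M (F : gradedSub M) k v : F v -> F (wproj N k v).
Proof. by apply: wproj_stable => u; exact: gsub_act. Qed.

Lemma trunc_full N M (F : gradedSub M) v : wt N M -> F v -> trunc F 0 v.
Proof.
move=> wM Fv; rewrite (wproj_sum v wM); apply: (subspace_sum (S := trunc F 0)) => k.
by apply: (trunc_gen (k := k)) => //; [exact: wproj_sub|exact: wt_wproj].
Qed.

Lemma trunc_hom M (F : gradedSub M) (f : M -> M) nu v : rep_hom f -> (forall u, F u -> F (f u)) ->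
  trunc F nu v -> trunc F nu (f v).
Proof.
case=> lf af _ Ff; apply: (generated_min (S := preim_subspace lf (trunc F nu))).
  by move=> u [Fu [k nk ku]]; apply: (trunc_gen _ nk); [exact: Ff|exact: wvec_hom].
move=> a r u; change (trunc F nu (f u) -> trunc F nu (f (act a r u))).
by rewrite af; exact: gsub_act.
Qed.

Definition standard M (F : gradedSub M) : Prop := forall nu, exists (I : choiceType) (d : I -> int),
  layer (wsum K nu d) (trunc F nu) (trunc F nu.+1).

Lemma standard0 M (F : gradedSub M) : (forall v, F v -> v = 0) -> standard F.
Proof.
move=> F0 nu; exists void, (fun=> 0); apply: layer_refl => [v|p].
  split=> /trunc_sub /F0 ->; exact: subspace0.
by apply: psumP => -[].
Qed.

Section AddComplement.
Variables (M : gradedRep K) (G G' C H H' : gradedSub M).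
Hypothesis CG : forall v, C v -> G v -> G' v.
Hypothesis HE : forall v, H v <-> exists2 c, C c & G (v - c).

(** Adding [C] to both terms does not change G / G', because C and G meet inside G'. *)
Lemma layer_add P : (forall v, H' v <-> exists2 c, C c & G' (v - c)) ->
  layer P G G' -> layer P H H'.
Proof.
move=> HE' [R RL]; exists (fun v p => exists2 c, C c & R (v - c) p); split.
- move=> c u v p q [c1 C1 R1] [c2 C2 R2]; exists (c *: c1 + c2); first exact: subspaceP.
  by rewrite opprD addrACA -scalerBr; exact: (layer_lin RL).
- by move=> v p [c Cc /(layer_dom RL) Gc]; apply/HE; exists c.
- by move=> v /HE[c Cc /(layer_tot RL)[p Rp]]; exists p, c.
- move=> p; have [v Rv] := layer_sur RL p; exists v, 0; first exact: subspace0.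
  by rewrite subr0.
- move=> a r v p [c Cc Rp]; exists (act a r c); first exact: gsub_act.
  by rewrite -(linB (@act_linear K M a r)); exact: (layer_act RL).
- move=> r v p [c Cc Rp]; exists (component r c); first exact: gsub_component.
  by rewrite -(linB (@component_linear K M r)); exact: (layer_cmp RL).
- move=> p [c Cc]; rewrite sub0r => Rp; apply: (layer_ker0 RL _ Rp).
  apply: CG; first exact: subspaceN.
  exact: (layer_dom RL Rp).
- move=> v; rewrite HE'; split=> -[c Cc] h; exists c => //.
    by apply/(layer_ker RL).
  exact/(layer_ker RL).
Qed.

(** H / G' is the sum of G / G' and of the image of C, which is F / F': C maps onto F / F', and what
    it has in F' lies in G'. *)
Lemma layer_add_sum nu (I1 I2 : choiceType) (d1 : I1 -> int) (d2 : I2 -> int)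
    (F F' : gradedSub M) (R2 : M -> wsum K nu d2 -> Prop) :
  is_layer F F' R2 -> layer (wsum K nu d1) G G' -> (forall v, G v -> F' v) ->
  (forall v, C v -> F v) -> (forall v, C v -> F' v -> G' v) ->
  (forall p, exists2 c, C c & R2 c p) -> (forall v, H' v <-> G' v) ->
  layer (wsum K nu (fun i : I1 + I2 => match i with inl i => d1 i | inr i => d2 i end)) H H'.
Proof.
move=> RL2 [R1 RL1] GF' CF CF' Csur HG'.
set P := wsum K nu _.
have finl (p : P) : finite_set [set i : I1 | pfun (inl i) p != 0].
  rewrite (_ : mkset _ = inl @^-1` [set i | pfun i p != 0]) //.
  apply: finite_preimage; last exact: dsum_fin p.
  by move=> x y _ _ [].
have finr (p : P) : finite_set [set i : I2 | pfun (inr i) p != 0].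
  rewrite (_ : mkset _ = inr @^-1` [set i | pfun i p != 0]) //.
  apply: finite_preimage; last exact: dsum_fin p.
  by move=> x y _ _ [].
pose l (p : P) : wsum K nu d1 := mkpsum d1 (finl p).
pose r (p : P) : wsum K nu d2 := mkpsum d2 (finr p).
have ll c p q : l (c *: p + q) = c *: l p + l q by apply: psumP.
have lr c p q : r (c *: p + q) = c *: r p + r q by apply: psumP.
have l0 : l 0 = 0 by apply: psumP.
have r0 : r 0 = 0 by apply: psumP.
have glue (p1 : wsum K nu d1) (p2 : wsum K nu d2) : exists p, l p = p1 /\ r p = p2.
  have ff : finite_set [set i : I1 + I2 |
      (match i with inl i => pfun i p1 | inr i => pfun i p2 end) != 0].
    apply: (@sub_finite_set _ _ ((inl @` [set i | pfun i p1 != 0]) `|`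
        (inr @` [set i | pfun i p2 != 0]))).
      by move=> [i|i] /= h; [left|right]; exists i.
    by rewrite finite_setU; split; apply: finite_image; [exact: dsum_fin p1|exact: dsum_fin p2].
  by exists (mkpsum _ ff); split; apply: psumP.
exists (fun v p => exists2 c, C c & R1 (v - c) (l p) /\ R2 c (r p)); split.
- move=> c u v p q [c1 C1 [Ru1 Ru2]] [c2 C2 [Rv1 Rv2]]; exists (c *: c1 + c2).
    exact: subspaceP.
  rewrite ll lr opprD addrACA -scalerBr.
  by split; [exact: (layer_lin RL1)|exact: (layer_lin RL2)].
- by move=> v p [c Cc [/(layer_dom RL1) Gc _]]; apply/HE; exists c.
- move=> v /HE[c Cc /(layer_tot RL1)[p1 Rp1]]; have [p2 Rp2] := layer_tot RL2 (CF _ Cc).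
  by have [p [lp rp]] := glue p1 p2; exists p, c; rewrite // lp rp.
- move=> p; have [c Cc Rc] := Csur (r p); have [v Rv] := layer_sur RL1 (l p).
  by exists (v + c), c => //; rewrite addrK.
- move=> a s v p [c Cc [Rp1 Rp2]]; exists (act a s c); first exact: gsub_act.
  rewrite -(linB (@act_linear K M a s)) (_ : l _ = act a s (l p)); last by apply: psumP.
  rewrite (_ : r _ = act a s (r p)); last by apply: psumP.
  by split; [exact: (layer_act RL1)|exact: (layer_act RL2)].
- move=> s v p [c Cc [Rp1 Rp2]]; exists (component s c); first exact: gsub_component.
  rewrite -(linB (@component_linear K M s)) (_ : l _ = component s (l p)); last first.
    by apply: psumP => i; rewrite -[LHS]/(pfun (inl i) (component s p)) !pfun_component.
  rewrite (_ : r _ = component s (r p)); last first.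
    by apply: psumP => i; rewrite -[LHS]/(pfun (inr i) (component s p)) !pfun_component.
  by split; [exact: (layer_cmp RL1)|exact: (layer_cmp RL2)].
- move=> p [c Cc [Rp1 Rp2]]; rewrite sub0r in Rp1.
  have F'c : F' c by rewrite -[c]opprK; apply: subspaceN; apply: GF'; exact: (layer_dom RL1 Rp1).
  have rp : r p = 0 by exact: (layer_ker0 RL2 F'c Rp2).
  have lp : l p = 0 by apply: (layer_ker0 RL1) Rp1; apply: subspaceN; exact: CF'.
  apply: psumP => -[i|i].
    by rewrite -[LHS]/(pfun i (l p)) lp.
  by rewrite -[LHS]/(pfun i (r p)) rp.
- move=> v; rewrite HG' l0 r0; split=> [G'v|[c Cc [/(layer_ker RL1) G'vc /(layer_ker RL2) F'c]]].
    exists 0; first exact: subspace0.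
    by rewrite subr0; split; [exact/(layer_ker RL1)|exact: (layer0 RL2)].
  rewrite -[v](subrK c); apply: subspaceD => //; exact: CF'.
Qed.
End AddComplement.

Lemma wvec_y0s M (k : int) m (v : M) : wvec k v -> wvec (k - (m.*2)%:Z) (y0s m v).
Proof.
move=> kv; elim: m => [|m IH]; first by rewrite subr0.
by have := wvec_y 0 IH; rewrite (_ : k - (m.*2)%:Z - 2 = k - (m.+1.*2)%:Z) //; lia.
Qed.

Lemma layer_y0s M P (F F' : gradedSub M) (R : M -> P -> Prop) m v p :
  is_layer F F' R -> R v p -> R (y0s m v) (y0s m p).
Proof. by move=> RL Rvp; elim: m => // m; exact: (layer_act RL). Qed.

Lemma wgen_wvec (lambda : nat) (I : choiceType) (d : I -> int) i : wvec lambda (wgen K lambda d i).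
Proof. by have [_ h _] := wgen_hw K lambda d i. Qed.

(** * Truncations after adding one layer W(lambda) on top *)

Section Extension.
Variables (N : nat) (M : gradedRep K) (F F' : gradedSub M) (lambda : nat) (I : choiceType).
Variables (d : I -> int) (R : M -> wsum K lambda d -> Prop).
Hypotheses (wM : wt N M) (RL : is_layer F F' R).

(** Any lift may be projected to the grade and weight of the generator, since these projections fix
    the generator. *)
Lemma ext_lift i : exists v, [/\ R v (wgen K lambda d i), grade M (d i) v & wvec lambda v].
Proof.
have [v0 R0] := layer_sur RL (wgen K lambda d i).
exists (wproj N lambda (component (d i) v0)); split.
- have := layer_wproj N lambda RL (layer_cmp RL (d i) R0).
  rewrite (grade_component_id (@wgen_grade K lambda I d i)).
  by rewrite (wproj_wvec (@wgen_wvec lambda I d i)) eqxx.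
- apply: wproj_stable; last exact: grade_component.
  by move=> u /(act_grade sl2_h 0); rewrite add0r.
- exact: wt_wproj.
Qed.

Definition ext_gen i : M := projT1 (cid (ext_lift i)).

Lemma ext_genP i : [/\ R (ext_gen i) (wgen K lambda d i), grade M (d i) (ext_gen i)
  & wvec lambda (ext_gen i)].
Proof. by rewrite /ext_gen; case: cid. Qed.

(** 0 is included to make the set stable under components. *)
Definition ext_set : set M := [set v | v = 0 \/ exists i, v = ext_gen i].

Fact ext_set_component r v : ext_set v -> ext_set (component r v).
Proof.
case=> [->|[i ->]]; first by left; exact: linear0.
have [_ gi _] := ext_genP i; rewrite (component_id r gi).
by case: eqP => _; [right; exists i|left].
Qed.

Definition ext_sub : gradedSub M := generated ext_set_component.

Lemma ext_sub_gen i : ext_sub (ext_gen i).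
Proof. by apply: generated_gen; right; exists i. Qed.

Lemma ext_sub_min (S : subspace M) : act_stable S -> (forall i, S (ext_gen i)) ->
  forall v, ext_sub v -> S v.
Proof.
move=> Sa Si; apply: generated_min => // v [->|[i ->]] //; exact: subspace0.
Qed.

Lemma ext_sub_sub v : ext_sub v -> F v.
Proof.
apply: ext_sub_min => [a r u|i]; first exact: gsub_act.
by have [/(layer_dom RL)] := ext_genP i.
Qed.

Lemma ext_sub_sur p : exists2 c, ext_sub c & R c p.
Proof.
have [S SE] : exists S : subspace (wsum K lambda d), forall p, S p <-> exists2 c, ext_sub c & R c p.
  apply: subspace_of => [|c p1 p2 [c1 C1 R1] [c2 C2 R2]]; first by exists 0; [exact: subspace0|exact: (layer0 RL)].
  by exists (c *: c1 + c2); [exact: subspaceP|exact: (layer_lin RL)].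
apply/SE; move: p; apply: wsum_generated => [i|a r p /SE[c Cc Rc]]; apply/SE.
  by exists (ext_gen i); [exact: ext_sub_gen|have [] := ext_genP i].
by exists (act a r c); [exact: gsub_act|exact: (layer_act RL)].
Qed.

(** Modulo the truncation the lifts are highest weight vectors, as their defects lie in F' and have
    weights lambda + 2 and -lambda - 2. Hence on [ext_sub] the quotient map factors through F / F'
    as [s], and so it kills the vectors lying in F'. *)
Lemma ext_sub_cap v : ext_sub v -> F' v -> trunc F' lambda.+1 v.
Proof.
have [q [[lq aq gq] q0 _]] := quot_map (trunc F' lambda.+1); set T := trunc _ _ in q lq aq gq q0 *.
have hw i : highest_weight lambda (q (ext_gen i)).
  have [Ri gi wi] := ext_genP i; have [wx wh wy] := wgen_hw K lambda d i.
  split=> [r||].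
  - rewrite -aq; apply/q0.
    apply: (trunc_gen (k := lambda%:Z + 2)) ; [|lia|exact: wvec_x].
    by apply/(layer_ker RL); rewrite -(wx r); exact: (layer_act RL).
  - by rewrite -aq wi; exact: (linZ lq).
  - have -> : iter lambda.+1 (act sl2_y 0) (q (ext_gen i)) =
        q (y0s lambda.+1 (ext_gen i)) by elim: lambda.+1 => // k IH; rewrite iterS IH -aq.
    apply/q0; apply: (trunc_gen (k := lambda%:Z - (lambda.+1.*2)%:Z)).
    + apply/(layer_ker RL); rewrite -wy; exact: (layer_y0s lambda.+1 RL Ri).
    + by lia.
    + exact: wvec_y0s.
have hg i : grade (quotRep T) (d i) (q (ext_gen i)).
  by apply: gq; have [] := ext_genP i.
have [s [ls as_ _] sg] := wsum_hom hw hg.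
have [S SE] : exists S : subspace M, forall v, S v <-> exists2 p, R v p & q v = s p.
  apply: subspace_of => [|c u u' [p Rp ps] [p' Rq qs]].
    by exists 0; [exact: (layer0 RL)|rewrite (lin0 lq) (lin0 ls)].
  by exists (c *: p + p'); [exact: (layer_lin RL)|rewrite lq ps qs ls].
move=> Cv F'v; have /SE[p Rp] : S v.
  apply: ext_sub_min Cv => [a r u /SE[p Rp E]|i]; apply/SE.
    exists (act a r p); first exact: (layer_act RL).
    by rewrite as_ -E aq.
  by exists (wgen K lambda d i); [have [] := ext_genP i|rewrite sg].
by rewrite (layer_ker0 RL F'v Rp) (lin0 ls) => /q0.
Qed.

(** A weight vector of F splits into parts in [ext_sub] and F'; projecting to its weight makes both
    parts weight vectors of that weight. *)
Lemma ext_trunc_le nu v : (nu <= lambda)%N ->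
  trunc F nu v <-> exists2 c, ext_sub c & trunc F' nu (v - c).
Proof.
move=> nl; have FF' := layer_sub RL; split=> [|[c Cc Tc]].
  pose S := sum_subspace ext_sub (trunc F' nu).
  apply: (generated_min (S := S)) => [u [Fu [k nk ku]]|a r u [c Cc Tc]]; last first.
    exists (act a r c); first exact: gsub_act.
    by rewrite -(linB (@act_linear K M a r)); exact: gsub_act.
  have [p Rp] := layer_tot RL Fu; have [c Cc Rc] := ext_sub_sur p.
  have F'uc : F' (u - c) by apply/(layer_ker RL); rewrite -(subrr p); exact: (layerB RL).
  have <- : wproj N k u = u by rewrite (wproj_wvec ku) eqxx.
  exists (wproj N k c); first exact: wproj_sub.
  rewrite -(linB (@wproj_linear K M N k)).
  by apply: (trunc_gen _ nk); [exact: wproj_sub|exact: wt_wproj].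
rewrite -[v](subrK c); apply: subspaceD; first exact: trunc_le Tc.
apply: ext_sub_min Cc => [a r u|i]; first exact: gsub_act.
have [/(layer_dom RL) Fi _ wi] := ext_genP i.
exact: (trunc_gen (k := lambda)).
Qed.

Lemma ext_trunc_gt nu v : (lambda < nu)%N -> trunc F nu v <-> trunc F' nu v.
Proof.
move=> ln; split; last by apply: trunc_le => //; exact: layer_sub RL.
apply: generated_min => [u [Fu [k nk ku]]|a r u]; last exact: gsub_act.
apply: (trunc_gen _ nk) => //; apply/(layer_ker RL).
have [p Rp] := layer_tot RL Fu; rewrite -[0](_ : p = 0) //.
apply: (wt_big (N := lambda) (k := k)); first exact: (wt_psum (@weyl_wt K lambda)).
  have := layer_act RL sl2_h 0 Rp; rewrite ku => /(layer_uniq RL); apply.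
  exact: (layerZ RL).
exact: leq_trans nk.
Qed.

(** For nu below lambda both ends of the layer acquire [ext_sub], above lambda nothing changes, and
    at lambda the layer gains the summands of F / F'. *)
Lemma standard_ext : standard F' -> standard F.
Proof.
move=> sF' nu; have [J [e L]] := sF' nu.
have [nl|ln|nl] := ltngtP nu lambda.
- exists J, e; apply: (layer_add (C := ext_sub)) L => [v Cv /trunc_sub F'v|v|v].
  + by apply: (trunc_le _ (leqW nl)) (ext_sub_cap Cv F'v).
  + by apply: ext_trunc_le; exact: ltnW.
  + exact: ext_trunc_le.
- by exists J, e; apply: layer_ext L => v; apply: iff_sym; apply: ext_trunc_gt => //; exact: ltnW.
- move: L; rewrite nl => L; exists (J + I)%type, (fun i => match i with inl i => e i | inr i => d i end).
  apply: (layer_add_sum (C := ext_sub) (G' := trunc F' lambda.+1) _ RL L).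
  + by move=> v; apply: ext_trunc_le.
  + exact: trunc_sub.
  + exact: ext_sub_sub.
  + exact: ext_sub_cap.
  + exact: ext_sub_sur.
  + by move=> v; exact: ext_trunc_gt.
Qed.
End Extension.

Lemma chain_standard N M (F : gradedSub M) : wt N M -> chain F -> standard F.
Proof.
move=> wM; elim=> [G|G G' lambda I d [R RL] _ IH]; first exact: standard0.
exact: (standard_ext wM RL IH).
Qed.

End Standard.

Lemma psum_ext (K : fieldType) (A : gradedRep K) (I : choiceType) (d : I -> int)
    (U : lmodType K) (f g : psum A d -> U) : linear f -> linear g ->
  (forall i x, f (pinj d i x) = g (pinj d i x)) -> f =1 g.
Proof.
move=> lf lg fg u; apply: subr0_eq.
apply: (psum_ind (S := subspace_ker (lin_sub lf lg))) => i x.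
by change (f (pinj d i x) - g (pinj d i x) = 0); rewrite fg subrr.
Qed.

Section Restriction.
Variables (K : fieldType) (A : gradedRep K) (J : choiceType) (d : J -> int) (B : set J).

Definition restrict_index := {j : J | `[< B j >]}.
Definition restrict_shift (i : restrict_index) : int := d (val i).

Definition restrict_incl : psum A restrict_shift -> psum A d :=
  plsum (fun i x => pinj d (val i) x).

Let incl_lin (i : restrict_index) : linear (fun x : A => pinj d (val i) x) := pinj_linear d (val i).

Lemma restrict_incl_pinj i x : restrict_incl (pinj restrict_shift i x) = pinj d (val i) x.
Proof. exact: (plsum_pinj _ incl_lin). Qed.

Lemma restrict_incl_hom : rep_hom restrict_incl.
Proof.
apply: plsum_hom => // i; first by move=> a r u; exact: pinj_act.
by move=> r u; exact: pinj_grade.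
Qed.

Lemma pfun_restrict_incl i q : pfun (val i) (restrict_incl q) = pfun i q.
Proof.
have li := rep_hom_linear restrict_incl_hom.
move: q; apply: psum_ext; [|by []|move=> i' x].
  exact: lin_comp (@pfun_linear K A J d (val i)) li.
by rewrite restrict_incl_pinj !pfun_pinj val_eqE.
Qed.

Lemma pfun_restrict_out j q : ~ B j -> pfun j (restrict_incl q) = 0.
Proof.
move=> nBj; have li := rep_hom_linear restrict_incl_hom.
move: q; apply: psum_ext => [||i x].
- exact: lin_comp (@pfun_linear K A J d j) li.
- exact: lin_cst0.
rewrite restrict_incl_pinj pfun_pinj; case: eqP => // ji.
by case: nBj; rewrite ji; apply/asboolP; exact: (valP i).
Qed.

Lemma restrict_incl_onto j x : B j -> exists q, restrict_incl q = pinj d j x.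
Proof.
move=> Bj; exists (pinj restrict_shift (exist _ j (asboolT Bj)) x).
exact: restrict_incl_pinj.
Qed.
End Restriction.

Lemma int_seq_bound (J : eqType) (d : J -> int) (p0 : int) (s : seq J) :
  exists k : nat, forall j, j \in s -> d j < p0 + k%:Z.
Proof.
elim: s => [|i s [k hk]]; first by exists 0.
exists (k + `|d i - p0|.+1)%N => j; rewrite inE => /orP[/eqP ->|/hk]; lia.
Qed.

(** * Idempotents of a sum of shifts of W(n) *)

Section Idempotent.
Variables (K : numFieldType) (n : nat) (J : choiceType) (d : J -> int) (p0 : int).
Notation P := (wsum K n d).
Hypothesis d_ge : forall j, p0 <= d j.
Variable e : P -> P.
Hypothesis he : rep_hom e.

Let le : linear e := rep_hom_linear he.

Lemma hom_entry_eq i j : d i = d j -> exists c : K, pfun i (e (wgen K n d j)) = c *: weyl_gen K n.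
Proof.
have [_ ae ge] := he; move=> ij; apply: weyl_top.
  apply: (wvec_hom (f := @pfun K (weyl K n) J d i)) => //; apply: (wvec_hom le ae); exact: wgen_wvec.
have gr : grade (weyl K n) (d j - d i) (pfun i (e (wgen K n d j))).
  exact: (ge _ _ (@wgen_grade K n J d j) i).
by move: gr; rewrite ij subrr.
Qed.

(* The matrix of the map induced by [e] on the degree-0 parts of the summands *)
Definition entry i j : K :=
  match pselect (d i = d j) with left ij => projT1 (cid (hom_entry_eq ij)) | right _ => 0 end.

Lemma entry0 i j : d i != d j -> entry i j = 0.
Proof. by rewrite /entry; case: pselect => // ij /eqP. Qed.

(** For d j < d i the generator would go to negative degree in W(n), so the block is 0. *)
Lemma entryE i j x : d j <= d i -> pfun i (e (pinj d j x)) = entry i j *: x.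
Proof.
have [_ ae ge] := he; move=> ji; move: x; apply: weyl_ext.
- exact: lin_comp (@pfun_linear K (weyl K n) J d i) (lin_comp le (@pinj_linear K (weyl K n) J d j)).
- by apply: lin_scale; exact: lin_id.
- by move=> a r v; rewrite /= pinj_act ae.
- by move=> a r v; rewrite (linZ (@act_linear K _ a r)).
rewrite -/(wgen K n d j) /entry; case: pselect => [ij|nij]; first by case: cid.
rewrite scale0r; apply: (@weyl_bounded K n (d j - d i)); first by lia.
exact: (ge _ _ (@wgen_grade K n J d j) i).
Qed.

Definition entry_row i (u : P) : weyl K n := \sum_(j \in [set: J]) entry i j *: pfun j u.

Lemma entry_row_fin i u : finite_set [set j | entry i j *: pfun j (u : P) != 0].
Proof.
by apply: sub_finite_set (dsum_fin u) => j /=; apply: contra_neq; rewrite /pfun => ->; rewrite scaler0.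
Qed.

Lemma entry_row_linear i : linear (entry_row i).
Proof.
apply: fsum_linear => [j|u]; last exact: entry_row_fin.
exact: lin_scale (@pfun_linear K (weyl K n) J d j).
Qed.

Lemma entry_row_pinj i j x : entry_row i (pinj d j x) = entry i j *: x.
Proof.
rewrite /entry_row (fsum1 (i0 := j)) ?pfun_pinj_id // => k /negPf kj.
by rewrite pfun_pinj kj scaler0.
Qed.

Lemma hom_top i (u : P) : (forall j, d i < d j -> pfun j u = 0) -> pfun i (e u) = entry_row i u.
Proof.
move=> u0; have l1 := lin_comp (@pfun_linear K (weyl K n) J d i) le.
rewrite -[LHS]/((pfun i \o e) u) (psum_fsum u).
have [s us s0] := finsupp_seq (dsum_fin u).
have pz j : j \notin s -> pinj d j (pfun j u) = 0.
  move=> /s0 /= /negP; rewrite negbK => /eqP; rewrite /pfun => ->; exact: (lin0 (@pinj_linear K (weyl K n) J d j)).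
rewrite (fsumE us) // (lin_sum _ _ l1) (lin_sum _ _ (@entry_row_linear i)).
apply: eq_bigr => j _; rewrite entry_row_pinj /=.
have [ij|ji] := ltP (d i) (d j); last exact: entryE.
by rewrite u0 // (lin0 (@pinj_linear K (weyl K n) J d j)) (lin0 le) scaler0.
Qed.

Hypothesis ee : forall u, e (e u) = e u.

Definition entry_col j : J -> K^o := fun i => entry i j.

Definition below (k : nat) (u : P) : Prop := forall i, p0 + k%:Z <= d i -> pfun i u = 0.

Lemma below_ex u : exists k, below k u.
Proof.
have [s us s0] := finsupp_seq (dsum_fin u); have [k sk] := int_seq_bound d p0 s.
exists k => i; rewrite leNgt => /negP ik; have /s0 /= /negP : i \notin s by apply: contra_notN ik; exact: sk.
by rewrite negbK => /eqP.
Qed.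

Lemma hom_below k i u : below k.+1 u -> p0 + k%:Z <= d i -> pfun i (e u) = entry_row i u.
Proof. by move=> uk ki; apply: hom_top => j ij; apply: uk; lia. Qed.

Variable B : set J.
Hypothesis B_free : independent entry_col B.
Hypothesis B_gen : forall k, exists (s : seq J) (c : J -> K), [/\ uniq s, forall j, j \in s -> B j &
    entry_col k = \sum_(j <- s) c j *: entry_col j].

Notation iota := (@restrict_incl K (weyl K n) J d B).
Let li : linear iota := rep_hom_linear (@restrict_incl_hom K (weyl K n) J d B).
Let iota_out j q : ~ B j -> pfun j (iota q) = 0 := @pfun_restrict_out K (weyl K n) J d B j q.

(** On the coordinates of largest shift [e] acts by its scalar matrix, whose columns in [B] are
    independent; these coordinates vanish and the bound [k] drops. *)
Lemma idem_inj k q : below k (iota q) -> e (iota q) = 0 -> iota q = 0.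
Proof.
elim: k => [|k IH] qk eq0; first by apply: psumP => i; apply: qk; rewrite addr0.
apply: IH => // i0 ki0; have [ki|ki] := ltP (p0 + k%:Z) (d i0); first by apply: qk; lia.
have {ki} di0 : d i0 = p0 + k%:Z by lia.
have [Bi0|/iota_out -> //] := pselect (B i0).
(* A linear form nonzero on the coordinate at [i0] turns a relation with coefficients in W(n) into
   one with scalar coefficients. *)
apply/eqP/negPn/negP => q0; have [phi lphi /negP phi0] := functional_sep q0; apply: phi0.
have [s us s0] := finsupp_seq (dsum_fin (iota q)).
have {}s0 j : j \notin s -> pfun j (iota q) = 0.
  by move=> /s0 /= /negP; rewrite negbK => /eqP.
pose s' := [seq j <- s | `[< B j >] && (d j == d i0)].
have i0s : i0 \in s'.
  rewrite mem_filter eqxx asboolT //=; apply: contraNT q0 => /s0 -> //.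
apply/eqP; apply: (B_free (s := s') (c := fun j => phi (pfun j (iota q)))) i0s.
- exact: filter_uniq.
- by move=> j; rewrite mem_filter => /andP[/andP[/asboolP]].
apply/funext => i; rewrite fct_sumE.
have [dii|dii] := eqVneq (d i) (d i0); last first.
  rewrite big_seq big1 // => j; rewrite mem_filter => /andP[/andP[_ /eqP ji]] _.
  by change ((phi (pfun j (iota q)) : K) * entry i j = 0); rewrite entry0 ?mulr0 // ji.
have := hom_below (i := i) qk; rewrite dii di0 lexx eq0 => /(_ isT).
rewrite [pfun i 0](lin0 (@pfun_linear K (weyl K n) J d i)) /entry_row (fsumE us); last first.
  by move=> j /s0 ->; rewrite scaler0.
move=> /(congr1 phi); rewrite (lin0 lphi) (lin_sum _ _ lphi) => E; rewrite [RHS]E.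
rewrite big_filter big_mkcond; apply: eq_bigr => j _.
rewrite (linZ lphi); case: ifP => [_|]; first exact: mulrC.
have [Bj|/iota_out -> _] := pselect (B j); last by rewrite (lin0 lphi) scaler0.
rewrite asboolT //= => /negbT ji; rewrite entry0 ?scale0r //.
by rewrite dii eq_sym.
Qed.

Lemma entry_row_cover k j x : d j < p0 + k%:Z ->
  exists q, below k (iota q) /\ forall i, entry_row i (pinj d j x) = entry_row i (iota q).
Proof.
move=> jk; have [s [c [us sB sc]]] := B_gen j.
have [f fE] : exists f : J -> psum (weyl K n) (@restrict_shift J d B), forall a, B a -> iota (f a) = pinj d a x.
  have /choice[f fE] : forall a, exists q, B a -> iota q = pinj d a x.
    move=> a; have [/(restrict_incl_onto d x)[q qa]|nBa] := pselect (B a); first by exists q.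
    by exists 0.
  by exists f.
pose c' a := if d a == d j then c a else 0.
exists (\sum_(a <- s) c' a *: f a); rewrite (lin_sum _ _ li).
have iE : \sum_(a <- s) iota (c' a *: f a) = \sum_(a <- s) c' a *: pinj d a x.
  by apply: eq_big_seq => a /sB Ba; rewrite (linZ li) fE.
rewrite iE; split=> [i ki|i].
  rewrite (lin_sum _ _ (@pfun_linear K (weyl K n) J d i)) big1 // => a _.
  rewrite (linZ (@pfun_linear K (weyl K n) J d i)) pfun_pinj /c'.
  case: eqP => [aj|_]; last by rewrite scale0r.
  by case: eqP => [ia|_]; rewrite ?scaler0 //; move: ki; rewrite ia aj leNgt jk.
rewrite (lin_sum _ _ (@entry_row_linear i)) entry_row_pinj.
transitivity ((\sum_(a <- s) c' a * entry i a) *: x); last first.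
  by rewrite scaler_suml; apply: eq_bigr => a _; rewrite (linZ (@entry_row_linear i)) entry_row_pinj scalerA.
congr (_ *: x); have /(congr1 (fun f : J -> K^o => f i)) := sc; rewrite fct_sumE /entry_col => scE.
have [ij|ij] := eqVneq (d i) (d j); last first.
  rewrite entry0 // big1 // => a _; rewrite /c'; case: eqP => [aj|_]; last by rewrite mul0r.
  by rewrite entry0 ?mulr0 // aj.
rewrite scE; apply: eq_bigr => a _; rewrite /c'; case: eqP => // aj; rewrite mul0r.
by change (c a * entry i a = 0); rewrite entry0 ?mulr0 // ij eq_sym; apply/eqP.
Qed.

(** A [q] with the same rows as [u] makes e(u - iota q) lie below the next smaller bound. Induction
    applies to that vector, and idempotence removes the second [e]. *)
Lemma idem_sur k u : below k u -> exists q, e (iota q) = e u.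
Proof.
elim: k u => [|k IH] u uk.
  exists 0; rewrite (lin0 li); congr e; apply/esym/psumP => i; apply: uk.
  by rewrite addr0.
have [S SE] : exists S : subspace P, forall v, S v <->
    exists q, below k.+1 (iota q) /\ forall i, entry_row i v = entry_row i (iota q).
  apply: subspace_of => [|c v v' [q [qk qE]] [q' [qk' qE']]].
    exists 0; rewrite (lin0 li); split=> // i _; exact: (lin0 (@pfun_linear K (weyl K n) J d i)).
  exists (c *: q + q'); rewrite li; split=> [i ki|i]; last by rewrite !entry_row_linear qE qE'.
  by rewrite pfun_linear qk // qk' // scaler0 addr0.
have /SE[q [qk qE]] : S u.
  rewrite (psum_fsum u); have [s us s0] := finsupp_seq (dsum_fin u).
  rewrite (fsumE us) => [|j /s0 /= /negP]; last first.
    rewrite negbK => /eqP; rewrite /pfun => ->; exact: (lin0 (@pinj_linear K (weyl K n) J d j)).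
  apply: subspace_sum => j; have [jk|jk] := ltP (d j) (p0 + k.+1%:Z); last first.
    by rewrite uk // (lin0 (@pinj_linear K (weyl K n) J d j)); exact: subspace0.
  by apply/SE; exact: entry_row_cover.
have [|q' q'E] := IH (e (u - iota q)).
  move=> i ki; rewrite (hom_below (k := k)) //; last first.
    move=> a ka; rewrite (linB (@pfun_linear K (weyl K n) J d a)) uk // qk // subrr //.
  by rewrite (linB (@entry_row_linear i)) qE subrr.
exists (q' + q); rewrite (linD li) (linD le) q'E ee (linB le) subrK //.
Qed.

End Idempotent.

(* An idempotent of a sum of shifts of [weyl n] is a graded matrix, block triangular with respect
   to degrees; its image is free on columns forming a basis of the column space of the
   degree-preserving part. *)
Lemma idempotent_image (K : numFieldType) n (J : choiceType) (d : J -> int) p0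
    (e : wsum K n d -> wsum K n d) : (forall j, p0 <= d j) -> rep_hom e -> (forall u, e (e u) = e u) ->
  exists (I : choiceType) (d' : I -> int) (g : wsum K n d' -> wsum K n d),
    [/\ rep_hom g, injective g & forall p, (exists q, g q = p) <-> e p = p].
Proof.
move=> d_ge he ee; have [B [B_free B_gen]] := maximal_independent (entry_col he).
have hi := @restrict_incl_hom K (weyl K n) J d B; have hg := rep_hom_comp he hi.
exists (restrict_index B), (@restrict_shift J d B), (e \o @restrict_incl K (weyl K n) J d B).
split=> // [q q' E|p].
  have lg := rep_hom_linear hg; apply: subr0_eq.
  have eq0 : e (restrict_incl (q - q')) = 0.
    by rewrite -[LHS]/((e \o _) (q - q')) (linB lg) E subrr.
  have [k kq] := below_ex p0 (restrict_incl (q - q')).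
  have := idem_inj d_ge B_free kq eq0 => q0.
  by apply: psumP => i; rewrite -pfun_restrict_incl q0.
split=> [[q <-] /=|ep]; first exact: ee.
have [k kp] := below_ex p0 p; have [q qp] := idem_sur d_ge ee B_gen kp.
by exists q; rewrite /= qp.
Qed.

Section Preimage.
Variables (K : fieldType) (M N : gradedRep K) (f : M -> N) (hf : rep_hom f) (G : gradedSub N).

Definition preim_space : subspace M := preim_subspace (rep_hom_linear hf) G.

Fact preim_act a r v : preim_space v -> preim_space (act a r v).
Proof.
by move=> Gv; change (G (f (act a r v))); have [_ -> _] := hf; exact: gsub_act.
Qed.
Fact preim_component r v : preim_space v -> preim_space (component r v).
Proof.
by move=> Gv; change (G (f (component r v))); rewrite (hom_component hf); exact: gsub_component.
Qed.

Definition preim_sub : gradedSub M := GradedSub preim_act preim_component.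
End Preimage.

Section LayerEndo.
Variables (K : fieldType) (M P : gradedRep K) (F F' : gradedSub M) (R : M -> P -> Prop).
Hypothesis RL : is_layer F F' R.
Variable f : M -> M.
Hypotheses (hf : rep_hom f) (fF : forall v, F v -> F (f v)) (fF' : forall v, F' v -> F' (f v)).

Lemma layer_endo : exists2 e : P -> P, rep_hom e & forall v p, R v p -> R (f v) (e p).
Proof.
have [lf af gf] := hf.
have /choice[e eE] : forall p, exists q, exists v, R v p /\ R (f v) q.
  move=> p; have [v Rv] := layer_sur RL p; have [q Rq] := layer_tot RL (fF (layer_dom RL Rv)).
  by exists q, v.
have ReP v p : R v p -> R (f v) (e p).
  move=> Rv; have [u [Ru Rfu]] := eE p; apply: (layer_mod RL) Rfu.
  rewrite -(linB lf); apply: fF'; apply/(layer_ker RL); rewrite -(subrr p).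
  exact: (layerB RL).
exists e => //; split=> [c p q|a r p|r p Pp].
- have [[u Ru] [v Rv]] := (layer_sur RL p, layer_sur RL q).
  apply: (layer_uniq RL (ReP _ _ (layer_lin RL c Ru Rv))).
  by rewrite lf; apply: (layer_lin RL); exact: ReP.
- have [u Ru] := layer_sur RL p.
  apply: (layer_uniq RL (ReP _ _ (layer_act RL a r Ru))).
  by rewrite af; apply: (layer_act RL); exact: ReP.
- have [u Ru] := layer_sur RL p; apply: component_grade.
  have := layer_cmp RL r Ru; rewrite (grade_component_id Pp) => /ReP Rc.
  apply: (layer_uniq RL _ Rc); rewrite (hom_component hf).
  by apply: (layer_cmp RL); exact: ReP.
Qed.
End LayerEndo.

(** * Retracts of filtered modules *)

Section Retract.
Variables (K : numFieldType) (N : nat) (p0 : int) (X Y : gradedRep K) (i : Y -> X) (r : X -> Y).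
Hypotheses (hi : rep_hom i) (hr : rep_hom r) (ri : forall y, r (i y) = y).
Hypotheses (wX : wt N X) (bX : bounded_below X p0).

Notation F nu := (preim_sub hi (trunc (full X) nu)).

(** A generator of shift below [p0] would lift to a vector of that degree, which is 0. *)
Lemma layer_shift_bound (G G' : gradedSub X) nu (I : choiceType) (d : I -> int) :
  layer (wsum K nu d) G G' -> forall j, p0 <= d j.
Proof.
move=> [R RL] j; rewrite leNgt; apply/negP => jp.
have [v Rv] := layer_sur RL (wgen K nu d j).
have := layer_cmp RL (d j) Rv; rewrite (grade_component_id (@wgen_grade K nu I d j)).
rewrite (bX jp (grade_component (d j) v)) => /(layer_fun RL) w0.
have := @weyl_gen_neq0 K nu; rewrite -(pfun_pinj_id d j (weyl_gen K nu)) -/(wgen K nu d j) w0.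
by rewrite (lin0 (@pfun_linear K (weyl K nu) I d j)) eqxx.
Qed.

(** The idempotent formed by [r] and [i] preserves the truncations and induces an idempotent [e] on
    the layer. Vectors [i y] are fixed, so their classes lie in the image of [e], which [g]
    parametrises. *)
Lemma retract_layer nu : standard (full X) ->
  exists (I : choiceType) (d : I -> int), layer (wsum K nu d) (F nu) (F nu.+1).
Proof.
move=> sX; have [J [d L]] := sX nu; have d_ge := layer_shift_bound L.
have [R RL] := L; have hf := rep_hom_comp hi hr; have [li ai gi] := hi.
have fF m v : trunc (full X) m v -> trunc (full X) m ((i \o r) v) by exact: trunc_hom.
have [e he eE] := layer_endo RL hf (fF nu) (fF nu.+1).
have ee p : e (e p) = e p.
  have [v Rv] := layer_sur RL p; apply: (layer_uniq RL (eE _ _ (eE _ _ Rv))).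
  by rewrite /= ri; exact: eE.
have [I [d' [g [hg gi' gE]]]] := idempotent_image d_ge he ee.
have [lg ag gg] := hg.
exists I, d', (fun y q => R (i y) (g q)); split.
- by move=> c u v p q Ru Rv; rewrite li lg; exact: (layer_lin RL).
- by move=> y q; exact: (layer_dom RL).
- move=> y /(layer_tot RL)[p Rp]; have ep : e p = p.
    by apply: (layer_uniq RL _ Rp); have := eE _ _ Rp; rewrite /= ri.
  by have /gE[q qp] := ep; exists q; rewrite qp.
- move=> q; have /gE ep : exists q', g q' = g q by exists q.
  have [v Rv] := layer_sur RL (g q); exists (r v).
  by have := eE _ _ Rv; rewrite ep.
- by move=> a s y q Rq; rewrite ai ag; exact: (layer_act RL).
- by move=> s y q Rq; rewrite (hom_component hi) (hom_component hg); exact: (layer_cmp RL).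
- by move=> q; rewrite (lin0 li) => /(layer_fun RL); rewrite -(lin0 lg) => /gi'.
- by move=> y; rewrite (lin0 lg); exact: (layer_ker RL).
Qed.

Lemma chain_retract : chain (full X) -> chain (full Y).
Proof.
move=> cX; have sX := chain_standard wX cX; have [li _ _] := hi.
suff cF k : chain (F (N.+1 - k)).
  apply: chain_ext (cF N.+1) => y; split=> // _; rewrite subnn.
  by change (trunc (full X) 0 (i y)); exact: (@trunc_full K N X (full X) (i y) wX I).
elim: k => [|k IH].
  rewrite subn0; apply: chain0 => y /(trunc_big wX (ltnSn N)) iy.
  by rewrite -[y]ri iy; case: hr => lr _ _; exact: lin0.
have [kN|Nk] := ltnP k N.+1; last first.
  have E : (N.+1 - k.+1 = N.+1 - k)%N by lia.
  by rewrite E.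
have E : (N.+1 - k = (N.+1 - k.+1).+1)%N by lia.
have [I [d L]] := retract_layer (N.+1 - k.+1) sX.
by rewrite E in IH; exact: chainS L IH.
Qed.
End Retract.

(** * Tensor products of global Weyl modules *)

Section Multiplication.
Variable K : numFieldType.
Notation F := (fockRep K).
Notation V := (vecRep K).

Definition vmul (f : F) (v : V) : F := free_lift (fun l => create l f) v.

Lemma vmul_gen f l : vmul f (vgen K l) = create l f.
Proof. exact: free_lift_gen. Qed.

Lemma vmul_linear f : linear (vmul f).
Proof. exact: free_lift_linear. Qed.

Lemma vec_ext (U : lmodType K) (f g : V -> U) : linear f -> linear g ->
  (forall l, f (vgen K l) = g (vgen K l)) -> f =1 g.
Proof. exact: letters_ext. Qed.

Lemma vmul_linearl v : linear (vmul^~ v).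
Proof.
move=> c f g; move: v; apply: vec_ext => [||l]; first exact: vmul_linear.
  by apply: lin_add; [apply: lin_scale|]; exact: vmul_linear.
by rewrite !vmul_gen; exact: create_linear.
Qed.

Lemma act_vmul a r f v : act a r (vmul f v) = vmul (act a r f) v + vmul f (act a r v).
Proof.
move: v; apply: vec_ext => [||l].
- exact: lin_comp (@act_linear K F a r) (vmul_linear f).
- apply: lin_add; first exact: vmul_linear.
  exact: lin_comp (vmul_linear f) (@act_linear K V a r).
rewrite !vmul_gen act_vgen act_create [RHS]addrC; congr (_ + _).
rewrite /letter_act (lin_sum _ _ (vmul_linear f)); apply: eq_bigr => p _.
by rewrite (linZ (vmul_linear f)) vmul_gen.
Qed.

Lemma vmul_grade i j f v : grade F i f -> grade V j v -> grade F (i + j) (vmul f v).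
Proof.
move=> fi; apply: (span_min (S := preim_subspace (vmul_linear f) (grade F (i + j)))).
move=> _ [l <- ->]; change (grade F (i + l.2%:Z) (vmul f (vgen K l))); rewrite vmul_gen.
exact: fock_grade_create.
Qed.

Definition weyl_mul n : tensorRep (weyl K n) V -> weyl K n.+1 :=
  tensor_lift (fun u v => ret n.+1 (vmul (emb u) v)).

Fact weyl_mul_linearl n v : linear (fun u : weyl K n => ret n.+1 (vmul (emb u) v)).
Proof.
exact: lin_comp (@ret_linear K n.+1) (lin_comp (vmul_linearl v) (@emb_linear K n)).
Qed.
Fact weyl_mul_linearr n (u : weyl K n) : linear (fun v => ret n.+1 (vmul (emb u) v)).
Proof. exact: lin_comp (@ret_linear K n.+1) (vmul_linear _). Qed.

Lemma weyl_mul_tens n u v : @weyl_mul n (tens u v) = ret n.+1 (vmul (emb u) v).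
Proof. exact: tensor_liftE (@weyl_mul_linearl n) (@weyl_mul_linearr n) u v. Qed.

Lemma weyl_mul_hom n : rep_hom (@weyl_mul n).
Proof.
have [[_ _ ge] _ _ _ _] := emb_retP K n; have [_ [_ _ gr] _ _ _] := emb_retP K n.+1.
apply: tensor_lift_hom; [exact: weyl_mul_linearl|exact: weyl_mul_linearr| |].
  move=> a r u v; rewrite -ret_act act_vmul -emb_act; exact: (linD (@ret_linear K n.+1)).
by move=> i j u v ui vj; apply: gr; apply: vmul_grade => //; exact: ge.
Qed.

(** Multiplication after normalised polarisation is Euler's identity; by equivariance it is enough
    to check the generator. *)
Lemma weyl_mul_cartan n (v : weyl K n.+1) : weyl_mul (cartan 0 v) = v.
Proof.
have [lm am _] := @weyl_mul_hom n; have [lc cg ac _] := @cartanP K n 0.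
move: v; apply: (weyl_ext (T := fun a r (x : weyl K n.+1) => act a r x) (lin_comp lm lc)
  (@lin_id K (weyl K n.+1))) => [a r v|//|] /=; first by rewrite ac am.
rewrite cg weyl_mul_tens emb_gen vmul_gen /vac.
rewrite create_fw -[_ :: _]/(nseq n.+1 (la 0)); exact: ret_vac.
Qed.

Lemma cartan_hom n : rep_hom (@cartan K n 0).
Proof.
have [lc cg ac gc] := @cartanP K n 0; split=> // r v /gc.
by rewrite addr0.
Qed.

Lemma chain_wsum lambda (I : choiceType) (d : I -> int) : chain (full (wsum K lambda d)).
Proof.
apply: (chainS (F' := gsub0 _) (lambda := lambda) (d := d)); last by apply: chain0.
by apply: (layer_of_epi (@rep_hom_id K _)) => // p; exists p.
Qed.

Lemma chain_weyl lambda : chain (full (weyl K lambda)).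
Proof.
have A := weyl K lambda; pose d (_ : unit) : int := 0.
apply: (chain_iso (f := pinj d tt)) (chain_wsum lambda d).
- split; [exact: pinj_linear|exact: pinj_act|] => r u ur.
  by rewrite -[r](addr0 r); exact: (pinj_grade d tt ur).
- by move=> u v /(congr1 (pfun tt)); rewrite !pfun_pinj_id.
- by move=> x; exists (pfun tt x); apply: psumP => -[]; rewrite pfun_pinj_id.
Qed.

Lemma weyl0_act a r : act a r (weyl_gen K 0) = 0.
Proof.
apply: (can_inj (@embK K 0)); rewrite emb_act emb_gen (lin0 (@emb_linear K 0)).
exact: act_fock_nil.
Qed.

Lemma weyl0_line (u : weyl K 0) : exists c, u = c *: weyl_gen K 0.
Proof.
have [S SE] := line_subspace (weyl_gen K 0); apply/SE; move: u; apply: weyl_generated; first by apply/SE; exists 1; rewrite scale1r.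
move=> a r u /SE[c ->]; apply/SE; exists 0.
by rewrite (linZ (@act_linear K _ a r)) weyl0_act scaler0 scale0r.
Qed.

(** W(0) is the trivial one-dimensional module, so tensoring with its generator is an
    isomorphism. *)
Lemma chain_weyl0 M : chain (full M) -> chain (full (tensorRep M (weyl K 0))).
Proof.
pose w := weyl_gen K 0; pose f (v : M) : tensorRep M (weyl K 0) := tens v w.
have lf : linear f := tens_linearl w.
apply: (chain_mono (f := f)).
- split=> // [a r v|r v Mv]; first by rewrite /f act_tens weyl0_act (lin0 (tens_linear _)) addr0.
  by rewrite -[r]addr0; apply: grade_tens => //; exact: weyl_gen_grade.
- have [phi lphi phi0] := functional_sep (@weyl_gen_neq0 K 0).
  pose g := tensor_lift (fun (v : M) (u : weyl K 0) => (phi u : K) *: v).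
  have gl u : linear (fun v : M => (phi u : K) *: v) by apply: lin_scale.
  have gr v : linear (fun u : weyl K 0 => (phi u : K) *: v).
    by move=> c u u'; rewrite lphi scalerDl scalerA.
  move=> v v' /(congr1 g); rewrite /g /f !tensor_liftE //.
  exact: (scalerI phi0).
- have [S SE] : exists S : subspace (tensorRep M (weyl K 0)), forall t, S t <-> exists v, f v = t.
    exists (im_subspace lf (full M)) => t; split=> [[v _ ->]|[v <-]]; by exists v.
  move=> t; apply/SE; move: t; apply: tensor_ind => v u; apply/SE.
  have [c ->] := weyl0_line u; exists (c *: v).
  by rewrite (linZ (tens_linear v)) (linZ lf).
Qed.

Lemma chain_weyl_tensor lambda mu : chain (full (tensorRep (weyl K lambda) (weyl K mu))).
Proof.
elim: mu => [|mu IH]; first exact: chain_weyl0 (chain_weyl lambda).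
have h1 := tensor_map_hom (@rep_hom_id K (weyl K lambda)) (cartan_hom mu).
have h2 := tensor_map_hom (@rep_hom_id K (weyl K lambda)) (weyl_mul_hom mu).
have hi := rep_hom_comp (@tensor_assocl_hom K (weyl K lambda) (weyl K mu) V) h1.
have hr := rep_hom_comp h2 (@tensor_assocr_hom K (weyl K lambda) (weyl K mu) V).
have [lc _ _] := cartan_hom mu; have [lm _ _] := weyl_mul_hom mu.
have mc : tensor_map (@id (weyl K lambda)) (@weyl_mul mu) \o tensor_map (@id (weyl K lambda)) (cartan 0) =1 id.
  have lL := lin_comp (rep_hom_linear h2) (rep_hom_linear h1).
  apply: (tensor_ext lL (@lin_id K (tensorRep (weyl K lambda) (weyl K mu.+1)))) => u v /=.
  by rewrite (tensor_mapE _ lc) // (tensor_mapE _ lm) // weyl_mul_cartan.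
apply: (chain_retract hi hr).
- by move=> t; apply: etrans (mc t); congr tensor_map; exact: tensor_assoclK.
- exact: (wt_tensor (wt_tensor (@weyl_wt K lambda) (@weyl_wt K mu)) (@vec_wt K)).
- exact: (bounded_tensor (bounded_tensor (@weyl_bounded K lambda) (@weyl_bounded K mu)) (@vec_bounded K)).
(* Each layer W(nu) of W(lambda) (x) W(mu) turns into W(nu) (x) V. *)
- apply: chain_tensorl IH _ => nu I d; apply: chain_psum_tensor; exact: chain_weyl_vec.
Qed.

Lemma chain_tensor_full (M N : gradedRep K) : chain (full M) -> chain (full N) ->
  chain (full (tensorRep M N)).
Proof. exact: chain_tensor chain_weyl_tensor. Qed.
End Multiplication.

(** * From chains to filtrations by global Weyl modules *)

Section Subquotients.
Variable K : fieldType.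
Implicit Types M P Q : gradedRep K.

Lemma subquot_layer M (S S' : gradedSub M) : (forall v, S' v -> S v) ->
  layer (subquot S S') S S'.
Proof.
move=> SS'; have [q [hq q0 qs]] := quot_map (restrict S S'); have [lq aq _] := hq.
exists (fun v p => exists2 u : subRep S, val u = v & q u = p); split.
- move=> c _ _ _ _ [u <- <-] [u' <- <-]; exists (c *: u + u'); last exact: lq.
  exact: (@val_vsub_linear K M S).
- by move=> _ _ [u <- _]; exact: vsubP.
- by move=> v Sv; exists (q (mkvsub Sv)), (mkvsub Sv).
- by move=> p; have [u <-] := qs p; exists (val u), u.
- by move=> a r _ _ [u <- <-]; exists (act a r u); last exact: aq.
- move=> r _ _ [u <- <-]; exists (component r u); first exact: val_component.
  exact: (hom_component hq).
- move=> p [u u0 <-]; have -> : u = 0 by apply: val_inj; rewrite u0.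
  exact: lin0 lq.
- move=> v; split=> [S'v|[u <-] /q0 //].
  by exists (mkvsub (SS' _ S'v)) => //; apply/q0.
Qed.

Lemma layer_rep_iso M P Q (F F' : gradedSub M) : layer P F F' -> layer Q F F' -> rep_iso P Q.
Proof.
suff H (A B : gradedRep K) (R : M -> A -> Prop) (T : M -> B -> Prop) :
    is_layer F F' R -> is_layer F F' T ->
    exists2 f : A -> B, rep_hom f & forall v p, R v p -> T v (f p).
  move=> [R RL] [T TL]; have [[f hf fE] [g _ gE]] := (H _ _ _ _ RL TL, H _ _ _ _ TL RL).
  exists f => //; exists g => p.
    have [v Rv] := layer_sur RL p; exact: (layer_uniq RL (gE _ _ (fE _ _ Rv)) Rv).
  have [v Tv] := layer_sur TL p; exact: (layer_uniq TL (fE _ _ (gE _ _ Tv)) Tv).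
move=> RL TL; have /choice[f fE] : forall p, exists q, exists2 v, R v p & T v q.
  move=> p; have [v Rv] := layer_sur RL p.
  by have [q Tq] := layer_tot TL (layer_dom RL Rv); exists q, v.
have fT v p : R v p -> T v (f p).
  move=> Rv; have [u Ru Tu] := fE p; apply: (layer_mod TL) Tu.
  by apply/(layer_ker RL); rewrite -(subrr p); exact: (layerB RL).
exists f => //; split=> [c p p'|a r p|r p Pp].
- have [[v Rv] [v' Rv']] := (layer_sur RL p, layer_sur RL p').
  apply: (layer_uniq TL (fT _ _ (layer_lin RL c Rv Rv'))).
  by apply: (layer_lin TL); exact: fT.
- have [v Rv] := layer_sur RL p; apply: (layer_uniq TL (fT _ _ (layer_act RL a r Rv))).
  by apply: (layer_act TL); exact: fT.
- have [v Rv] := layer_sur RL p; apply: component_grade.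
  have := layer_cmp RL r Rv; rewrite (grade_component_id Pp) => /fT Tc.
  by apply: (layer_uniq TL _ Tc); apply: (layer_cmp TL); exact: fT.
Qed.

Lemma weyl_filtered_chain M : weyl_filtered M -> chain (full M).
Proof.
case=> k [F [F0 Fk FS]]; suff cF j : chain (F (k.+1 - j)%N).
  by apply: chain_ext (cF k.+1) => v; rewrite subnn; split.
elim: j => [|j IH]; first by rewrite subn0; apply: chain0.
have [jk|kj] := ltnP j k.+1; last first.
  have E : (k.+1 - j.+1 = k.+1 - j)%N by lia.
  by rewrite E.
have E : (k.+1 - j = (k.+1 - j.+1).+1)%N by lia.
have [|sub [lambda [m [f hf fb]]]] := FS (k.+1 - j.+1)%N; first by lia.
rewrite E in IH; apply: (chainS (lambda := lambda) _ IH).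
exact: (layer_target hf fb (subquot_layer sub)).
Qed.

Lemma psum_reindex (A : gradedRep K) (I J : choiceType) (d : I -> int) (e : J -> int)
    (phi : J -> I) : bijective phi -> (forall j, d (phi j) = e j) ->
  rep_iso (psum A d) (psum A e).
Proof.
move=> [psi psiK phiK] de.
have ff (u : psum A d) : finite_set [set j | pfun (phi j) u != 0].
  rewrite (_ : mkset _ = phi @^-1` [set i | pfun i u != 0]) //.
  by apply: finite_preimage; [move=> x y _ _; exact: (can_inj psiK)|exact: dsum_fin u].
have gg (u : psum A e) : finite_set [set i | pfun (psi i) u != 0].
  rewrite (_ : mkset _ = psi @^-1` [set j | pfun j u != 0]) //.
  by apply: finite_preimage; [move=> x y _ _; exact: (can_inj phiK)|exact: dsum_fin u].
exists (fun u => mkpsum e (ff u)).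
  split=> [c u v|a r u|r u ur j]; [exact: psumP|exact: psumP|].
  by have := ur (phi j); rewrite /= de.
exists (fun u => mkpsum d (gg u)) => u; apply: psumP => i.
  by rewrite -[LHS]/(pfun (phi (psi i)) u) phiK.
by rewrite -[LHS]/(pfun (psi (phi i)) u) psiK.
Qed.

(** Enumerating the fibres of [d] brings an arbitrary index type to the form required by
    [weyl_sum]. *)
Lemma finite_fibres_reindex (A : gradedRep K) (I : choiceType) (d : I -> int) :
  (forall p, finite_set [set i | d i = p]) ->
  exists m : int -> nat, rep_iso (psum A d) (psum A (fun t : {p : int & 'I_(m p)} => tag t)).
Proof.
move=> fin; pose s p : seq I := fset_set [set i | d i = p].
have sP p i : i \in s p <-> d i = p by rewrite in_fset_set // inE.
exists (fun p => size (s p)).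
pose phi (t : {p : int & 'I_(size (s p))}) : I := tnth (in_tuple (s (tag t))) (tagged t).
have dphi t : d (phi t) = tag t by apply/sP; exact: mem_tnth.
have phi_inj : injective phi.
  move=> [p j] [p' j'] E; have := dphi (existT _ p j); rewrite E dphi /= => pp'.
  case: p / pp' j E => j; rewrite /phi /= => /(elimT (tuple_uniqP _)) -> //.
  exact: fset_uniq.
have sd i : (index i (s (d i)) < size (s (d i)))%N by rewrite index_mem; apply/sP.
pose psi i : {p : int & 'I_(size (s p))} := Tagged (fun p => 'I_(size (s p))) (Ordinal (sd i)).
have psiK i : phi (psi i) = i by rewrite /phi (tnth_nth i) nth_index //; apply/sP.
apply: (@psum_reindex A I _ d _ phi) => //; exists psi => // t.
by apply: phi_inj; exact: psiK.
Qed.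

Lemma dependent_of_span (V : lmodType K) (n m : nat) (b : 'I_n -> V) (v : 'I_m -> V) :
  (n < m)%N -> (forall k, exists c : 'I_n -> K, v k = \sum_i c i *: b i) ->
  exists2 a : 'I_m -> K, (exists k, a k != 0) & \sum_k a k *: v k = 0.
Proof.
move=> nm /choice[c cE]; pose C : 'M[K]_(m, n) := \matrix_(k, i) c k i.
pose a := nz_row (kermx C).
have a0 : a != 0.
  rewrite nz_row_eq0 -mxrank_eq0 mxrank_ker subn_eq0 -ltnNge.
  exact: leq_ltn_trans (rank_leq_col C) nm.
have aC : a *m C = 0 by apply/sub_kermxP; exact: nz_row_sub.
exists (fun k => a 0 k); first by have /rV0Pn := a0.
under eq_bigr => k _ do rewrite cE scaler_sumr.
rewrite exchange_big big1 // => i _.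
under eq_bigr => k _ do rewrite scalerA.
rewrite -scaler_suml; have /rowP /(_ i) := aC; rewrite !mxE.
under eq_bigr => k _ do rewrite mxE.
by move=> ->; rewrite scale0r.
Qed.

Lemma layer_sum M P (F F' : gradedSub M) (R : M -> P -> Prop) (I : Type) (s : seq I)
    (f : I -> M) (g : I -> P) : is_layer F F' R -> (forall i, R (f i) (g i)) ->
  R (\sum_(i <- s) f i) (\sum_(i <- s) g i).
Proof.
move=> RL Rfg; elim/big_ind2: _ => //; first exact: (layer0 RL).
by move=> u p v q; exact: (layerD RL).
Qed.
End Subquotients.

Section Filtered.
Variable K : numFieldType.
Implicit Types X : gradedRep K.

(** With infinitely many summands of shift [p], more generators than the dimension of [grade X p]
    would lift to that grade; a linear relation between the lifts would descend to the independent
    generators. *)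
Lemma layer_finite_fibres X (F F' : gradedSub X) lambda (I : choiceType) (d : I -> int) :
  layer (wsum K lambda d) F F' -> (forall p, fin_dim (grade X p)) ->
  forall p, finite_set [set i | d i = p].
Proof.
move=> [R RL] fX p; apply: contrapT => inf.
have [n [b [_ bX]]] := fX p.
have [B Bp nB] := infinite_set_fset n.+1 inf.
pose t (k : 'I_#|` B|) : I := tnth (in_tuple (enum_fset B)) k.
have tB k : d (t k) = p by apply: Bp; exact: mem_tnth.
have t_inj : injective t by apply/tuple_uniqP; exact: fset_uniq.
have /choice[v vE] : forall k, exists v, grade X p v /\ R v (wgen K lambda d (t k)).
  move=> k; have [v Rv] := layer_sur RL (wgen K lambda d (t k)).
  exists (component p v); split; first exact: grade_component.
  have := layer_cmp RL p Rv; rewrite -(tB k).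
  by rewrite (grade_component_id (@wgen_grade K lambda I d (t k))).
have [k|a [k0 a0] av0] := @dependent_of_span K X n _ b v nB.
  by apply: bX; have [] := vE k.
have := layer_sum (index_enum _) RL (fun k => layerZ RL (a k) (vE k).2).
rewrite av0 => /(layer_fun RL) /(congr1 (pfun (t k0))).
rewrite (lin_sum _ _ (@pfun_linear K (weyl K lambda) I d (t k0))) (bigD1 k0) // big1 => [|k /andP[_ kk0]].
  rewrite [X in X = _]addr0 (linZ (@pfun_linear K (weyl K lambda) I d (t k0))) /wgen pfun_pinj_id.
  rewrite (lin0 (@pfun_linear K (weyl K lambda) I d (t k0))) => /eqP.
  by rewrite scaler_eq0 (negPf a0) (negPf (@weyl_gen_neq0 K lambda)).
rewrite (linZ (@pfun_linear K (weyl K lambda) I d (t k0))) pfun_pinj.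
by rewrite (inj_eq t_inj) eq_sym (negPf kk0) scaler0.
Qed.

Lemma chain_weyl_filtered X : (forall p, fin_dim (grade X p)) -> chain (full X) -> weyl_filtered X.
Proof.
move=> fX; suff H (F : gradedSub X) : chain F -> exists (k : nat) (G : nat -> gradedSub X),
    [/\ forall v, F v <-> G 0 v, forall v, G k.+1 v -> v = 0
      & forall s, (s <= k)%N -> exists lambda m, layer (weyl_sum K lambda m) (G s) (G s.+1)].
  move=> /H[k [G [G0 Gk GS]]]; exists k, G; split=> // [v|s sk]; first exact/G0.
  have [lambda [m L]] := GS s sk; have sub : forall v, G s.+1 v -> G s v.
    by have [R RL] := L; exact: layer_sub RL.
  by split=> //; exists lambda, m; exact: layer_rep_iso (subquot_layer sub) L.
elim=> {F} [F F0|F F' lambda I d L _ [k [G [G0 Gk GS]]]].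
  (* [weyl_filtered] counts at least one layer, so the zero module gets an empty sum. *)
  exists 0, (fun=> F); split=> // s _; exists 0, (fun=> 0%N).
  by apply: layer_refl => // p; apply: dsumP => -[q []].
have [m [f hf fb]] := finite_fibres_reindex (weyl K lambda) (layer_finite_fibres L fX).
exists k.+1, (fun s => if s is s'.+1 then G s' else F); split=> // -[_|s sk]; last exact: GS.
exists lambda, m; apply: layer_ext (layer_target hf fb L) => // v.
Qed.
End Filtered.

Section FiniteDimension.
Variable K : fieldType.
Implicit Types V : lmodType K.

Lemma fin_dim_seq V (S : subspace V) : fin_dim S <->
  exists2 s : seq V, forall v, v \in s -> S v & forall v, S v -> span [set u | u \in s] v.
Proof.
split=> [[n [b [Sb bS]]]|[s sS Ss]].
  exists (codom b) => [v /codomP[i ->] //|v /bS[c ->]].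
  apply: subspace_sum => i; apply: subspaceZ; apply: span_gen; exact: codom_f.
exists (size s), (fun i => s`_i); split=> [i|v /Ss]; first exact/sS/mem_nth.
have [T TE] : exists T : subspace V, forall v, T v <-> exists c : 'I_(size s) -> K, v = \sum_i c i *: s`_i.
  apply: subspace_of => [|a _ _ [c ->] [c' ->]].
    by exists (fun=> 0); rewrite big1 // => i _; rewrite scale0r.
  exists (fun i => a * c i + c' i); rewrite scaler_sumr -big_split.
  by apply: eq_bigr => i _; rewrite scalerDl scalerA.
move=> vs; apply/TE; move: vs; apply: span_min => u /= us; apply/TE.
have iu : (index u s < size s)%N by rewrite index_mem.
exists (fun i => (i == Ordinal iu)%:R); rewrite (bigD1 (Ordinal iu)) //= eqxx scale1r nth_index //.
by rewrite big1 ?addr0 // => i /negPf ->; rewrite scale0r.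
Qed.
End FiniteDimension.

Section Boundedness.
Variable K : numFieldType.
Implicit Types M N X : gradedRep K.

(** The lower bounds leave finitely many i for degree n, those with p <= i <= n - q; the list [r]
    contains them. *)
Lemma tensor_fin_dim M N p q : bounded_below M p -> bounded_below N q ->
  (forall i, fin_dim (grade M i)) -> (forall j, fin_dim (grade N j)) ->
  forall n, fin_dim (grade (tensorRep M N) n).
Proof.
move=> bM bN fM fN n; apply/fin_dim_seq.
have /choice[sM sMP] : forall i, exists s : seq M, (forall v, v \in s -> grade M i v) /\
    forall v, grade M i v -> span [set u | u \in s] v.
  by move=> i; have /fin_dim_seq[s h1 h2] := fM i; exists s.
have /choice[sN sNP] : forall i, exists s : seq N, (forall v, v \in s -> grade N i v) /\
    forall v, grade N i v -> span [set u | u \in s] v.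
  by move=> i; have /fin_dim_seq[s h1 h2] := fN i; exists s.
pose r := [seq p + k%:Z | k <- iota 0 (absz (n - q - p)%R).+1].
pose s i := [seq tens u w | u <- sM i, w <- sN (n - i)].
exists (flatten [seq s i | i <- r]).
  move=> t /flatten_mapP[i _ /allpairsP[[u w] [ui wi ->]]].
  rewrite -[n](subrKC i); apply: grade_tens; [exact: (sMP i).1|exact: (sNP _).1].
move=> t; set A := span [set _ | _]; apply: (span_min (S := A)) => _ [i [j [v [w [Mv Nw ij ->]]]]].
have [ip|pi] := ltP i p; first by rewrite (bM _ ip _ Mv) (lin0 (tens_linearl w)); exact: subspace0.
have [jq|qj] := ltP j q; first by rewrite (bN _ jq _ Nw) (lin0 (tens_linear v)); exact: subspace0.
have ir : i \in r.
  by apply/mapP; exists (absz (i - p)%R); [rewrite mem_iota|]; lia.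
have jE : j = n - i by rewrite -ij addrC addKr.
move: ((sMP i).2 v Mv); apply: (span_min (S := preim_subspace (tens_linearl w) A)) => u us.
rewrite jE in Nw; move: ((sNP (n - i)).2 w Nw).
apply: (span_min (S := preim_subspace (tens_linear u) A)) => u' u's.
apply: span_gen; apply/flatten_mapP; exists i => //.
by apply/allpairsP; exists (u, u').
Qed.

(** A vector of weight beyond lambda is 0 in a sum of shifts of W(lambda), so it passes to the next
    member of the chain. *)
Lemma chain_weights X (F : gradedSub X) : chain F ->
  exists N : nat, forall (mu : int) v, F v -> wvec mu v -> (N < `|mu|)%N -> v = 0.
Proof.
elim=> {F} [F F0|F F' lambda I d [R RL] _ [N NF]]; first by exists 0%N => mu v /F0.
exists (maxn N lambda) => mu v Fv vmu; rewrite gtn_max => /andP[Nmu lmu].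
apply: (NF mu _ _ vmu Nmu); apply/(layer_ker RL); have [p Rp] := layer_tot RL Fv.
rewrite -[0](_ : p = 0) //; apply: (wt_big (N := lambda) (k := mu)) => //.
  exact: (wt_psum (@weyl_wt K lambda)).
have := layer_act RL sl2_h 0 Rp; rewrite vmu => /(layer_uniq RL); apply.
exact: (layerZ RL).
Qed.

Lemma chain_finite_weights X : chain (full X) ->
  finite_set [set mu : int | exists2 v : X, @weight_space K X mu v & v != 0].
Proof.
move=> /chain_weights[N NX]; apply: sub_finite_set (finite_seq (irange N)) => mu [v vmu v0] /=.
by rewrite mem_irange leqNgt; apply: contra_neqN v0; apply: NX.
Qed.

Lemma weyl_filtered_tensor M N : I_bdd M -> I_bdd N -> weyl_filtered M -> weyl_filtered N ->
  I_bdd (tensorRep M N) /\ weyl_filtered (tensorRep M N).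
Proof.
move=> [[p bM] fM _] [[q bN] fN _] /weyl_filtered_chain cM /weyl_filtered_chain cN.
have cT := chain_tensor_full cM cN; have fT := tensor_fin_dim bM bN fM fN.
split; last exact: chain_weyl_filtered.
split=> //; first by exists (p + q); exact: bounded_tensor bM bN.
exact: chain_finite_weights.
Qed.
End Boundedness.

Theorem corollary3p8 (R : realType) (M N : gradedRep (complex R))
    (M_bdd : I_bdd M) (N_bdd : I_bdd N)
    (M_filt : weyl_filtered M) (N_filt : weyl_filtered N) :
  I_bdd (tensorRep M N) /\ weyl_filtered (tensorRep M N).
Proof. exact: (@weyl_filtered_tensor (complex R)). Qed.
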